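(* There is a one-to-one correspondence between the set $\mathbb{Q}_{+}$ of positive rational numbers and the quotient $\mathscr{C}_{\mathscr{B}_{av}}/(\mathbb{Z}/2\mathbb{Z}\times\mathbb{Z}/2\mathbb{Z})$, where the $i$-th factor $\mathbb{Z}/2\mathbb{Z}$ identifies $z_i$ with $-z_i$ ($i=1,2$).
   Context: $S^1=\mathbb{R}/\mathbb{Z}$; $\|u\|=\left(\int_0^1u(\tau)^2d\tau\right)^{1/2}$ is the $L^2$-norm; $z_i^2$ denotes the pointwise square, so $\|z_i^2\|^2=\int_0^1 z_i^4\,d\tau$; $z_i'$ is the derivative in $\tau$. Let $\tilde{\mathscr{H}}^1_{av}=\{z=(z_1,z_2)\in H^1(S^1,\mathbb{R}^2):\|z_1\|>0,\ \|z_2\|>0\}$. The torus $\mathbb{T}^2=S^1\times S^1$ acts on it by independent time shifts $(z_1(\cdot),z_2(\cdot))\mapsto(z_1(\cdot+\theta_1),z_2(\cdot+\theta_2))$, and $\mathscr{H}^1_{av}=\tilde{\mathscr{H}}^1_{av}/\mathbb{T}^2$. The functional $$\mathscr{B}_{av}(z_1,z_2)=\sum_{i=1}^2\left(2\|z_i\|^2\|z_i'\|^2+\frac{2}{\|z_i\|^2}\right)-\frac{\|z_1\|^2\|z_2\|^2}{\|z_1^2\|^2\|z_2\|^2+\|z_2^2\|^2\|z_1\|^2}$$ is invariant under this action and is regarded as a functional $\mathscr{B}_{av}:\mathscr{H}^1_{av}\to\mathbb{R}$. $\mathscr{C}_{\mathscr{B}_{av}}\subset\mathscr{H}^1_{av}$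 denotes the set of all its critical points, i.e. the set of $\mathbb{T}^2$-orbits of pairs $(z_1,z_2)\in\tilde{\mathscr{H}}^1_{av}$ at which the differential of this functional on $\tilde{\mathscr{H}}^1_{av}$ vanishes. The group $\mathbb{Z}/2\mathbb{Z}\times\mathbb{Z}/2\mathbb{Z}$ acts by sign changes $(z_1,z_2)\mapsto(\pm z_1,\pm z_2)$. *)

(* Defs.v *)
From HB Require Import structures.
From mathcomp Require Import all_boot all_order all_algebra.
From mathcomp Require Import all_classical all_reals all_analysis.
From mathcomp Require Import measurable_realfun zify ring lra.

Set Implicit Arguments.
Unset Strict Implicit.
Unset Printing Implicit Defensive.

Import Order.TTheory GRing.Theory Num.Theory.
Import numFieldNormedType.Exports.

Local Open Scope classical_set_scope.
Local Open Scope ring_scope.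

(* A function on S^1 = R/Z is a 1-periodic function R -> R; integrals over S^1
   are integrals over the fundamental domain [0, 1]. *)

Section sobolev_definitions.
Context {R : realType}.
Local Notation mu := (@lebesgue_measure R).
Local Notation I01 := (`[0%R, 1%R]%classic : set R).
Implicit Types g u z phi : R -> R.

Definition integral01 u : R := \int[mu]_(t in I01) u t.

Definition L2norm u : R := Num.sqrt (integral01 (fun t => u t ^+ 2)).

Definition square_integrable u : Prop :=
  measurable_fun I01 u /\
  mu.-integrable I01 (EFin \o (fun t => u t ^+ 2)).

(* Testing against C^1 or against smooth functions gives the same weak
   derivatives. *)
Definition test_function phi : Prop :=
  [/\ periodic phi 1, forall t, derivable phi t 1 & continuous (derive1 phi)].

Definition is_weak_derivative z g : Prop :=
  square_integrable g /\
  forall phi, test_function phi ->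
    integral01 (fun t => z t * derive1 phi t) =
    - integral01 (fun t => g t * phi t).

(* H^1(S^1, R): every Sobolev class has exactly one continuous representative,
   and the class is identified with it. *)
Definition sobolev_H1 : {pred R -> R} := fun z =>
  `[< [/\ periodic z 1, continuous z & exists g, is_weak_derivative z g] >].

(* Weak derivatives are unique only almost everywhere on [0, 1]
   (weak_derivative_unique below); this picks one of them, and it is only used
   through its L^2-norm. *)
Definition weak_derivative z : R -> R := xget 0 [set g | is_weak_derivative z g].

Definition H1norm z : R :=
  Num.sqrt (L2norm z ^+ 2 + L2norm (weak_derivative z) ^+ 2).

End sobolev_definitions.

Section sobolev_theory.
Context {R : realType}.
Local Notation mu := (@lebesgue_measure R).
Local Notation I01 := (`[0%R, 1%R]%classic : set R).
Implicit Types f g u z w phi : R -> R.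

Local Notation integ f := (mu.-integrable I01 (EFin \o f)).

Lemma integ_scale (a : R) f : integ f -> integ (fun t => a * f t).
Proof.
move=> fi; rewrite (_ : _ \o _ = (fun t => a%:E * (EFin \o f) t)%E).
  exact: integrableZl.
by apply/funext.
Qed.

Lemma integ_mul f g : square_integrable f -> square_integrable g ->
  integ (fun t => f t * g t).
Proof.
move=> [mf if2] [mg ig2].
have h : integ (fun t => f t ^+ 2 + g t ^+ 2).
  rewrite (_ : _ \o _ = (EFin \o (fun t => f t ^+ 2)) \+ (EFin \o (fun t => g t ^+ 2))); last first.
    by apply/funext => t /=; rewrite EFinD.
  by apply: integrableD.
apply: le_integrable h => //.
  by apply/measurable_EFinP; exact: measurable_funM.
move=> t _ /=; rewrite lee_fin.
rewrite (ger0_norm (addr_ge0 (sqr_ge0 _) (sqr_ge0 _))) ler_norml.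
by apply/andP; split; nra.
Qed.

Lemma square_integrable_continuous f : continuous f -> square_integrable f.
Proof.
move=> cf; split.
  by apply: measurable_funTS; exact: continuous_measurable_fun.
apply: continuous_compact_integrable; first exact: segment_compact.
apply: continuous_subspaceT => x.
under eq_fun do rewrite expr2.
by apply: cvgM; exact: cf.
Qed.

Lemma square_integrable0 : square_integrable (0 : R -> R).
Proof.
by apply: (@square_integrable_continuous (cst 0)) => x; exact: cvg_cst.
Qed.

Lemma integ_square_integrable f : square_integrable f -> integ f.
Proof.
move=> sf.
have s1 : square_integrable (cst 1 : R -> R).
  by apply: square_integrable_continuous => x; exact: cvg_cst.
have := integ_mul sf s1.
by rewrite (_ : (fun t => f t * _) = f)//; apply/funext => t /=; rewrite mulr1.
Qed.

Lemma square_integrable_lin (a : R) f g : square_integrable f ->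
  square_integrable g -> square_integrable (a *: (f : R -> R^o) + g).
Proof.
move=> sf sg; split.
  apply: measurable_funD; last exact: sg.1.
  by apply: measurable_funM => //; exact: sf.1.
rewrite (_ : _ \o _ = (EFin \o (fun t => a ^+ 2 * f t ^+ 2)) \+
  ((EFin \o (fun t => 2 * a * (f t * g t))) \+ (EFin \o (fun t => g t ^+ 2)))); last first.
  apply/funext => t /=; rewrite -!EFinD; congr EFin.
  rewrite (_ : (_ + _) t = a * f t + g t)//; ring.
apply: integrableD => //; last apply: integrableD => //; last exact: sg.2.
- by apply: integ_scale; exact: sf.2.
- by apply: integ_scale; exact: integ_mul.
Qed.

Lemma integral01_lin (a : R) f g : integ f -> integ g ->
  integral01 (fun t => a * f t + g t) = a * integral01 f + integral01 g.
Proof.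
move=> fi gi; rewrite /integral01 RintegralD//; first by rewrite RintegralZl.
exact: integ_scale.
Qed.

Lemma test_function_cont phi : test_function phi -> continuous phi.
Proof.
by case=> _ d _ x; apply: differentiable_continuous; apply/derivable1_diffP.
Qed.

Lemma is_weak_derivative_lin (a : R) z w f g : continuous z -> continuous w ->
  is_weak_derivative z f -> is_weak_derivative w g ->
  is_weak_derivative (a *: (z : R -> R^o) + w) (a *: (f : R -> R^o) + g).
Proof.
move=> cz cw [sf zf] [sg wg]; split; first exact: square_integrable_lin.
move=> phi tphi.
have sphi := square_integrable_continuous (test_function_cont tphi).
have sdphi : square_integrable (derive1 phi).
  by case: tphi => _ _; exact: square_integrable_continuous.
have sz := square_integrable_continuous cz.
have sw := square_integrable_continuous cw.
under [in LHS]eq_fun do rewrite mulrDl -mulrA.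
under [in RHS]eq_fun do rewrite mulrDl -mulrA.
rewrite (integral01_lin _ (integ_mul sz sdphi) (integ_mul sw sdphi)).
rewrite (integral01_lin _ (integ_mul sf sphi) (integ_mul sg sphi)).
by rewrite zf// wg//; ring.
Qed.

Lemma sobolev_H1P z : z \in sobolev_H1 ->
  [/\ periodic z 1, continuous z & is_weak_derivative z (weak_derivative z)].
Proof.
move=> /asboolP[pz cz [g zg]]; split=> //.
rewrite /weak_derivative; case: xgetP => // /(_ g); exact.
Qed.

Lemma sobolev_H1_submod_closed :
  submod_closed (sobolev_H1 : {pred R -> R^o}).
Proof.
split=> [|a z w].
  apply/asboolP; split => //; first by move=> x; exact: cvg_cst.
  exists 0; split; first exact: square_integrable0.
  move=> phi _; rewrite /integral01.
  under [in LHS]eq_Rintegral do rewrite mul0r.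
  under [in RHS]eq_Rintegral do rewrite mul0r.
  by rewrite Rintegral_cst// mul0r oppr0.
move=> /asboolP[pz cz [f zf]] /asboolP[pw cw [g wg]].
apply/asboolP; split.
- by move=> t; rewrite -[LHS]/(a * z (t + 1) + w (t + 1)) pz pw.
- move=> t; apply: cvgD; last exact: cw.
  by apply: cvgZr; exact: cz.
- by eexists; exact: is_weak_derivative_lin zf wg.
Qed.

End sobolev_theory.

Section weak_derivative_orthogonality.
Context {R : realType}.
Local Notation mu := (@lebesgue_measure R).
Local Notation I01 := (`[0%R, 1%R]%classic : set R).
Local Notation integ f := (mu.-integrable I01 (EFin \o f)).
Implicit Types f g u z phi k : R -> R.

Let psi (b t : R) : R := sin (pi * t) * sin (pi * (b - t)).
Let phin (b : R) (n : nat) (t : R) : R := (1 + expR (- (n%:R * psi b t)))^-1.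

Let psiD b t : psi b (t + 1) = psi b t.
Proof.
rewrite /psi; have -> : pi * (b - t) = pi * (b - (t + 1)) + pi :> R by ring.
by rewrite mulrDr mulr1 !sinDpi; ring.
Qed.

Let dpsi (b t : R) : R :=
  pi * cos (pi * t) * sin (pi * (b - t)) - sin (pi * t) * (pi * cos (pi * (b - t))).

Let dpsiE b t : is_derive t (1:R) (psi b) (dpsi b t).
Proof.
have h1 : is_derive t (1:R) (fun x => pi * x : R) pi.
  by apply: is_derive_eq; rewrite ?scaler0 ?addr0 /GRing.scale/= ?mulr1.
have h2 : is_derive t (1:R) (fun x => pi * (b - x) : R) (- pi).
  by apply: is_derive_eq; rewrite /GRing.scale/=; ring.
have s1 := @is_derive1_comp R sin (fun x => pi * x) t _ _ (is_derive_sin (pi * t)) h1.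
have s2 := @is_derive1_comp R sin (fun x => pi * (b - x)) t _ _ (is_derive_sin (pi * (b - t))) h2.
apply: (is_derive_eq (is_deriveM s1 s2)); rewrite /dpsi /GRing.scale/=; ring.
Qed.

Let cont_psi b : continuous (psi b).
Proof.
move=> x; apply: differentiable_continuous; apply/derivable1_diffP.
by case: (dpsiE b x).
Qed.

Let cont_mul f g : continuous f -> continuous g -> continuous (fun t => f t * g t).
Proof. by move=> cf cg x; apply: cvgM; [exact: cf|exact: cg]. Qed.
Let cont_cst (a : R) : continuous (fun t : R => a).
Proof. by move=> x; exact: cvg_cst. Qed.
Let cont_comp f g : continuous f -> continuous g -> continuous (fun t => f (g t)).
Proof. by move=> cf cg x; apply: continuous_comp; [exact: cg|exact: cf]. Qed.
Let cont_sub f g : continuous f -> continuous g -> continuous (fun t => f t - g t).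
Proof. by move=> cf cg x; apply: cvgB; [exact: cf|exact: cg]. Qed.
Let cont_id : continuous (fun t : R => t).
Proof. by move=> x; exact: cvg_id. Qed.

Let cont_dpsi b : continuous (dpsi b).
Proof.
have h1 := cont_mul (@cont_cst pi) (@cont_id).
have h2 := cont_mul (@cont_cst pi) (cont_sub (@cont_cst b) (@cont_id)).
apply: cont_sub; apply: cont_mul.
- by apply: cont_mul (cont_comp _ h1); [exact: cont_cst|exact: continuous_cos].
- by apply: cont_comp h2; exact: continuous_sin.
- by apply: cont_comp h1; exact: continuous_sin.
- by apply: cont_mul (cont_comp _ h2); [exact: cont_cst|exact: continuous_cos].
Qed.

Let e_ b n t : R := expR (- (n%:R * psi b t)).
Let den_gt0 b n t : 0 < 1 + e_ b n t.
Proof. by rewrite addr_gt0// expR_gt0. Qed.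

Let dphin b n t : R := (phin b n t) ^+ 2 * (e_ b n t * (n%:R * dpsi b t)).

Let dphinE b n t : is_derive t (1:R) (phin b n) (dphin b n t).
Proof.
have h := dpsiE b t.
have h1 : is_derive t (1:R) (fun x => - (n%:R * psi b x)) (- (n%:R * dpsi b t)).
  by apply: is_derive_eq; rewrite /GRing.scale/=; ring.
have h2 := @is_derive1_comp R expR (fun x => - (n%:R * psi b x)) t _ _ (is_derive_expR (- (n%:R * psi b t))) h1.
have h3 : is_derive t (1:R) (fun x => 1 + e_ b n x) (e_ b n t * (- (n%:R * dpsi b t))).
  by have := is_deriveD (is_derive_cst (1:R) t 1) h2; rewrite add0r.
have h4 := @is_deriveV R (fun x => 1 + e_ b n x) t _ _ (lt0r_neq0 (den_gt0 b n t)) h3.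
apply: (is_derive_eq h4); rewrite /dphin /phin -/(e_ b n t) /GRing.scale/=.
by rewrite exprVn; ring.
Qed.

Let cont_phin b n : continuous (phin b n).
Proof.
move=> x; apply: differentiable_continuous; apply/derivable1_diffP.
by case: (dphinE b n x).
Qed.

Lemma test_phin b n : test_function (phin b n).
Proof.
split.
- by move=> t; rewrite /phin psiD.
- by move=> t; case: (dphinE b n t).
- have -> : derive1 (phin b n) = dphin b n.
    by apply/funext => t; rewrite derive1E; have [_ ->] := dphinE b n t.
  have ce : continuous (e_ b n).
    apply: cont_comp; first exact: continuous_expR.
    move=> x; apply: cvgN; apply: cvgM; first exact: cvg_cst.
    exact: cont_psi.
  apply: cont_mul.
    rewrite (_ : (fun _ => _) = fun t => phin b n t * phin b n t)//.
    by apply: cont_mul; exact: cont_phin.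
  by apply: cont_mul => //; apply: cont_mul.
Qed.

Let phin_norm b n t : `|phin b n t| <= 1.
Proof.
rewrite ger0_norm ?invr_ge0 ?(ltW (den_gt0 _ _ _))//.
by rewrite invf_le1 ?den_gt0// lerDl expR_ge0.
Qed.

Let psi_gt0 b t : b <= 1 -> 0 < t < b -> 0 < psi b t.
Proof.
move=> b1 /andP[t0 tb]; apply: mulr_gt0; apply: sin_gt0_pi; have := pi_gt0 R; nra.
Qed.

Let psi_lt0 b t : 0 <= b -> b < t < 1 -> psi b t < 0.
Proof.
move=> b0 /andP[bt t1]; rewrite /psi -[b - t]opprB mulrN sinN mulrN oppr_lt0.
by apply: mulr_gt0; apply: sin_gt0_pi; have := pi_gt0 R; nra.
Qed.

Let phin_cvg1 b t : 0 < psi b t -> phin b n t @[n --> \oo] --> (1 : R).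
Proof.
move=> p0; rewrite -[X in _ --> X]invr1; apply: cvgV => //.
rewrite -[X in _ --> X]addr0; apply: cvgD; first exact: cvg_cst.
under eq_fun do rewrite -mulrN expRM_natl.
apply: cvg_expr; rewrite ger0_norm ?expR_ge0// expR_lt1; lra.
Qed.

Let phin_cvg0 b t : psi b t < 0 -> phin b n t @[n --> \oo] --> (0 : R).
Proof.
move=> p0.
have h : expR (n%:R * psi b t) @[n --> \oo] --> (0 : R).
  under eq_fun do rewrite expRM_natl.
  by apply: cvg_expr; rewrite ger0_norm ?expR_ge0// expR_lt1.
apply: (@squeeze_cvgr _ _ _ _ (cst 0) (fun n => expR (n%:R * psi b t))) => //.
  near=> n; rewrite /= invr_ge0 (ltW (den_gt0 _ _ _))/=.
  rewrite /phin invf_ple ?posrE ?den_gt0 ?expR_gt0//.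
  by rewrite -expRN lerDr.
exact: cvg_cst.
Unshelve. all: by end_near. Qed.

Lemma orth_integral0 k : square_integrable k ->
  (forall phi, test_function phi -> integral01 (fun t => k t * phi t) = 0) ->
  forall b, 0 <= b <= 1 -> \int[mu]_(t in `[0, b]) k t = 0.
Proof.
move=> sk k0 b /andP[b0 b1].
pose h (t : R) : R := k t * \1_(`[0, b]%classic) t.
have ik := integ_square_integrable sk.
have mphi n : measurable_fun I01 (phin b n).
  by apply: measurable_funTS; apply: continuous_measurable_fun; exact: cont_phin.
have [] := @dominated_convergence _ _ _ mu I01 (measurable_itv _)
  (fun n => EFin \o (fun t => k t * phin b n t)) (EFin \o h)
  (EFin \o (fun t => `|k t|)).
- by move=> n; apply/measurable_EFinP; apply: measurable_funM; [exact: sk.1|exact: mphi].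
- by apply/measurable_EFinP; apply: measurable_funM; [exact: sk.1|].
- exists [set 0; b; 1]; split.
  + by apply: measurableU; [apply: measurableU|].
  + apply: null_set_setU => //.
    * by apply: measurableU.
    * apply: null_set_setU => //; exact: lebesgue_measure_set1.
    * exact: lebesgue_measure_set1.
  + move=> t /=; rewrite -[X in _ -> X]notK; apply: contra_not.
    move=> nt; rewrite in_itv/= => /andP[t0 t1].
    have {}t0 : 0 < t by rewrite lt_neqAle t0 andbT; apply/eqP => e; apply: nt; left; left.
    have {}t1 : t < 1 by rewrite lt_neqAle t1 andbT; apply/eqP => e; apply: nt; right.
    apply: cvg_EFin; first by near=> n.
    apply: cvgM; first exact: cvg_cst.
    rewrite indicE; have [tb|bt] := ltP t b.
      by rewrite mem_set/= ?in_itv/= ?(ltW t0) ?(ltW tb)//; apply: phin_cvg1; apply: psi_gt0 => //; rewrite t0.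
    have {}bt : b < t by rewrite lt_neqAle bt andbT; apply/eqP => e; apply: nt; left; right.
    rewrite memNset/= ?in_itv/=; last by rewrite (ltW t0) leNgt bt.
    by apply: phin_cvg0; apply: psi_lt0 => //; rewrite bt.
- exact: integrable_norm.
- apply: aeW => t n _ /=; rewrite lee_fin normrM ler_piMr//.
- move=> ih _.
  set S := (X in X @ \oo --> _); have -> : S = cst 0%E.
    apply/funext => n; rewrite /S/=; have := k0 _ (test_phin b n).
    rewrite /integral01 /Rintegral => H; rewrite -[LHS]fineK; first by congr EFin.
    apply: integrable_fin_num => //; apply: integ_mul => //.
    by apply: square_integrable_continuous; exact: cont_phin.
  move=> /(cvg_lim (@ereal_hausdorff R)); rewrite lim_cst//.
  move=> /(congr1 fine) /= h0; rewrite [RHS]h0 -[RHS]/(\int[mu]_(t in I01) h t).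
  rewrite [LHS]Rintegral_mkcond [RHS]Rintegral_mkcond; apply: eq_Rintegral => t _.
  rewrite !patchE /h indicE.
  case: (boolP (t \in `[0, b]%classic)) => tb; last by rewrite mulr0 if_same.
  rewrite mulr1 ifT//; move: tb; rewrite !inE/= !in_itv/= => /andP[-> tb].
  by rewrite (le_trans tb).
Unshelve. all: by end_near. Qed.

Lemma orth_ae0 k : square_integrable k ->
  (forall phi, test_function phi -> integral01 (fun t => k t * phi t) = 0) ->
  ae_eq mu I01 k (cst 0).
Proof.
move=> sk k0.
have I := orth_integral0 sk k0.
pose f := k \_ I01.
have fi : mu.-integrable setT (EFin \o f).
  by rewrite -restrict_EFin; apply/integrable_restrict => //=; rewrite setTI;
    exact: integ_square_integrable.
have := @FTC1Ny _ f.
move=> /(_ _ _)[].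
- move=> y; exact: integrableS fi.
- by apply: open_integrable_locally => //; exact: openT.
move=> N [mN N0 sN]; exists N; split => //.
move=> t /= nt; apply: sN => /=; apply: contra_not nt => -[_ +] t01.
rewrite /f patchE mem_set// => <-.
set F := (F in derive1 F).
suff -> : F = cst 0 by rewrite derive1_cst.
apply/funext => x; rewrite /F/=.
have [x0|x0] := ltP x 0.
  rewrite (@eq_Rintegral _ _ _ _ _ (cst 0)) ?Rintegral_cst ?mul0r// => y.
  rewrite inE/= in_itv/= => yx; rewrite /f patchE memNset//= in_itv/=.
  by rewrite leNgt (le_lt_trans yx).
have b01 : 0 <= Num.min x 1 <= 1 by rewrite le_min x0 ler01 ge_min lexx orbT.
rewrite -[RHS](I _ b01) [LHS]Rintegral_mkcond [RHS]Rintegral_mkcond.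
apply: eq_Rintegral => y _; rewrite /f !patchE !mem_setE !in_itv/= le_min.
by case: (0 <= y); case: (y <= x); case: (y <= 1).
Qed.
End weak_derivative_orthogonality.

Section sobolev_norm_theory.
Context {R : realType}.
Local Notation mu := (@lebesgue_measure R).
Local Notation I01 := (`[0%R, 1%R]%classic : set R).
Local Notation integ f := (mu.-integrable I01 (EFin \o f)).
Implicit Types f g u z w phi k : R -> R.

Lemma weak_derivative_unique z f g :
  is_weak_derivative z f -> is_weak_derivative z g -> ae_eq mu I01 f g.
Proof.
move=> [sf zf] [sg zg].
have skfg := square_integrable_lin (-1) sg sf.
have [N [mN N0 sN]] : ae_eq mu I01 (-1 *: (g : R -> R^o) + f) (cst 0).
  apply: orth_ae0 => // phi tphi.
  have sphi := square_integrable_continuous (test_function_cont tphi).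
  under [in LHS]eq_fun do rewrite mulrDl -mulrA.
  rewrite (integral01_lin _ (integ_mul sg sphi) (integ_mul sf sphi)).
  by have := zf _ tphi; rewrite zg// => /oppr_inj ->; ring.
exists N; split => // t /= nt; apply: sN => /= h; apply: nt => t01.
have := h t01; rewrite (_ : (_ + _) t = -1 * g t + f t)//; lra.
Qed.

Lemma integral01_sqr_ae f g : square_integrable f -> square_integrable g ->
  ae_eq mu I01 f g ->
  integral01 (fun t => f t ^+ 2) = integral01 (fun t => g t ^+ 2).
Proof.
move=> sf sg [N [mN N0 sN]]; rewrite /integral01 /Rintegral; congr fine.
apply: ae_eq_integral => //.
- by case/integrableP : sf.2.
- by case/integrableP : sg.2.
- exists N; split => // t /= nt; apply: sN => /= h; apply: nt => t01.
  by rewrite h.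
Qed.

Lemma integral01_sqr_ge0 f : 0 <= integral01 (fun t => f t ^+ 2).
Proof. by apply: Rintegral_ge0 => t _; exact: sqr_ge0. Qed.

Lemma L2norm_sqr f : L2norm f ^+ 2 = integral01 (fun t => f t ^+ 2).
Proof. by rewrite sqr_sqrtr// integral01_sqr_ge0. Qed.

Lemma H1normE z : H1norm z = Num.sqrt (integral01 (fun t => z t ^+ 2) +
  integral01 (fun t => weak_derivative z t ^+ 2)).
Proof. by rewrite /H1norm (L2norm_sqr z) (L2norm_sqr (weak_derivative z)). Qed.

Lemma integral01_sqr_lin (a : R) f g : square_integrable f -> square_integrable g ->
  integral01 (fun t => (a * f t + g t) ^+ 2) =
  a ^+ 2 * integral01 (fun t => f t ^+ 2) +
  (2 * a * integral01 (fun t => f t * g t) + integral01 (fun t => g t ^+ 2)).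
Proof.
move=> sf sg; have ifg := integ_mul sf sg.
rewrite -(integral01_lin _ ifg sg.2) -integral01_lin.
- by congr integral01; apply/funext => t; ring.
- exact: sf.2.
- have -> : (EFin \o (fun t => 2 * a * (f t * g t) + g t ^+ 2)) =
      ((EFin \o (fun t => 2 * a * (f t * g t))) \+ (EFin \o (fun t => g t ^+ 2))).
    by apply/funext => t /=; rewrite EFinD.
  by apply: integrableD => //; [exact: integ_scale|exact: sg.2].
Qed.

Lemma integral01_weak_derivative_lin (a : R) z w :
    z \in sobolev_H1 -> w \in sobolev_H1 ->
  integral01 (fun t => weak_derivative (a *: (z : R -> R^o) + w) t ^+ 2) =
  integral01 (fun t => (a * weak_derivative z t + weak_derivative w t) ^+ 2).
Proof.
move=> hz hw.
have hzw : (a *: (z : R -> R^o) + w) \in sobolev_H1.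
  exact: (sobolev_H1_submod_closed.2).
have [_ _ dzw] := sobolev_H1P hzw.
have [_ cz dz] := sobolev_H1P hz; have [_ cw dw] := sobolev_H1P hw.
have dl := is_weak_derivative_lin a cz cw dz dw.
rewrite (integral01_sqr_ae dzw.1 dl.1)//; exact: weak_derivative_unique dzw dl.
Qed.

Lemma sobolev_H1_square_integrable z : z \in sobolev_H1 -> square_integrable z.
Proof. by case/sobolev_H1P => _ cz _; exact: square_integrable_continuous. Qed.

Lemma ler_H1normD z w : z \in sobolev_H1 -> w \in sobolev_H1 ->
  H1norm (z + w) <= H1norm z + H1norm w.
Proof.
move=> hz hw.
have sz := sobolev_H1_square_integrable hz.
have sw := sobolev_H1_square_integrable hw.
have [_ _ [sdz _]] := sobolev_H1P hz; have [_ _ [sdw _]] := sobolev_H1P hw.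
have e : z + w = (1 : R) *: (z : R -> R^o) + w by rewrite scale1r.
rewrite !H1normE {2}e (integral01_weak_derivative_lin 1 hz hw).
rewrite (integral01_sqr_lin 1 sdz sdw).
have -> : integral01 (fun t => (z + w) t ^+ 2) =
    integral01 (fun t => (1 * z t + w t) ^+ 2).
  by apply: eq_Rintegral => t _; rewrite mul1r.
rewrite (integral01_sqr_lin 1 sz sw).
set A := integral01 (fun t => z t ^+ 2).
set B := integral01 (fun t => z t * w t).
set C := integral01 (fun t => w t ^+ 2).
set A' := integral01 (fun t => weak_derivative z t ^+ 2).
set B' := integral01 (fun t => weak_derivative z t * weak_derivative w t).
set C' := integral01 (fun t => weak_derivative w t ^+ 2).
have A0 : 0 <= A by exact: integral01_sqr_ge0.
have A'0 : 0 <= A' by exact: integral01_sqr_ge0.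
have C0 : 0 <= C by exact: integral01_sqr_ge0.
have C'0 : 0 <= C' by exact: integral01_sqr_ge0.
have q (s : R) : 0 <= s ^+ 2 * (A + A') + (2 * s * (B + B') + (C + C')).
  have := integral01_sqr_ge0 (fun t => s * z t + w t).
  have := integral01_sqr_ge0 (fun t => s * weak_derivative z t + weak_derivative w t).
  by rewrite (integral01_sqr_lin s sdz sdw) (integral01_sqr_lin s sz sw) -/A -/B -/C -/A' -/B' -/C'; lra.
clearbody A B C A' B' C'.
have AC0 : 0 <= (A + A') by lra.
have CC0 : 0 <= (C + C') by lra.
have CS : (B + B') ^+ 2 <= (A + A') * (C + C').
  have [a0|a0] := eqVneq (A + A') 0.
    have [b0|b0] := eqVneq (B + B') 0; first by rewrite b0 a0 expr0n/= mul0r.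
    have := q (- ((C + C') + 1) / (2 * (B + B'))).
    rewrite a0 mulr0 add0r (_ : _ + _ = -1); [lra|by field].
  have := q (- (B + B') / (A + A')).
  rewrite (_ : _ + _ = ((A + A') * (C + C') - (B + B') ^+ 2) / (A + A')); last by field.
  by rewrite pmulr_lge0 ?subr_ge0// invr_gt0 lt_def a0.
rewrite -(@ler_pXn2r _ 2) ?nnegrE ?addr_ge0 ?sqrtr_ge0//.
rewrite sqr_sqrtr; last by have := q 1; lra.
rewrite sqrrD !sqr_sqrtr//.
have : B + B' <= Num.sqrt (A + A') * Num.sqrt (C + C').
  rewrite -sqrtrM// (le_trans (ler_norm _))// -sqrtr_sqr.
  by rewrite ler_sqrt// mulr_ge0.
by rewrite -mulr_natr; lra.
Qed.

Lemma is_weak_derivative0 : is_weak_derivative (0 : R -> R) 0.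
Proof.
split; first exact: square_integrable0.
move=> phi _; rewrite /integral01.
under [in LHS]eq_Rintegral do rewrite mul0r.
under [in RHS]eq_Rintegral do rewrite mul0r.
by rewrite Rintegral_cst// mul0r oppr0.
Qed.

Lemma H1normZ (a : R) z : z \in sobolev_H1 ->
  H1norm (a *: (z : R -> R^o)) = `|a| * H1norm z.
Proof.
move=> hz.
have sz := sobolev_H1_square_integrable hz.
have [_ cz dz] := sobolev_H1P hz.
have haz : a *: (z : R -> R^o) \in sobolev_H1.
  by rewrite -[X in X \in _]addr0; apply: (sobolev_H1_submod_closed.2) => //;
    exact: sobolev_H1_submod_closed.1.
have [_ _ daz] := sobolev_H1P haz.
have c0 : continuous (0 : R -> R) by move=> x; exact: cvg_cst.
have dl := is_weak_derivative_lin a cz c0 dz is_weak_derivative0.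
rewrite !addr0 in dl.
rewrite !H1normE -sqrtr_sqr -sqrtrM ?sqr_ge0//; congr Num.sqrt.
rewrite (integral01_sqr_ae daz.1 dl.1); last first.
  exact: weak_derivative_unique daz dl.
have hh f : integ f -> a ^+ 2 * integral01 f = integral01 (fun t => a ^+ 2 * f t).
  by move=> fi; rewrite /integral01 RintegralZl.
rewrite mulrDr (hh _ sz.2) (hh _ dz.1.2).
by congr (_ + _); apply: eq_Rintegral => t _; rewrite -exprMn.
Qed.

Lemma H1norm_eq0 z : z \in sobolev_H1 -> H1norm z = 0 -> z = 0.
Proof.
move=> hz /eqP; rewrite sqrtr_eq0 => n0.
have [pz cz _] := sobolev_H1P hz.
have iz2 : mu.-integrable I01 (EFin \o (fun t => z t ^+ 2)).
  by case: (sobolev_H1_square_integrable hz).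
have I0 : integral01 (fun t => z t ^+ 2) = 0.
  apply/eqP; rewrite eq_le integral01_sqr_ge0 andbT -(L2norm_sqr z).
  by rewrite (le_trans _ n0)// lerDl sqr_ge0.
have cz2 : continuous (fun t => z t ^+ 2).
  by move=> x; under eq_fun do rewrite expr2; apply: cvgM; exact: cz.
have zoo x : 0 < x < 1 -> z x = 0.
  move=> /andP[x0 x1].
  have [_] := continuous_FTC1_closed x1 iz2 x0 (cz2 x).
  set F := (F in derive1 F).
  suff F0 : \forall y \near x, F y = 0.
    move=> /esym e; apply/eqP; rewrite -sqrf_eq0 e.
    rewrite derive1E (near_eq_derive _ (g := cst 0)) ?derive_cst//.
  near=> y.
  have y0 : 0 < y by near: y; exact: lt_nbhsr.
  have y1 : y < 1 by near: y; exact: lt_nbhsl.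
  apply/eqP; rewrite eq_le; apply/andP; split; last first.
    by apply: Rintegral_ge0 => t _; exact: sqr_ge0.
  rewrite -I0 /F /integral01 [leLHS]Rintegral_mkcond [leRHS]Rintegral_mkcond.
  apply: le_Rintegral => //.
  - rewrite -restrict_EFin; apply/integrable_restrict => //=; rewrite setTI.
    apply: integrableS iz2 => //; apply: subset_itvl; rewrite bnd_simp; exact: ltW.
  - by rewrite -restrict_EFin; apply/integrable_restrict => //=; rewrite setTI.
  - move=> t _; rewrite !patchE !mem_setE !in_itv/=.
    case: (0 <= t) => //=; case: (leP t y) => ty; last by case: ifP => _; rewrite ?sqr_ge0.
    by rewrite (le_trans ty (ltW y1)).
have z0 : z 0 = 0.
  have : z x @[x --> (0:R)^'+] --> z 0 by apply: cvg_at_right_filter; exact: cz.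
  move=> /(cvg_lim (@Rhausdorff R)) <-; apply: (cvg_lim (@Rhausdorff R)).
  apply: cvg_near_cst; near=> x; apply/eqP; rewrite zoo//.
  by apply/andP; split; near: x; [exact: nbhs_right_gt|exact: nbhs_right_lt].
have zn n : forall x, z (x + n%:R) = z x.
  by move=> x; have := periodicn pz n x; rewrite -mulr_natl mulr1.
have z1 x : 0 <= x < 1 -> z x = 0.
  move=> /andP[]; rewrite le_eqVlt => /predU1P[<-//|x0 x1].
  by apply: zoo; rewrite x0.
apply/funext => x /=.
have [n nx] : exists n : nat, (Num.floor x + n%:Z >= 0)%R.
  by exists `|Num.floor x|%N; lia.
have fl : 0 <= x - (Num.floor x)%:~R < 1.
  by have := floor_itv x; rewrite intrD; lra.
rewrite -(zn n x).
have -> : x + n%:R = (x - (Num.floor x)%:~R) + `|(Num.floor x + n%:Z)%R|%N%:R.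
  by rewrite natr_absz ger0_norm// intrD; ring.
by rewrite zn z1.
Unshelve. all: by end_near. Qed.
End sobolev_norm_theory.

Section loop_space.
Context {R : realType}.

Record loop_H1 := LoopH1 {
  loop_fun :> R -> R ;
  loop_funP : loop_fun \in @sobolev_H1 R }.

HB.instance Definition _ := GRing.isSubmodClosed.Build R (R -> R^o)
  (@sobolev_H1 R) sobolev_H1_submod_closed.
HB.instance Definition _ : isSub (R -> R^o) (mem (@sobolev_H1 R)) loop_H1 :=
  [isSub for loop_fun].
HB.instance Definition _ := [Choice of loop_H1 by <:].
HB.instance Definition _ := [SubChoice_isSubLmodule of loop_H1 by <:].
End loop_space.
Arguments loop_H1 : clear implicits.

Section loop_space_norm.
Context {R : realType}.
Implicit Types z w : loop_H1 R.

Let norm z : R := H1norm z.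

Let normD z w : norm (z + w) <= norm z + norm w.
Proof. by apply: ler_H1normD; apply: loop_funP. Qed.

Let normZ (a : R) z : norm (a *: z) = `|a| * norm z.
Proof. by apply: H1normZ; apply: loop_funP. Qed.

Let norm_eq0 z : norm z = 0 -> z = 0.
Proof.
by move=> /(H1norm_eq0 (loop_funP z)) z0; apply/val_inj; rewrite /= z0.
Qed.

HB.instance Definition _ :=
  Lmodule_isNormed.Build R (loop_H1 R) normD normZ norm_eq0.

End loop_space_norm.

(* H^1(S^1, R^2). The library norm on the product is the maximum of the two
   H^1-norms; it is equivalent to the Hilbert norm, hence yields the same
   differentials. *)
Notation pair_H1 R := (loop_H1 R * loop_H1 R)%type.

Section averaged_functional.
Context {R : realType}.

(* Defined on all of H^1(S^1, R^2) through the convention x / 0 = 0; only its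
   values on the open set [H1_av] are meaningful. *)
Definition B_av (z : pair_H1 R) : R :=
  let n1 := L2norm z.1 ^+ 2 in
  let n2 := L2norm z.2 ^+ 2 in
  (2 * n1 * L2norm (weak_derivative z.1) ^+ 2 + 2 / n1)
  + (2 * n2 * L2norm (weak_derivative z.2) ^+ 2 + 2 / n2)
  - n1 * n2 / (L2norm (fun t => z.1 t ^+ 2) ^+ 2 * n2
               + L2norm (fun t => z.2 t ^+ 2) ^+ 2 * n1).

(* The space before the quotient by the torus. *)
Definition H1_av : set (pair_H1 R) :=
  [set z : pair_H1 R | 0 < L2norm z.1 /\ 0 < L2norm z.2].

Definition critical_loop_pair : set (pair_H1 R) :=
  [set z : pair_H1 R |
     [/\ H1_av z, differentiable B_av z & forall h, 'd B_av z h = 0]].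

(* Shifts by S^1 are given by real numbers, loops being 1-periodic. *)
Definition torus_orbit (z : pair_H1 R) : set (pair_H1 R) :=
  [set w : pair_H1 R | exists theta1 theta2 : R,
     (forall t, w.1 t = z.1 (t + theta1)) /\
     (forall t, w.2 t = z.2 (t + theta2))].

Definition critical_points : set (set (pair_H1 R)) :=
  [set torus_orbit z | z in critical_loop_pair].

(* (Z/2)^2 acts on pairs of loops, hence on torus orbits by direct image. *)
Definition sign_change (e : bool * bool) (z : pair_H1 R) : pair_H1 R :=
  ((-1) ^+ e.1 *: z.1, (-1) ^+ e.2 *: z.2).

Definition sign_orbit (O : set (pair_H1 R)) : set (set (pair_H1 R)) :=
  [set sign_change e @` O | e in [set: bool * bool]].

Definition critical_points_mod_signs : set (set (set (pair_H1 R))) :=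
  [set sign_orbit O | O in critical_points].

End averaged_functional.
Arguments critical_points_mod_signs R : clear implicits.

(* Main.v *)
(* Put q_i = \int z_i^4 / \int z_i^2. For a fixed value of kap = (q_1 + q_2)^-2
   the critical point equations decouple: each component solves an equation
   z'' = a z + b z^3 with b > 0, so (constants being excluded) it is
   z(t) = M sn_h(k t + c), where k is a positive integer and sn_h is the Jacobi
   sine of parameter h, rescaled to period 1. Writing I_j(h) for the mean over
   the angle s of sin^(2j) s (1 - h sin^2 s)^(-1/2), the equations become
     kap M^4 = 2 h,   M^6 (2 pi k I_1(h))^2 = 1,   q = M^2 I_2(h) / I_1(h)
   for each component, together with kap (q_1 + q_2)^2 = 1. As I_1 and I_2 / I_1
   are nondecreasing in h, there is at most one solution, up to shifts and signs,
   for given (k_1, k_2), so the critical set is countable. For z_1 = z_2 the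
   system reduces to 8 h I_2(h)^2 = I_1(h)^2, which has a root by the intermediate
   value theorem; it yields one critical point for every k_1 = k_2 = k, so the
   critical set is infinite, hence equipotent to the positive rationals. *)
From HB Require Import structures.
Require Import Defs.
From mathcomp Require Import all_boot all_order all_algebra.
From mathcomp Require Import all_classical all_reals all_analysis.
From mathcomp Require Import ring lra.
Import Order.TTheory GRing.Theory Num.Theory.
Import numFieldNormedType.Exports.
Local Open Scope classical_set_scope.
Local Open Scope ring_scope.
Set Implicit Arguments.
Unset Strict Implicit.
Unset Printing Implicit Defensive.


(** The relation between M, k and I_1 is a self-consistency condition: the coefficients a and b
    depend on the loop through its mass N = \int z^2, its energy D = \int z'^2 and Q = \int z^4.
    Pairing the equation with z gives D = -(a N + b Q), and integrating the derivative of sin s cos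
    s (1 - h sin^2 s)^(1/2) over a period gives I_0 - 2 (1 + h) I_1 + 3 h I_2 = 0. Eliminating D and
    I_0 leaves M^6 (2 pi k I_1)^2 = 1. Since kap is itself an unknown, uniqueness has to compare
    solutions with different couplings. For fixed k_1 and k_2, kap' <= kap forces h_i' <= h_i in
    both components. With x_i = kap^(1/2) M_i^2 = (2 h_i)^(1/2) and r_i = I_2(h_i) / I_1(h_i), the
    last equation reads x_1 r_1 + x_2 r_2 = 1, where every factor is nondecreasing in h_i, so no
    inequality can be strict. For z_1 = z_2 it reads 2 (2 h)^(1/2) I_2 / I_1 = 1, which is the
    origin of the constant 8. A critical point is a priori only of class H^1, so the equation first
    holds weakly; a regularity argument has to precede any use of uniqueness for ordinary
    differential equations. *)

Section calculus.
Context {R : realType}.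
Local Notation mu := (@lebesgue_measure R).
Local Notation I01 := (`[0%R, 1%R]%classic : set R).
Local Notation integ f := (mu.-integrable I01 (EFin \o f)).
Implicit Types (f g u F G : R -> R) (t a b c e : R).

(** * Derivatives, continuity and integrals over one period *)

Lemma is_derive_mul f g t a b : is_derive t 1 f a -> is_derive t 1 g b ->
  is_derive t (1 : R) (fun s => f s * g s) (a * g t + f t * b).
Proof.
by move=> df dg; apply: (is_derive_eq (is_deriveM df dg)); rewrite /GRing.scale/=; ring.
Qed.

Lemma is_derive_add f g t a b : is_derive t 1 f a -> is_derive t 1 g b ->
  is_derive t (1 : R) (fun s => f s + g s) (a + b).
Proof. by move=> df dg; apply: (is_derive_eq (is_deriveD df dg)). Qed.

Lemma is_derive_scale c f t a : is_derive t 1 f a ->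
  is_derive t (1 : R) (fun s => c * f s) (c * a).
Proof. by move=> df; apply: (is_derive_eq (is_deriveZ c df)). Qed.

Lemma is_derive_const c t : is_derive t (1 : R) (fun _ : R => c) 0.
Proof. exact: is_derive_cst. Qed.

Lemma is_derive_ext f g t a : (forall s, f s = g s) ->
  is_derive t (1 : R) f a -> is_derive t (1 : R) g a.
Proof. by move=> /funext ->. Qed.

Lemma is_derive_exp f n t a : is_derive t 1 f a ->
  is_derive t (1 : R) (fun s => f s ^+ n.+1) (n.+1%:R * f t ^+ n * a).
Proof.
move=> df; elim: n => [|n IH]; first by rewrite expr0 !mul1r.
apply: (@is_derive_ext (fun s => f s * f s ^+ n.+1)) => [s|]; first by rewrite -exprS.
apply: (is_derive_eq (is_derive_mul df IH)).
by rewrite -[n.+2%:R]natr1 exprS; ring.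
Qed.

Lemma is_derive_chain F f t a b : is_derive (f t) 1 F a -> is_derive t 1 f b ->
  is_derive t (1 : R) (fun s => F (f s)) (a * b).
Proof. by move=> dF df; apply: (is_derive_eq (is_derive1_comp dF df)); rewrite mulrC. Qed.

Lemma is_derive_affine c e t : is_derive t (1 : R) (fun s => c * s + e) c.
Proof. by apply: is_derive_eq; rewrite /GRing.scale/=; ring. Qed.

Lemma is_derive_addr c t : is_derive t (1 : R) (fun s => s + c) 1.
Proof. by apply: (@is_derive_ext (fun s => 1 * s + c)) => [s|]; [ring|exact: is_derive_affine]. Qed.

Lemma derive_unique f t a b : is_derive t (1 : R) f a -> is_derive t (1 : R) f b -> a = b.
Proof. by case=> _ <- [_ <-]. Qed.

Lemma is_derive_continuous f g : (forall t, is_derive t 1 f (g t)) -> continuous f.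
Proof.
move=> df t; apply: differentiable_continuous; apply/derivable1_diffP.
by case: (df t).
Qed.

Lemma derive1_fun f g : (forall t, is_derive t 1 f (g t)) -> derive1 f = g.
Proof. by move=> df; apply/funext => t; rewrite derive1E; case: (df t). Qed.

Lemma cont_mul f g : continuous f -> continuous g -> continuous (fun t => f t * g t).
Proof. by move=> cf cg x; apply: cvgM; [exact: cf|exact: cg]. Qed.

Lemma cont_add f g : continuous f -> continuous g -> continuous (fun t => f t + g t).
Proof. by move=> cf cg x; apply: cvgD; [exact: cf|exact: cg]. Qed.

Lemma cont_const (a : R) : continuous (fun t : R => a).
Proof. by move=> x; exact: cvg_cst. Qed.

Lemma cont_scale (a : R) f : continuous f -> continuous (fun t => a * f t).
Proof. by move=> cf; apply: cont_mul => //; exact: cont_const. Qed.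

Lemma cont_comp f g : continuous f -> continuous g -> continuous (fun t => f (g t)).
Proof. by move=> cf cg x; apply: continuous_comp; [exact: cg|exact: cf]. Qed.

Lemma cont_exp f n : continuous f -> continuous (fun t => f t ^+ n).
Proof.
move=> cf; elim: n => [|n IH]; first exact: cont_const.
by under eq_fun do rewrite exprS; exact: cont_mul.
Qed.

Lemma continuous_integ f : continuous f -> integ f.
Proof. by move=> cf; exact: integ_square_integrable (square_integrable_continuous cf). Qed.

Lemma integral01D f g : integ f -> integ g ->
  integral01 (fun t => f t + g t) = integral01 f + integral01 g.
Proof. by move=> fi gi; rewrite /integral01 RintegralD. Qed.

Lemma integral01Z a f : integ f -> integral01 (fun t => a * f t) = a * integral01 f.
Proof. by move=> fi; rewrite /integral01 RintegralZl. Qed.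

Lemma integral01_cst a : integral01 (fun=> a) = a.
Proof.
rewrite /integral01 Rintegral_cst//= lebesgue_measure_itv/= lte_fin ltr01.
by rewrite oppr0 addr0 mulr1.
Qed.

Lemma integral01_le f g : integ f -> integ g -> (forall t, f t <= g t) ->
  integral01 f <= integral01 g.
Proof. by move=> fi gi fg; apply: le_Rintegral. Qed.

Lemma integral01_ge0 f : (forall t, 0 <= f t) -> 0 <= integral01 f.
Proof. by move=> f0; apply: Rintegral_ge0. Qed.

Lemma integral01_derive F f : continuous f -> (forall t, is_derive t 1 F (f t)) ->
  integral01 f = F 1 - F 0.
Proof.
move=> cf dF; rewrite /integral01 /Rintegral (@continuous_FTC2 _ f F 0 1)//.
- exact: continuous_subspaceT.
- have cF := is_derive_continuous dF.
  split=> [x _||].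
  + by case: (dF x).
  + by apply: cvg_at_right_filter; exact: cF.
  + by apply: cvg_at_left_filter; exact: cF.
- by move=> x _; rewrite (derive1_fun dF).
Qed.

Lemma derive_ge0_le (G G' : R -> R) x y : (forall t, is_derive t 1 G (G' t)) ->
  (forall t, 0 <= G' t) -> x <= y -> G x <= G y.
Proof.
move=> dG G'0 xy; apply: (@ger0_derive1_ndecr R G x y) => // [s _|].
- by rewrite (derive1_fun dG).
- by apply: continuous_subspaceT; exact: is_derive_continuous dG.
Qed.

(** The lower limit -(|x| + 1) moves with x in order to lie to the left of both 0 and x, which
    yields one formula on the whole line. For |y - x| < 1 it can be frozen at -(|x| + 2) by
    additivity, and there the fundamental theorem applies. *)
Lemma continuous_primitive f : continuous f ->
  exists F, F 0 = 0 /\ forall t, is_derive t 1 F (f t).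
Proof.
move=> cf.
have fi a b : mu.-integrable `[a, b] (EFin \o f).
  apply: continuous_compact_integrable; first exact: segment_compact.
  exact: continuous_subspaceT.
pose G (n x : R) := \int[mu]_(t in `[- n, x]) f t.
pose F x := G (`|x| + 1) x - G (`|x| + 1) 0.
exists F; split; first by rewrite /F subrr.
move=> x.
pose n := `|x| + 2.
have dG : is_derive x 1 (fun y => G n y + - G n 0) (f x).
  have [] := @continuous_FTC1_closed R f (- n) x (x + 1) _ (fi _ _) _ (cf x).
  - by rewrite ltrDl.
  - by rewrite /n; have := ler_norm (- x); rewrite normrN; lra.
  move=> dd /esym; rewrite derive1E => e.
  have h : is_derive x 1 (G n) (f x) by split.
  have := is_derive_add h (is_derive_const (- G n 0) x).
  by rewrite addr0.
apply: (near_eq_is_derive _ dG).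
near=> y.
have yn : `|y| + 1 <= n.
  have yx : `|y - x| < 1.
    by near: y; rewrite near_simpl; have := @nbhsx_ballx R R x 1 ltr01; apply: filterS => y; rewrite /ball/= distrC.
  have := ler_normD (y - x) x; rewrite subrK /n; lra.
have hs z : - (`|y| + 1) <= z -> z <= n -> G n z - G n (- (`|y| + 1)) = G (`|y| + 1) z.
  move=> z1 z2; rewrite /G Rintegral_itvB ?bnd_simp//; last by rewrite lerNl opprK.
  by rewrite Rintegral_itv_obnd_cbnd//; apply: integrableS (fi (- (`|y| + 1)) z) => //;
    exact: subset_itv_oc_cc.
have := ler_norm y; have := ler_norm (- y); rewrite normrN => y1 y2.
have yp := normr_ge0 y.
by rewrite /F -!hs; lra.
Unshelve. all: by end_near. Qed.

End calculus.
Arguments cont_exp {R} [f] n cf x : rename.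
Arguments cont_scale {R} a [f] cf x : rename.



(** * Weak derivatives *)

Section weak.
Context {R : realType}.
Local Notation mu := (@lebesgue_measure R).
Local Notation I01 := (`[0%R, 1%R]%classic : set R).
Local Notation integ f := (mu.-integrable I01 (EFin \o f)).
Implicit Types (f g u z w k v p phi F G : R -> R) (t a b c e : R).

Lemma square_integrable_linE a f g : square_integrable f -> square_integrable g ->
  square_integrable (fun t => a * f t + g t).
Proof. by move=> sf sg; have := square_integrable_lin a sf sg. Qed.

(** The quadratic s -> \int (s f + g)^2 is nonnegative: its value at the minimum -B / A gives the
    claim. If A = 0 the function is affine and must be constant, as otherwise s = -(C + 1) / (2 B)
    would give the value -1. *)
Lemma cauchy_schwarz01 f g : square_integrable f -> square_integrable g ->
  integral01 (fun t => f t * g t) ^+ 2 <=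
  integral01 (fun t => f t ^+ 2) * integral01 (fun t => g t ^+ 2).
Proof.
move=> sf sg.
have q s := integral01_sqr_ge0 (fun t => s * f t + g t).
have {}q s : 0 <= s ^+ 2 * integral01 (fun t => f t ^+ 2) +
  (2 * s * integral01 (fun t => f t * g t) + integral01 (fun t => g t ^+ 2)).
  by have := q s; rewrite integral01_sqr_lin.
have A0 := integral01_sqr_ge0 f.
move: q A0; set A := integral01 _; set B := integral01 _; set C := integral01 _ => q A0.
have [a0|a0] := eqVneq A 0.
  have [b0|b0] := eqVneq B 0; first by rewrite b0 a0 expr0n/= mul0r.
  have := q (- (C + 1) / (2 * B)).
  rewrite a0 mulr0 add0r (_ : _ + _ = -1); [lra|by field].
have := q (- B / A).
rewrite (_ : _ + _ = (A * C - B ^+ 2) / A); last by field.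
by rewrite pmulr_lge0 ?subr_ge0// invr_gt0 lt_def a0.
Qed.

Lemma integral01_ae f g : integ f -> integ g -> ae_eq mu I01 f g ->
  integral01 f = integral01 g.
Proof.
move=> fi gi [N [mN N0 sN]]; rewrite /integral01 /Rintegral; congr fine.
apply: ae_eq_integral => //.
- by case/integrableP : fi.
- by case/integrableP : gi.
- by exists N; split => // t /= nt; apply: sN => /= h; apply: nt => t01; rewrite h.
Qed.

Lemma integral01_mul_ae f g u : square_integrable f -> square_integrable g ->
  square_integrable u -> ae_eq mu I01 f g ->
  integral01 (fun t => f t * u t) = integral01 (fun t => g t * u t).
Proof.
move=> sf sg su [N [mN N0 sN]]; apply: integral01_ae.
- exact: integ_mul.
- exact: integ_mul.
- by exists N; split => // t /= nt; apply: sN => /= h; apply: nt => t01; rewrite h.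
Qed.

Lemma weak_derivativeP z g : is_weak_derivative z g ->
  is_weak_derivative z (weak_derivative z).
Proof. by move=> zg; rewrite /weak_derivative; case: xgetP => // /(_ g). Qed.

Lemma L2norm_weak_derivative z g : is_weak_derivative z g ->
  L2norm (weak_derivative z) ^+ 2 = integral01 (fun t => g t ^+ 2).
Proof.
move=> zg; have zw := weak_derivativeP zg; rewrite L2norm_sqr.
by apply: (integral01_sqr_ae zw.1 zg.1); exact: weak_derivative_unique zw zg.
Qed.

Lemma integral01_parts f f' g g' : periodic f 1 -> periodic g 1 ->
  continuous f' -> continuous g' ->
  (forall t, is_derive t 1 f (f' t)) -> (forall t, is_derive t 1 g (g' t)) ->
  integral01 (fun t => f t * g' t) = - integral01 (fun t => f' t * g t).
Proof.
move=> pf pg cf' cg' df dg.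
have cf := is_derive_continuous df; have cg := is_derive_continuous dg.
have h t := is_derive_mul (df t) (dg t).
have e : integral01 (fun t => f' t * g t + f t * g' t) = 0.
  rewrite (integral01_derive _ h); last by apply: cont_add; exact: cont_mul.
  by rewrite -[X in f X * g X - _]add0r pf pg subrr.
move: e; rewrite integral01D; first lra; by apply: continuous_integ; exact: cont_mul.
Qed.

Lemma test_function_derive f f' : periodic f 1 ->
  (forall t, is_derive t 1 f (f' t)) -> continuous f' -> test_function f.
Proof.
by move=> pf df cf'; split => //; rewrite (derive1_fun df).
Qed.

Lemma test_functionP f : test_function f ->
  [/\ periodic f 1, forall t, is_derive t 1 f (derive1 f t) & continuous (derive1 f)].
Proof. by case=> pf df cf; split => // t; split=> //; rewrite derive1E. Qed.

Lemma is_weak_derivative_derive f f' : periodic f 1 -> continuous f' ->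
  (forall t, is_derive t 1 f (f' t)) -> is_weak_derivative f f'.
Proof.
move=> pf cf' df; split; first exact: square_integrable_continuous.
move=> phi /test_functionP[pphi dphi cphi].
exact: integral01_parts.
Qed.

Lemma sobolev_H1_derive f f' : periodic f 1 -> continuous f' ->
  (forall t, is_derive t 1 f (f' t)) -> f \in @sobolev_H1 R.
Proof.
move=> pf cf' df; apply/asboolP; split => //; first exact: is_derive_continuous df.
by exists f'; exact: is_weak_derivative_derive.
Qed.

Lemma primitive_addn1 f F : continuous f -> periodic f 1 ->
  (forall t, is_derive t 1 F (f t)) -> forall t, F (t + 1) = F t + integral01 f.
Proof.
move=> cf pf dF t.
have d0 s : is_derive s (1 : R) (fun x => F (x + 1) + -1 * F x) 0.
  have h1 : is_derive s (1 : R) (fun x => F (x + 1)) (f (s + 1) * 1).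
    exact: (@is_derive_chain R F (fun x => x + 1) s _ _ (dF (s + 1)) (is_derive_addr 1 s)).
  by apply: (is_derive_eq (is_derive_add h1 (is_derive_scale (-1) (dF s)))); rewrite pf; ring.
have := is_derive_0_is_cst t 0 d0; rewrite add0r (integral01_derive cf dF); lra.
Qed.

Lemma periodic_primitive f : continuous f -> periodic f 1 -> integral01 f = 0 ->
  exists F, [/\ F 0 = 0, periodic F 1 & forall t, is_derive t 1 F (f t)].
Proof.
move=> cf pf f0; have [F [F0 dF]] := continuous_primitive cf.
exists F; split => // t; have := primitive_addn1 cf pf dF t; lra.
Qed.

Lemma test_function_primitive f : continuous f -> periodic f 1 ->
  exists phi, test_function phi /\ forall t, derive1 phi t = f t - integral01 f.
Proof.
move=> cf pf.
have cfm : continuous (fun t => f t + - integral01 f).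
  by apply: cont_add => //; exact: cont_const.
have [|||F [_ pF dF]] := @periodic_primitive (fun t => f t + - integral01 f); first exact: cfm.
- by move=> t; rewrite pf.
- rewrite integral01D ?integral01_cst ?subrr//; apply: continuous_integ => //.
  exact: cont_const.
- exists F; split; first exact: test_function_derive dF cfm.
  by move=> t; rewrite (derive1_fun dF).
Qed.

(** A continuous periodic function minus its mean is the derivative of a test function, so k minus
    its mean is orthogonal to all test functions and [orth_ae0] applies. *)
Lemma du_bois_reymond k : square_integrable k ->
  (forall phi, test_function phi -> integral01 (fun t => k t * derive1 phi t) = 0) ->
  ae_eq mu I01 k (cst (integral01 k)).
Proof.
move=> sk k0; set c := integral01 k.
have sc : square_integrable (cst c : R -> R).
  by apply: square_integrable_continuous; exact: cont_const.
have skc := square_integrable_linE (-1) sc sk.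
have [|N [mN N0 sN]] := orth_ae0 skc; last first.
  exists N; split => // t /= nt; apply: sN => /= h; apply: nt => /h /=; lra.
move=> phi tphi; have cphi := test_function_cont tphi.
have [pphi _ _] := tphi.
have [phi' [tphi' dphi']] := test_function_primitive cphi pphi.
have sphi := square_integrable_continuous cphi.
have kphi : integ (fun t => k t * phi t) by exact: integ_mul.
have ik := integ_square_integrable sk.
have := k0 _ tphi'.
rewrite (_ : (fun t => _) = (fun t => - integral01 phi * k t + k t * phi t)); last first.
  by apply/funext => t; rewrite dphi'; ring.
rewrite integral01_lin// -/c => e.
rewrite (_ : (fun t => _) = (fun t => - c * phi t + k t * phi t)); last first.
  by apply/funext => t /=; ring.
rewrite integral01_lin//; first by rewrite -[RHS]e; ring.
exact: integ_square_integrable.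
Qed.

Lemma continuous_periodic_eq0 w : continuous w -> periodic w 1 ->
  integral01 (fun t => w t ^+ 2) = 0 -> is_weak_derivative w 0 -> w = 0.
Proof.
move=> cw pw w0 dw; apply: H1norm_eq0.
  by apply/asboolP; split => //; exists 0.
rewrite H1normE w0 -L2norm_sqr (L2norm_weak_derivative dw) add0r.
by under eq_fun do rewrite expr0n/=; rewrite integral01_cst sqrtr0.
Qed.

(** The du Bois-Reymond lemma gives equality almost everywhere only. Continuity removes the
    exceptional set: w - c has zero L^2-norm and zero weak derivative, and the H^1-norm is definite
    on continuous representatives. *)
Lemma weak_derivative_eq0 w : continuous w -> periodic w 1 ->
  (forall phi, test_function phi -> integral01 (fun t => w t * derive1 phi t) = 0) ->
  forall t, w t = integral01 w.
Proof.
move=> cw pw w0; have sw := square_integrable_continuous cw.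
have wc := du_bois_reymond sw w0; set c := integral01 w in wc *.
have sc : square_integrable (cst c : R -> R).
  by apply: square_integrable_continuous; exact: cont_const.
have e : (fun t => w t + - c) = 0.
  apply: continuous_periodic_eq0.
  - by apply: cont_add => //; exact: cont_const.
  - by move=> t; rewrite pw.
  - rewrite -[RHS](integral01_cst (0 : R)); apply: integral01_ae.
    + by apply: continuous_integ; apply: cont_exp; apply: cont_add => //; exact: cont_const.
    + by apply: continuous_integ; exact: cont_const.
    + case: wc => N [mN N0 sN]; exists N; split => // t /= nt; apply: sN => /= h; apply: nt => /h ->.
      by rewrite subrr expr0n.
  - split; first exact: square_integrable0.
    move=> phi tphi; rewrite [RHS](_ : _ = 0); last first.
      by under eq_fun do rewrite mul0r; rewrite integral01_cst oppr0.
    have [pphi dphi cphi] := test_functionP tphi.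
    have sphi := square_integrable_continuous cphi.
    rewrite (_ : (fun t => _) = (fun t => - c * derive1 phi t + w t * derive1 phi t)); last first.
      by apply/funext => t; ring.
    rewrite integral01_lin ?w0//; last exact: integ_mul.
      rewrite (integral01_derive cphi dphi) -[X in phi X - _]add0r pphi; ring.
    exact: continuous_integ.
by move=> t; apply/eqP; rewrite -subr_eq0 -[_ - _]/((fun t => w t + - c) t) e.
Qed.

(** The hypothesis says that g' = f weakly. Two integrations suffice: g agrees almost everywhere
    with a primitive p of f, then z agrees with a primitive of p up to a constant. Testing with the
    constant function 1 shows that f and p have mean 0, so that their primitives are periodic. *)
Lemma weak_solution_regular f z g : continuous f -> periodic f 1 ->
  continuous z -> periodic z 1 -> is_weak_derivative z g ->
  (forall phi, test_function phi ->
    integral01 (fun t => g t * derive1 phi t) = - integral01 (fun t => f t * phi t)) ->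
  exists p, [/\ periodic p 1, forall t, is_derive t 1 z (p t)
    & forall t, is_derive t 1 p (f t)].
Proof.
move=> cf pf cz pz [sg zg] H.
have t1 : test_function (fun=> 1 : R).
  by apply: (@test_function_derive _ (fun=> 0)) => //; exact: cont_const.
have d1 : derive1 (fun=> 1 : R) = fun=> 0 :> R.
  by apply: derive1_fun => t; exact: is_derive_const.
have f0 : integral01 f = 0.
  have := H _ t1; rewrite d1.
  under eq_fun do rewrite mulr0; under [X in _ = - integral01 X]eq_fun do rewrite mulr1.
  by rewrite integral01_cst => /eqP; rewrite eq_sym oppr_eq0 => /eqP.
have [F [_ pF dF]] := periodic_primitive cf pf f0.
have cF := is_derive_continuous dF.
have sF := square_integrable_continuous cF.
have sk : square_integrable (fun t => -1 * F t + g t) by exact: square_integrable_linE.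
have kc : ae_eq mu I01 (fun t => -1 * F t + g t) (cst (integral01 (fun t => -1 * F t + g t))).
  apply: du_bois_reymond => // phi tphi.
  have [pphi dphi cphi] := test_functionP tphi.
  have sphi := square_integrable_continuous cphi.
  rewrite (_ : (fun t => _) = (fun t => -1 * (F t * derive1 phi t) + g t * derive1 phi t)); last first.
    by apply/funext => t; ring.
  rewrite integral01_lin; [|exact: integ_mul..].
  by rewrite H// (integral01_parts pF pphi cf cphi dF dphi); ring.
set c := integral01 _ in kc.
pose p t := F t + c.
have cp : continuous p by apply: cont_add => //; exact: cont_const.
have sp := square_integrable_continuous cp.
have pp : periodic p 1 by move=> t; rewrite /p pF.
have dp t : is_derive t 1 p (f t).
  by apply: (is_derive_eq (is_derive_add (dF t) (is_derive_const c t))); rewrite addr0.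
have gp : ae_eq mu I01 g p.
  case: kc => N [mN N0 sN]; exists N; split => // t /= nt; apply: sN => /= h; apply: nt => /h /=.
  rewrite /p; lra.
have zp : is_weak_derivative z p.
  split=> // phi tphi; rewrite zg//; congr (- _); apply: integral01_mul_ae => //.
  exact: square_integrable_continuous (test_function_cont tphi).
have p0 : integral01 p = 0.
  have := zp.2 _ t1; rewrite d1.
  under eq_fun do rewrite mulr0; under [X in _ = - integral01 X]eq_fun do rewrite mulr1.
  by rewrite integral01_cst => /eqP; rewrite eq_sym oppr_eq0 => /eqP.
have [P [_ pP dP]] := periodic_primitive cp pp p0.
have cP := is_derive_continuous dP.
have zP : forall t, z t + -1 * P t = integral01 (fun t => z t + -1 * P t).
  apply: (@weak_derivative_eq0 (fun t => z t + -1 * P t)).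
  - by apply: cont_add => //; exact: cont_scale.
  - by move=> t; rewrite pz pP.
  - move=> phi tphi; have [pphi dphi cphi] := test_functionP tphi.
    have sphi := square_integrable_continuous cphi.
    rewrite (_ : (fun t => _) = (fun t => -1 * (P t * derive1 phi t) + z t * derive1 phi t)); last first.
      by apply/funext => t; ring.
    rewrite integral01_lin; last 2 first.
      by apply: continuous_integ; exact: cont_mul.
      by apply: continuous_integ; exact: cont_mul.
    by rewrite zp.2// (integral01_parts pP pphi cp cphi dP dphi); ring.
exists p; split => // t.
set e := integral01 _ in zP.
apply: (@is_derive_ext _ (fun t => P t + e)); first by move=> s; rewrite -(zP s); ring.
by apply: (is_derive_eq (is_derive_add (dP t) (is_derive_const e t))); rewrite addr0.
Qed.

(* Test the weak derivative against the primitive of v^3 - \int v^3. *)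
Lemma integral01_exp4_le v g : continuous v -> periodic v 1 -> is_weak_derivative v g ->
  integral01 (fun t => v t ^+ 4) <=
  8 * (integral01 (fun t => v t ^+ 2) + integral01 (fun t => g t ^+ 2)) ^+ 2.
Proof.
move=> cv pv [sg vg].
have cv3 := cont_exp 3 cv; have cv4 := cont_exp 4 cv.
set a := integral01 (fun t => v t ^+ 2); set d := integral01 (fun t => g t ^+ 2).
set Q := integral01 _.
have sv := square_integrable_continuous cv.
have cn : continuous (fun t => `|v t|).
  by move=> x; apply: cvg_comp (cv x) _; exact: norm_continuous.
(* The third absolute moment controls both the mean of v^3 and the size of its periodic primitive,
   while T^2 <= a Q lets one factor Q be cancelled at the end. *)
pose T := integral01 (fun t => `|v t| ^+ 3).
have TQ : T ^+ 2 <= a * Q.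
  have := cauchy_schwarz01 (square_integrable_continuous cn) (square_integrable_continuous (cont_exp 2 cv)).
  rewrite (_ : integral01 _ = T); last first.
    by congr integral01; apply/funext => t /=; rewrite -(real_normK (num_real (v t))) -exprS.
  rewrite (_ : integral01 _ = a); last first.
    by congr integral01; apply/funext => t; rewrite real_normK ?num_real.
  by rewrite (_ : integral01 _ = Q)//; congr integral01; apply/funext => t; rewrite -exprM.
have T0 : 0 <= T by apply: integral01_ge0 => t; exact: exprn_ge0.
set m := integral01 (fun t => v t ^+ 3).
have cn3 := cont_exp 3 cn.
have mT : `|m| <= T.
  rewrite ler_norml; apply/andP; split.
    rewrite -mulN1r -integral01Z; last exact: continuous_integ.
    apply: integral01_le => [||t]; try exact: continuous_integ.
      by apply: continuous_integ; exact: cont_scale.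
    by rewrite mulN1r -normrX lerNl -normrN ler_norm.
  apply: integral01_le => [||t]; try exact: continuous_integ.
  by rewrite -normrX ler_norm.
have [|||phi [phi0 pphi dphi]] := @periodic_primitive (fun t => v t ^+ 3 + - m).
- by apply: cont_add => //; exact: cont_const.
- by move=> t; rewrite pv.
- rewrite integral01D ?integral01_cst ?subrr//; apply: continuous_integ => //.
  exact: cont_const.
have cdphi : continuous (fun t => v t ^+ 3 + - m).
  by apply: cont_add => //; exact: cont_const.
have cphi := is_derive_continuous dphi.
have sphi := square_integrable_continuous cphi.
(* The derivative of phi t + m t is v^3, whose absolute value is the derivative of [Pa]. Hence |phi
   t + m t| <= Pa t <= T on [0, 1], and |m| <= T gives the factor 2. *)
have [Pa [Pa0 dPa]] := continuous_primitive cn3.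
have PaT : Pa 1 = T by rewrite /T (integral01_derive cn3 dPa) Pa0 subr0.
have phiT t : 0 <= t <= 1 -> `|phi t| <= 2 * T.
  move=> /andP[t0 t1].
  have PaM : Pa t <= T.
    rewrite -PaT; apply: (derive_ge0_le dPa _ t1).
    by move=> s; exact: exprn_ge0.
  have s3 s : `|v s ^+ 3| = `|v s| ^+ 3 by rewrite normrX.
  have b1 : (Pa 0 + (phi 0 + m * 0)) <= (Pa t + (phi t + m * t)).
    apply: (@derive_ge0_le R (fun t => Pa t + (phi t + m * t)) (fun t => `|v t| ^+ 3 + ((v t ^+ 3 + - m) + m * 1))) => //.
    move=> s; rewrite -s3 mulr1 subrK.
    by have := ler_norm (- (v s ^+ 3)); rewrite normrN; lra.
  have b2 : (Pa 0 + -1 * (phi 0 + m * 0)) <= (Pa t + -1 * (phi t + m * t)).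
    apply: (@derive_ge0_le R (fun t => Pa t + -1 * (phi t + m * t)) (fun t => `|v t| ^+ 3 + -1 * ((v t ^+ 3 + - m) + m * 1))) => //.
    move=> s; rewrite -s3 mulr1 subrK.
    by have := ler_norm (v s ^+ 3); lra.
  move: b1 b2; rewrite phi0 Pa0 => b1 b2.
  move: mT; rewrite !ler_norml => /andP[m1 m2].
  by apply/andP; split; nra.
have tphi : test_function phi by exact: test_function_derive pphi dphi cdphi.
have := vg _ tphi; rewrite (derive1_fun dphi).
rewrite (_ : (fun t => _) = (fun t => - m * v t + v t ^+ 4)); last first.
  by apply/funext => t; ring.
rewrite integral01_lin; [|exact: continuous_integ..].
rewrite -/Q => e.
have iv2 : integral01 v ^+ 2 <= a.
  have := cauchy_schwarz01 sv (square_integrable_continuous (@cont_const R 1)).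
  under eq_fun do rewrite mulr1.
  by under [X in _ <= _ * integral01 X]eq_fun do rewrite expr1n; rewrite integral01_cst mulr1.
have iphi2 : integral01 (fun t => phi t ^+ 2) <= (2 * T) ^+ 2.
  rewrite -[leRHS]integral01_cst; apply: le_Rintegral => //.
  - by apply: continuous_integ; exact: cont_exp.
  - by apply: continuous_integ; exact: cont_const.
  - move=> t /=; rewrite in_itv/= => /phiT h.
    by rewrite -[leLHS](real_normK (num_real (phi t))); apply: lerXn2r => //; rewrite ?nnegrE ?mulr_ge0.
have := cauchy_schwarz01 sg sphi; rewrite -/d => gphi.
have a0 : 0 <= a by exact: integral01_sqr_ge0.
have d0 : 0 <= d by exact: integral01_sqr_ge0.
have Q0 : 0 <= Q by apply: integral01_ge0 => t; rewrite -[4%N]/(2 * 2)%N exprM sqr_ge0.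
move: e; set X := integral01 v; set Y := integral01 _ => e.
rewrite -/X in iv2; rewrite -/Y in gphi.
have Y2 : Y ^+ 2 <= 4 * T ^+ 2 * d.
  apply: (le_trans gphi); rewrite [leRHS]mulrC ler_wpM2l//.
  by apply: (le_trans iphi2); rewrite exprMn -natrX.
have m2 : m ^+ 2 <= T ^+ 2.
  by rewrite -[leLHS](real_normK (num_real m)); apply: lerXn2r; rewrite ?nnegrE.
have mX : (m * X) ^+ 2 <= T ^+ 2 * a.
  by rewrite exprMn; apply: ler_pM => //; exact: sqr_ge0.
(* From Q = m X - Y one gets Q^2 <= 2 ((m X)^2 + Y^2) <= T^2 (2 a + 8 d) <= a Q (2 a + 8 d), and a
   (2 a + 8 d) <= 8 (a + d)^2. *)
have QQ : Q ^+ 2 <= Q * (8 * (a + d) ^+ 2).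
  have -> : Q = m * X - Y by lra.
  have h1 : (m * X - Y) ^+ 2 <= 2 * ((m * X) ^+ 2 + Y ^+ 2).
    have := sqr_ge0 (m * X + Y); nra.
  have -> : m * X - Y = Q by lra.
  move: h1; have -> : m * X - Y = Q by lra.
  move=> h1.
  have h2 : Q ^+ 2 <= T ^+ 2 * (2 * a + 8 * d) by nra.
  have h3 : T ^+ 2 * (2 * a + 8 * d) <= a * Q * (2 * a + 8 * d).
    by apply: ler_wpM2r => //; lra.
  apply: (le_trans h2); apply: (le_trans h3).
  have -> : a * Q * (2 * a + 8 * d) = Q * (a * (2 * a + 8 * d)) by ring.
  by apply: ler_wpM2l => //; nra.
have [Qp|] := ltP 0 Q; first by move: QQ; rewrite expr2 ler_pM2l.
by move=> Qn; apply: (le_trans Qn); rewrite mulr_ge0// sqr_ge0.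
Qed.

End weak.



(** * Integer translates of periodic and quasi-periodic functions *)

Section translation.
Context {R : realType}.
Implicit Types (f : R -> R) (x c : R).

Lemma translate_nat f c : (forall x, f (x + 1) = f x + c) ->
  forall (k : nat) x, f (x + k%:R) = f x + k%:R * c.
Proof.
move=> f1; elim=> [|k IH] x; first by rewrite addr0 mul0r addr0.
by rewrite -natr1 addrA f1 IH; ring.
Qed.

Lemma translate_int f c : (forall x, f (x + 1) = f x + c) ->
  forall (k : int) x, f (x + k%:~R) = f x + k%:~R * c.
Proof.
move=> f1 [k|k] x; first exact: translate_nat.
rewrite NegzE mulrNz; have := translate_nat f1 k.+1 (x - k.+1%:R).
by rewrite subrK => ->; ring.
Qed.

Lemma periodic_nat f : periodic f 1 -> forall (k : nat) x, f (x + k%:R) = f x.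
Proof.
move=> pf k x; rewrite (@translate_nat f 0) ?mulr0 ?addr0// => y.
by rewrite pf addr0.
Qed.

Lemma periodic_int f : periodic f 1 -> forall (k : int) x, f (x + k%:~R) = f x.
Proof.
move=> pf k x; rewrite (@translate_int f 0) ?mulr0 ?addr0// => y.
by rewrite pf addr0.
Qed.

End translation.

(** * Complete elliptic integrals *)

Section elliptic_integrals.
Context {R : realType}.
Implicit Types (h s x c t : R) (j : nat).

Definition sin2 s : R := sin (2 * pi * s) ^+ 2.

Definition rho h x : R := (Num.sqrt (1 - h * x))^-1.

(* With x = sin^2, ellint 0 h is the complete elliptic integral K(m = h), up to
   the factor pi / 2. *)
Definition ellint j h : R := integral01 (fun s => sin2 s ^+ j * rho h (sin2 s)).

Lemma sin2_ge0 s : 0 <= sin2 s. Proof. exact: sqr_ge0. Qed.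

Lemma sin2_le1 s : sin2 s <= 1.
Proof. by rewrite /sin2 sin2cos2 lerBlDr lerDl sqr_ge0. Qed.

Lemma mul2piD1 s : 2 * pi * (s + 1) = 2 * pi * s + pi *+ 2 :> R.
Proof. by rewrite mulr2n; ring. Qed.

Lemma sin2D1 s : sin2 (s + 1) = sin2 s.
Proof.
by rewrite /sin2 mul2piD1 sinD2pi.
Qed.

Lemma is_derive_sin2pi s :
  is_derive s 1 (fun u => sin (2 * pi * u)) (cos (2 * pi * s) * (2 * pi)).
Proof.
apply: (@is_derive_chain R sin (fun u => 2 * pi * u)).
by apply: (is_derive_eq (is_derive_scale (2 * pi) (is_derive_id s _))); rewrite mulr1.
Qed.

Lemma is_derive_cos2pi s :
  is_derive s 1 (fun u => cos (2 * pi * u)) (- sin (2 * pi * s) * (2 * pi)).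
Proof.
apply: (@is_derive_chain R cos (fun u => 2 * pi * u)).
by apply: (is_derive_eq (is_derive_scale (2 * pi) (is_derive_id s _))); rewrite mulr1.
Qed.

Lemma cont_sin2 : continuous sin2.
Proof. by apply: cont_exp; exact: is_derive_continuous is_derive_sin2pi. Qed.

Lemma den_gt0 h x : 0 <= h < 1 -> 0 <= x <= 1 -> 0 < 1 - h * x.
Proof. by move=> /andP[h0 h1] /andP[x0 x1]; nra. Qed.

Lemma sin2_01 s : 0 <= sin2 s <= 1. Proof. by rewrite sin2_ge0 sin2_le1. Qed.

Lemma rho_gt0 h x : 0 <= h < 1 -> 0 <= x <= 1 -> 0 < rho h x.
Proof. by move=> h01 x01; rewrite invr_gt0 sqrtr_gt0 den_gt0. Qed.

Lemma rho_sqr h x : 0 <= h < 1 -> 0 <= x <= 1 -> rho h x ^+ 2 = (1 - h * x)^-1.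
Proof. by move=> h01 x01; rewrite exprVn sqr_sqrtr// ltW// den_gt0. Qed.

Lemma rho_ge1 h x : 0 <= h < 1 -> 0 <= x <= 1 -> 1 <= rho h x.
Proof.
move=> h01 x01; rewrite /rho invf_ge1 ?sqrtr_gt0 ?den_gt0//.
rewrite -[leRHS]sqrtr1 ler_sqrt//.
by case/andP: h01; case/andP: x01; nra.
Qed.

(** After squaring and inverting, the claim is (1 - h' x) (1 - h y) <= (1 - h x) (1 - h' y), and the
    difference of the two sides is exactly (h' - h) (x - y). Thus rho h' / rho h is nondecreasing in
    x when h <= h'. *)
Lemma rho_le_sqr h h' x y : 0 <= h < 1 -> 0 <= h' < 1 -> 0 <= x <= 1 -> 0 <= y <= 1 ->
  0 <= (h' - h) * (x - y) -> rho h x * rho h' y <= rho h' x * rho h y.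
Proof.
move=> h01 h01' x01 y01 hx.
have a := rho_gt0 h01 x01; have b := rho_gt0 h01' y01.
have c := rho_gt0 h01' x01; have d := rho_gt0 h01 y01.
rewrite -(@ler_pXn2r _ 2) ?nnegrE ?(mulr_ge0 (ltW a) (ltW b)) ?(mulr_ge0 (ltW c) (ltW d))//.
rewrite !exprMn !rho_sqr// -!invfM lef_pV2 ?posrE ?mulr_gt0 ?den_gt0//.
by rewrite -subr_ge0; apply: (le_trans hx); rewrite le_eqVlt; apply/orP; left; apply/eqP; ring.
Qed.

Lemma rho_le h h' x : 0 <= h -> h <= h' -> h' < 1 -> 0 <= x <= 1 -> rho h x <= rho h' x.
Proof.
move=> h0 hh h1 x01; rewrite /rho lef_pV2 ?posrE ?sqrtr_gt0 ?den_gt0//; last 2 first.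
- by rewrite h0 (le_lt_trans hh).
- by rewrite h1 (le_trans h0).
by rewrite ler_sqrt; case/andP: x01 => x0 x1; nra.
Qed.

Lemma cont_rho h : 0 <= h < 1 -> continuous (fun s => rho h (sin2 s)).
Proof.
move=> h01 s; apply: cvgV; first by rewrite gt_eqF// sqrtr_gt0 den_gt0// sin2_01.
have := @cont_comp R Num.sqrt (fun s => 1 + - h * sin2 s) (@sqrt_continuous R).
move=> /(_ _ s) H; under eq_fun do rewrite -mulNr; rewrite -mulNr; apply: H.
by apply: cont_add; [exact: cont_const|apply: cont_scale; exact: cont_sin2].
Qed.

Lemma cont_ellint_integrand j h : 0 <= h < 1 -> continuous (fun s => sin2 s ^+ j * rho h (sin2 s)).
Proof. by move=> h01; apply: cont_mul; [apply: cont_exp; exact: cont_sin2|exact: cont_rho]. Qed.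

Lemma ellint_lin h a b c : 0 <= h < 1 ->
  integral01 (fun s => (a + b * sin2 s + c * sin2 s ^+ 2) * rho h (sin2 s)) =
  a * ellint 0 h + b * ellint 1 h + c * ellint 2 h.
Proof.
move=> h01; rewrite /ellint -!integral01Z; do ?[by apply: continuous_integ; exact: cont_ellint_integrand].
have ci j d : continuous (fun s => d * (sin2 s ^+ j * rho h (sin2 s))).
  by apply: cont_scale; exact: cont_ellint_integrand.
rewrite -!integral01D; try apply: continuous_integ; try exact: ci; last first.
  by apply: cont_add; exact: ci.
by congr integral01; apply/funext => s; rewrite expr0 expr1; ring.
Qed.

(** The functions sin cos and sin^3 cos are periodic, so their derivatives, polynomials in sin^2,
    integrate to 0; this determines the two moments successively. *)
Lemma integral01_sin2 : integral01 sin2 = 1 / 2 /\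
  integral01 (fun s => sin2 s ^+ 2) = 3 / 8.
Proof.
have d1 s : is_derive s 1 (fun u => sin (2 * pi * u) * cos (2 * pi * u))
    (2 * pi * 1 + (- (4 * pi)) * sin2 s).
  apply: (is_derive_eq (is_derive_mul (is_derive_sin2pi s) (is_derive_cos2pi s))).
  have := cos2Dsin2 (2 * pi * s); rewrite /sin2 => e.
  rewrite (_ : _ + _ = 2 * pi * (cos (2 * pi * s) ^+ 2 - sin (2 * pi * s) ^+ 2)); last by ring.
  by rewrite (_ : cos _ ^+ 2 = 1 - sin (2 * pi * s) ^+ 2); [ring|lra].
have d3 s : is_derive s 1 (fun u => sin (2 * pi * u) ^+ 3 * cos (2 * pi * u))
    (6 * pi * sin2 s + (- (8 * pi)) * sin2 s ^+ 2).
  apply: (is_derive_eq (is_derive_mul (is_derive_exp 2 (is_derive_sin2pi s)) (is_derive_cos2pi s))).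
  have := cos2Dsin2 (2 * pi * s); rewrite /sin2 => e.
  rewrite (_ : _ + _ = 2 * pi * (3 * sin (2 * pi * s) ^+ 2 * cos (2 * pi * s) ^+ 2 - (sin (2 * pi * s) ^+ 2) ^+ 2)); last by ring.
  by rewrite (_ : cos _ ^+ 2 = 1 - sin (2 * pi * s) ^+ 2); [ring|lra].
have s0 : sin (2 * pi * 0 : R) = 0 by rewrite mulr0 sin0.
have s1 : sin (2 * pi * 1 : R) = 0 by rewrite mulr1 mulr_natl sin2pi.
have cs := cont_sin2; have cs2 := cont_exp 2 cs.
have p0 := pi_gt0 R.
have e1 : integral01 sin2 = 1 / 2.
  have c1 : continuous (fun s => 2 * pi * 1 + - (4 * pi) * sin2 s).
    by apply: cont_add; [exact: cont_const|exact: cont_scale].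
  have := integral01_derive c1 d1.
  rewrite integral01D; try apply: continuous_integ; try exact: cont_const; try exact: cont_scale.
  rewrite integral01_cst integral01Z; last exact: continuous_integ.
  by rewrite s0 s1 !mul0r subrr; nra.
split => //.
have c3 : continuous (fun s => 6 * pi * sin2 s + - (8 * pi) * sin2 s ^+ 2).
  by apply: cont_add; exact: cont_scale.
have := integral01_derive c3 d3.
rewrite integral01D; try apply: continuous_integ; try exact: cont_scale.
rewrite !integral01Z; try exact: continuous_integ.
by rewrite s0 s1 e1 expr0n !mul0r subrr; nra.
Qed.

Lemma ellint_ge j h : 0 <= h < 1 -> integral01 (fun s => sin2 s ^+ j) <= ellint j h.
Proof.
move=> h01; apply: integral01_le => [||s].
- by apply: continuous_integ; apply: cont_exp; exact: cont_sin2.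
- by apply: continuous_integ; exact: cont_ellint_integrand.
- by apply: ler_peMr; [exact: exprn_ge0 (sin2_ge0 s)|exact: rho_ge1 h01 (sin2_01 s)].
Qed.

Lemma ellint0_gt0 h : 0 <= h < 1 -> 0 < ellint 0 h.
Proof.
move=> h01; apply: lt_le_trans (ellint_ge 0 h01).
by under eq_fun do rewrite expr0; rewrite integral01_cst.
Qed.

Lemma ellint1_gt0 h : 0 <= h < 1 -> 0 < ellint 1 h.
Proof.
move=> h01; apply: lt_le_trans (ellint_ge 1 h01).
by under eq_fun do rewrite expr1; rewrite integral01_sin2.1; lra.
Qed.

Lemma ellint2_gt0 h : 0 <= h < 1 -> 0 < ellint 2 h.
Proof.
move=> h01; apply: lt_le_trans (ellint_ge 2 h01).
by rewrite integral01_sin2.2; lra.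
Qed.

Lemma ellint21_le h : 0 <= h < 1 -> ellint 2 h <= ellint 1 h.
Proof.
move=> h01; apply: integral01_le => [||s].
- by apply: continuous_integ; exact: cont_ellint_integrand.
- by apply: continuous_integ; exact: cont_ellint_integrand.
- have := rho_gt0 h01 (sin2_01 s); have := sin2_ge0 s; have := sin2_le1 s => s1 s0 r0.
  by apply: (ler_wpM2r (ltW r0)); rewrite expr1; nra.
Qed.

Lemma ellint_le j h h' : 0 <= h -> h <= h' -> h' < 1 -> ellint j h <= ellint j h'.
Proof.
move=> h0 hh h1; apply: integral01_le => [||s].
- by apply: continuous_integ; apply: cont_ellint_integrand; rewrite h0 (le_lt_trans hh).
- by apply: continuous_integ; apply: cont_ellint_integrand; rewrite h1 (le_trans h0).
- apply: ler_wpM2l; first exact: exprn_ge0 (sin2_ge0 s).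
  exact: rho_le (sin2_01 s).
Qed.

(* Chebyshev: rho h' / rho h is an increasing function of x, hence replacing the
   weight rho h by rho h' increases the mean of x. *)
Lemma ellint_ratio_le h h' : 0 <= h -> h <= h' -> h' < 1 ->
  ellint 2 h * ellint 1 h' <= ellint 2 h' * ellint 1 h.
Proof.
move=> h0 hh h1.
have h01 : 0 <= h < 1 by rewrite h0 (le_lt_trans hh).
have h01' : 0 <= h' < 1 by rewrite h1 (le_trans h0).
have i1 := ellint1_gt0 h01.
(* This is the mean of x for the weight x rho h, so that x (x - c) integrates to 0 against rho h. It
   remains to see that its integral against rho h' is nonnegative. *)
pose c := ellint 2 h / ellint 1 h.
have ce : ellint 2 h = c * ellint 1 h by rewrite divfK// gt_eqF.
have c01 : 0 <= c <= 1.
  rewrite divr_ge0 ?(ltW (ellint2_gt0 _)) ?(ltW i1)//=.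
  by rewrite ler_pdivrMr// mul1r ellint21_le.
suff H : 0 <= 0 * ellint 0 h' + - c * ellint 1 h' + 1 * ellint 2 h'.
  rewrite ce; have : c * ellint 1 h' <= ellint 2 h' by lra.
  by move=> /(ler_wpM2r (ltW i1)) ?; rewrite mulrAC.
rewrite -ellint_lin//.
have cc g : 0 <= g < 1 ->
    continuous (fun s => (0 + - c * sin2 s + 1 * sin2 s ^+ 2) * rho g (sin2 s)).
  move=> g01; apply: cont_mul; last exact: cont_rho.
  apply: cont_add; last by apply: cont_scale; apply: cont_exp; exact: cont_sin2.
  by apply: cont_add; [exact: cont_const|apply: cont_scale; exact: cont_sin2].
have rc := rho_gt0 h01 c01.
rewrite -(pmulr_rge0 _ rc) -integral01Z; last by apply: continuous_integ; exact: cc.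
(* The two weights are normalised to agree at x = c. Then x (x - c) rho h(c) rho h'(x) dominates x
   (x - c) rho h'(c) rho h(x) pointwise, on either side of c, and the latter integrates to 0. *)
have e : rho h' c * integral01 (fun s => (0 + - c * sin2 s + 1 * sin2 s ^+ 2) * rho h (sin2 s)) = 0.
  by rewrite ellint_lin// ce; ring.
rewrite -[leLHS]e -integral01Z; last by apply: continuous_integ; exact: cc.
apply: integral01_le => [||s].
- by apply: continuous_integ; apply: cont_scale; exact: cc.
- by apply: continuous_integ; apply: cont_scale; exact: cc.
have s01 := sin2_01 s; have s0 := sin2_ge0 s.
set x := sin2 s in s01 s0 *.
have [xc|xc] := leP c x.
  have := @rho_le_sqr h h' x c h01 h01' s01 c01.
  have : 0 <= (h' - h) * (x - c) by apply: mulr_ge0; lra.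
  move=> /[swap] /[apply] ineq.
  have -> : rho h' c * ((0 + - c * x + 1 * x ^+ 2) * rho h x) = x * (x - c) * (rho h x * rho h' c) by ring.
  have -> : rho h c * ((0 + - c * x + 1 * x ^+ 2) * rho h' x) = x * (x - c) * (rho h' x * rho h c) by ring.
  by apply: ler_wpM2l => //; apply: mulr_ge0 => //; lra.
have := @rho_le_sqr h h' c x h01 h01' c01 s01.
have : 0 <= (h' - h) * (c - x) by apply: mulr_ge0; lra.
move=> /[swap] /[apply] ineq.
have -> : rho h' c * ((0 + - c * x + 1 * x ^+ 2) * rho h x) = - (x * (c - x) * (rho h' c * rho h x)) by ring.
have -> : rho h c * ((0 + - c * x + 1 * x ^+ 2) * rho h' x) = - (x * (c - x) * (rho h c * rho h' x)) by ring.
rewrite lerN2; by apply: ler_wpM2l => //; apply: mulr_ge0 => //; lra.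
Qed.

(** The integrand is, up to the factor 2 pi, the derivative of the periodic function sin cos (1 - h
    sin^2)^(1/2). The identity later eliminates I_0 from the critical point equations. *)
Lemma ellint_moment_identity h : 0 <= h < 1 ->
  ellint 0 h - 2 * (1 + h) * ellint 1 h + 3 * h * ellint 2 h = 0.
Proof.
move=> h01.
have dw s : is_derive s 1 (fun u => Num.sqrt (1 - h * sin2 u))
    (- (2 * pi) * h * sin (2 * pi * s) * cos (2 * pi * s) * rho h (sin2 s)).
  have dpos := den_gt0 h01 (sin2_01 s).
  have d1 : is_derive s 1 (fun u => 1 - h * sin2 u) (0 + - h * (2%:R * sin (2 * pi * s) ^+ 1 * (cos (2 * pi * s) * (2 * pi)))).
    apply: (@is_derive_ext R (fun u => 1 + - h * sin (2 * pi * u) ^+ 2)).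
      by move=> u; rewrite /sin2 mulNr.
    apply: is_derive_add; apply: is_derive_scale; apply: is_derive_exp; exact: is_derive_sin2pi.
  apply: (is_derive_eq (@is_derive_chain R Num.sqrt (fun u => 1 - h * sin2 u) s _ _ (is_derive1_sqrt dpos) d1)).
  rewrite /rho -/(sin2 s); set w := Num.sqrt _.
  have w0 : w != 0 by rewrite gt_eqF// sqrtr_gt0.
  by rewrite expr1; field.
have dF s : is_derive s 1 (fun u => (sin (2 * pi * u) * cos (2 * pi * u)) * Num.sqrt (1 - h * sin2 u))
    (2 * pi * ((1 + - (2 * (1 + h)) * sin2 s + 3 * h * sin2 s ^+ 2) * rho h (sin2 s))).
  apply: (is_derive_eq (is_derive_mul (is_derive_mul (is_derive_sin2pi s) (is_derive_cos2pi s)) (dw s))).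
  have dpos := den_gt0 h01 (sin2_01 s).
  (* Writing the root as (1 - h x) rho makes rho a common factor, so that a polynomial in x
     remains. *)
  rewrite {1}(_ : Num.sqrt _ = (1 - h * sin2 s) * rho h (sin2 s)); last first.
    by rewrite /rho -{2}(sqr_sqrtr (ltW dpos)) expr2 mulfK// gt_eqF// sqrtr_gt0.
  have c2 : cos (2 * pi * s) ^+ 2 = 1 - sin2 s by rewrite cos2sin2.
  set r := rho h _; rewrite (_ : _ + _ = 2 * pi * (((cos (2 * pi * s) ^+ 2 - sin2 s) * (1 - h * sin2 s) - h * sin2 s * cos (2 * pi * s) ^+ 2) * r)); last first.
    by rewrite /sin2; ring.
  by rewrite c2; congr (_ * _); congr (_ * _); ring.
have cc : continuous (fun s => (1 + - (2 * (1 + h)) * sin2 s + 3 * h * sin2 s ^+ 2) * rho h (sin2 s)).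
  apply: cont_mul; last exact: cont_rho.
  apply: cont_add; last by apply: cont_scale; apply: cont_exp; exact: cont_sin2.
  by apply: cont_add; [exact: cont_const|apply: cont_scale; exact: cont_sin2].
have := integral01_derive (cont_scale (2 * pi) cc) dF.
rewrite integral01Z; last exact: continuous_integ.
rewrite ellint_lin// (mulr0 (2 * pi)) (mulr1 (2 * pi)) sin0 mulr_natl sin2pi !mul0r subrr.
have p0 := pi_gt0 R.
by move=> /eqP; rewrite mulf_eq0 mulrn_eq0 (gt_eqF p0)/= => /eqP; lra.
Qed.

(** Below the cutoff 3/4 the integrand is dominated by the constant (1 - 3/4)^(-1/2) = 2. The range
    contains [1/8, 1/2], where the intermediate value theorem is applied. *)
Lemma ellint_continuous j h : 0 < h < 3 / 4 -> {for h, continuous (ellint j)}.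
Proof.
move=> hh.
have I01E x : `]0, (3 / 4 : R)[%classic x -> 0 <= x < 1.
  by rewrite /= in_itv/= => /andP[x0 x1]; apply/andP; split; lra.
have := @continuity_under_integral R _ _ lebesgue_measure
  (fun h s => sin2 s ^+ j * rho h (sin2 s)) `[0, 1]%classic (measurable_itv _) 0 (3 / 4).
move=> /(_ _ _ (fun=> 2)); apply => //.
- move=> x /I01E x01; apply: continuous_integ; exact: cont_ellint_integrand.
- apply: aeW => s _ x /set_mem /I01E x01.
  apply: cvgM; first exact: cvg_cst.
  apply: cvgV; first by rewrite gt_eqF// sqrtr_gt0 den_gt0// sin2_01.
  apply: (@cont_comp R Num.sqrt (fun x => 1 - x * sin2 s)); first exact: sqrt_continuous.
  move=> y; apply: cvgB; first exact: cvg_cst.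
  by apply: cvgM; [exact: cvg_id|exact: cvg_cst].
- by apply: continuous_integ; exact: cont_const.
- move=> x xI; have x01 := I01E _ xI; apply: aeW => s _.
  have r0 := rho_gt0 x01 (sin2_01 s).
  have r2 : rho x (sin2 s) <= 2.
    rewrite -(@ler_pXn2r _ 2) ?nnegrE ?(ltW r0)// rho_sqr ?sin2_01//.
    rewrite invf_ple ?posrE ?den_gt0 ?sin2_01//.
    move: xI; rewrite /= in_itv/= => /andP[x0 x1].
    have := sin2_ge0 s; have := sin2_le1 s => s1 s0.
    rewrite [leLHS](_ : _ = 1 / 4 :> R); [nra|by field].
  have sj0 := exprn_ge0 j (sin2_ge0 s).
  rewrite ger0_norm ?(mulr_ge0 sj0 (ltW r0))// -[leRHS]mul1r.
  by apply: (ler_pM sj0 (ltW r0) _ r2); apply: exprn_ile1 (sin2_le1 s); exact: sin2_ge0.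
- by rewrite inE/= in_itv.
Qed.

(** At h = 1/8 the factor 8 h is 1 and I_2 <= I_1. At h = 1/2 it is 4, while I_2 / I_1 is at least
    its value 3/4 at h = 0, hence exceeds 1/2. *)
Lemma ellint_symmetric_root : exists2 h, 0 < h < 1 & 8 * h * ellint 2 h ^+ 2 = ellint 1 h ^+ 2.
Proof.
pose F h := 8 * h * ellint 2 h ^+ 2 - ellint 1 h ^+ 2.
have b8 : 0 <= (1 / 8 : R) < 1 by lra.
have b2 : 0 <= (1 / 2 : R) < 1 by lra.
have F8 : F (1 / 8) <= 0.
  have := ellint21_le b8; have := ellint2_gt0 b8.
  by rewrite /F (_ : 8 * (1 / 8) = 1 :> R); [nra|field].
have F2 : 0 <= F (1 / 2).
  have := ellint_ratio_le (lexx 0) (ltW (_ : (0 : R) < 1 / 2)) _.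
  have E j : ellint j 0 = integral01 (fun s => sin2 s ^+ j).
    by congr integral01; apply/funext => s; rewrite /rho mul0r subr0 sqrtr1 invr1 mulr1.
  have e1 : integral01 (fun s => sin2 s ^+ 1) = 1 / 2.
    by under eq_fun do rewrite expr1; rewrite integral01_sin2.1.
  rewrite !E integral01_sin2.2 e1 => H.
  have {}H : 3 / 8 * ellint 1 (1 / 2) <= ellint 2 (1 / 2) * (1 / 2) by apply: H; lra.
  have := ellint1_gt0 b2; rewrite /F (_ : 8 * (1 / 2) = 4 :> R); last by field.
  by move=> e0; nra.
have le82 : (1 / 8 : R) <= 1 / 2 by lra.
have [||h hI Fh] := IVT (f := F) (v := 0) le82.
- apply: continuous_in_subspaceT => h; rewrite inE/= in_itv/= => /andP[h1 h2].
  have hh : 0 < h < 3 / 4 by apply/andP; split; lra.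
  have c2 := @ellint_continuous 2 h hh; have c1 := @ellint_continuous 1 h hh.
  apply: cvgB.
    apply: cvgM; first by apply: cvgM; [exact: cvg_cst|exact: cvg_id].
    by under eq_fun do rewrite expr2; apply: cvgM.
  by under eq_fun do rewrite expr2; apply: cvgM.
- by rewrite ge_min F8/= le_max F2 orbT.
exists h; last by move: Fh; rewrite /F; lra.
by move: hI; rewrite in_itv/= => /andP[h1 h2]; apply/andP; split; lra.
Qed.

End elliptic_integrals.



(** * Jacobi elliptic functions *)

Section jacobi.
Context {R : realType}.
Implicit Types (h s x c t : R) (j k : nat).

(** Jacobi's amplitude am, measured in full turns and with time rescaled so that a turn takes time
    1. No value at 0 is prescribed: the function is fixed up to a time shift only, and [sn_max]
    locates the phase where it matters. *)
Definition is_amplitude h (A : R -> R) : Prop :=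
  [/\ forall t, A (t + 1) = A t + 1,
      forall t, is_derive t 1 A (ellint 0 h / rho h (sin2 (A t))),
      injective A & forall s, exists t, A t = s].

(** The amplitude is the inverse of the incomplete elliptic integral T(s), the integral of rho h
    from 0 to s divided by I_0. T is strictly increasing with T(s + 1) = T(s) + 1, hence a bijection
    of the line. *)
Lemma is_amplitude_exists h : 0 <= h < 1 -> exists A, is_amplitude h A.
Proof.
move=> h01; have I0 := ellint0_gt0 h01.
have cr := cont_rho h01.
have [P [P0 dP]] := continuous_primitive cr.
have rp s : 0 < rho h (sin2 s) by apply: rho_gt0 (sin2_01 s).
have PD s : P (s + 1) = P s + ellint 0 h.
  rewrite (primitive_addn1 cr _ dP) => [|u]; last by rewrite sin2D1.
  by congr (_ + _); congr integral01; apply/funext => u; rewrite expr0 mul1r.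
pose T s := (ellint 0 h)^-1 * P s.
have TD s : T (s + 1) = T s + 1 by rewrite /T PD mulrDr mulVf// gt_eqF.
have dT s : is_derive s 1 T ((ellint 0 h)^-1 * rho h (sin2 s)) by exact: is_derive_scale.
have cT := is_derive_continuous dT.
have T0 : T 0 = 0 by rewrite /T P0 mulr0.
have Tlt a b : a < b -> T a < T b.
  move=> ab; apply: (@gtr0_derive1_lt_cc R T a b); rewrite ?in_itv/= ?lexx ?(ltW ab)//.
  - by move=> x _; rewrite (derive1_fun dT) mulr_gt0// invr_gt0.
  - exact: continuous_subspaceT.
have Tinj : injective T.
  move=> a b Tab; have [ab|ab|//] := ltgtP a b; by have := Tlt _ _ ab; rewrite Tab ltxx.
have Tsurj t : exists s, T s = t.
  have T1 : T 1 = 1 by rewrite -[X in T X]add0r TD T0 add0r.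
  have fl := floor_itv t.
  have [||s _ Ts] := @IVT R T 0 1 (t - (Num.floor t)%:~R) ler01.
  - exact: continuous_subspaceT.
  - move: fl; rewrite intrD T0 T1 ge_min le_max => /andP[f1 f2]; apply/andP; split.
      by apply/orP; left; lra.
    by apply/orP; right; lra.
  exists (s + (Num.floor t)%:~R).
  by rewrite (translate_int TD) Ts mulr1 subrK.
have /choice[A AK] : forall t, exists s, T s = t by [].
have TK : cancel T A by move=> s; apply: Tinj; rewrite AK.
exists A; split.
- by move=> t; apply: Tinj; rewrite TD !AK.
- move=> t; have nz : (ellint 0 h)^-1 * rho h (sin2 (A t)) != 0.
    by rewrite gt_eqF// mulr_gt0// invr_gt0.
  have := @is_derive_inverse R T A _ (A t) _ _ (dT (A t)) nz.
  rewrite AK => H; apply: (is_derive_eq (H _ _)).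
  + by near=> x; exact: TK.
  + by near=> x; exact: cT.
  + by rewrite invfM invrK.
- by move=> t u Atu; rewrite -[t]AK -[u]AK Atu.
- by move=> s; exists (T s).
Unshelve. all: by end_near. Qed.

Definition amp h : R -> R := xget 0 [set A | is_amplitude h A].

Lemma ampP h : 0 <= h < 1 -> is_amplitude h (amp h).
Proof.
move=> /is_amplitude_exists[A hA]; rewrite /amp; case: xgetP => // /(_ A).
by move=> /(_ hA).
Qed.

(* The Jacobi elliptic functions of parameter m = h, with the time variable
   rescaled by jfreq h = 4 K(h), so that their period is 1. *)
Definition jfreq h : R := 2 * pi * ellint 0 h.
Definition sn h t : R := sin (2 * pi * amp h t).
Definition cn h t : R := cos (2 * pi * amp h t).
Definition dn h t : R := Num.sqrt (1 - h * sn h t ^+ 2).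

Lemma jfreq_gt0 h : 0 <= h < 1 -> 0 < jfreq h.
Proof. by move=> h01; rewrite !mulr_gt0 ?pi_gt0 ?ellint0_gt0. Qed.

Lemma sin2_amp h t : sin2 (amp h t) = sn h t ^+ 2. Proof. by []. Qed.

Lemma sn2_01 h t : 0 <= sn h t ^+ 2 <= 1. Proof. exact: sin2_01. Qed.

Lemma dn_gt0 h t : 0 <= h < 1 -> 0 < dn h t.
Proof. by move=> h01; rewrite sqrtr_gt0 den_gt0// sn2_01. Qed.

Lemma dn_sqr h t : 0 <= h < 1 -> dn h t ^+ 2 = 1 - h * sn h t ^+ 2.
Proof. by move=> h01; rewrite sqr_sqrtr// ltW// den_gt0// sn2_01. Qed.

Lemma cn_sqr h t : cn h t ^+ 2 = 1 - sn h t ^+ 2. Proof. exact: cos2sin2. Qed.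

Lemma is_derive_amp h t : 0 <= h < 1 -> is_derive t 1 (amp h) (ellint 0 h * dn h t).
Proof.
by move=> h01; have [_ dA _ _] := ampP h01; apply: (is_derive_eq (dA t)); rewrite invrK.
Qed.

Lemma is_derive_sn h t : 0 <= h < 1 ->
  is_derive t 1 (sn h) (jfreq h * (cn h t * dn h t)).
Proof.
move=> h01; have dA := is_derive_amp t h01.
apply: (is_derive_eq (@is_derive_chain R _ (amp h) t _ _ (is_derive_sin2pi (amp h t)) dA)).
by rewrite /jfreq /cn; ring.
Qed.

Lemma is_derive_cn h t : 0 <= h < 1 ->
  is_derive t 1 (cn h) (- jfreq h * (sn h t * dn h t)).
Proof.
move=> h01; have dA := is_derive_amp t h01.
apply: (is_derive_eq (@is_derive_chain R _ (amp h) t _ _ (is_derive_cos2pi (amp h t)) dA)).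
by rewrite /jfreq /sn; ring.
Qed.

Lemma is_derive_dn h t : 0 <= h < 1 ->
  is_derive t 1 (dn h) (- jfreq h * h * (sn h t * cn h t)).
Proof.
move=> h01; have dpos := den_gt0 h01 (sn2_01 h t).
have d1 : is_derive t 1 (fun u => 1 - h * sn h u ^+ 2)
    (0 + - h * (2%:R * sn h t ^+ 1 * (jfreq h * (cn h t * dn h t)))).
  apply: (@is_derive_ext R (fun u => 1 + - h * sn h u ^+ 2)).
    by move=> u; rewrite mulNr.
  apply: is_derive_add; apply: is_derive_scale; apply: is_derive_exp; exact: is_derive_sn.
apply: (is_derive_eq (@is_derive_chain R Num.sqrt (fun u => 1 - h * sn h u ^+ 2) t _ _ (is_derive1_sqrt dpos) d1)).
have := dn_gt0 t h01; rewrite /dn; set w := Num.sqrt _ => w0.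
by rewrite expr1; field; rewrite gt_eqF.
Qed.

Definition dsn h t : R := jfreq h * (cn h t * dn h t).

Lemma is_derive_dsn h t : 0 <= h < 1 ->
  is_derive t 1 (dsn h) (jfreq h ^+ 2 * (- (1 + h) * sn h t + 2 * h * sn h t ^+ 3)).
Proof.
move=> h01.
apply: (is_derive_eq (is_derive_scale (jfreq h) (is_derive_mul (is_derive_cn t h01) (is_derive_dn t h01)))).
transitivity (- jfreq h ^+ 2 * (sn h t * dn h t ^+ 2 + h * sn h t * cn h t ^+ 2)); first by ring.
by rewrite dn_sqr// cn_sqr; ring.
Qed.

Lemma sn_periodic h : 0 <= h < 1 -> periodic (sn h) 1.
Proof.
move=> h01 t; have [AD _ _ _] := ampP h01; rewrite /sn AD.
rewrite mul2piD1.
by rewrite sinD2pi.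
Qed.

Lemma dsn_periodic h : 0 <= h < 1 -> periodic (dsn h) 1.
Proof.
move=> h01 t; have sp := sn_periodic h01 t.
rewrite /dsn /dn sp /cn; have [AD _ _ _] := ampP h01; rewrite AD.
rewrite mul2piD1.
by rewrite cosD2pi.
Qed.

Lemma sn_norm_le1 h t : `|sn h t| <= 1. Proof. exact: sin_max. Qed.

Lemma cont_sn h : 0 <= h < 1 -> continuous (sn h).
Proof. by move=> h01; apply: is_derive_continuous => t; exact: is_derive_sn. Qed.

Lemma sin2pi_eq1 s : sin (2 * pi * s) = 1 -> exists k : int, s = 1 / 4 + k%:~R.
Proof.
move=> s1; have p0 := pi_gt0 R.
have per : periodic (fun u : R => sin (2 * pi * u)) 1.
  move=> u; rewrite mul2piD1.
  exact: sinD2pi.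
(* Reduction to the window [-1/4, 3/4) centred at the maximum 1/4: there 2 pi x - pi / 2 lies in
   [-pi, pi), and cos, being even and injective on [0, pi], takes the value 1 only at 0. *)
pose m := Num.floor (s + 1 / 4); have := floor_itv (s + 1 / 4); rewrite -/m intrD => /andP[m1 m2].
pose x := s - m%:~R.
have x1 : sin (2 * pi * x) = 1 by rewrite -[RHS]s1 -[RHS](periodic_int per (- m)) mulrNz.
have xi : - (1 / 4) <= x < 3 / 4 by rewrite /x; apply/andP; split; lra.
exists m; suff : x = 1 / 4 by rewrite /x; lra.
case/andP: xi => x2 x3.
have c1 : cos (2 * pi * x - pi / 2) = 1 by rewrite cosBpihalf.
have [xl|xl] := leP (1 / 4) x.
  have : 2 * pi * x - pi / 2 = 0.
    by apply: cos_inj; rewrite ?in_itv/= ?lexx ?cos0//; nra.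
  by move=> e; apply: (mulfI (lt0r_neq0 p0)); lra.
have : - (2 * pi * x - pi / 2) = 0.
  by apply: cos_inj; rewrite ?in_itv/= ?lexx ?cosN ?cos0//; nra.
by move=> e; apply: (mulfI (lt0r_neq0 p0)); lra.
Qed.

(** The maximum is attained only at the integer translates of t0. This is what forces the frequency
    of a 1-periodic solution to be an integer. *)
Lemma sn_max h : 0 <= h < 1 -> exists t0,
  [/\ sn h t0 = 1, dsn h t0 = 0 &
      forall c, sn h (c + t0) = 1 -> exists k : int, c = k%:~R].
Proof.
move=> h01; have [AD _ Ainj Asurj] := ampP h01.
have [t0 At0] := Asurj (1 / 4).
have e : 2 * pi * (1 / 4) = pi / 2 :> R by field.
exists t0; split; first by rewrite /sn At0 e sin_pihalf.
  by rewrite /dsn /cn At0 e cos_pihalf mul0r mulr0.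
move=> c /sin2pi_eq1[k ck]; exists k.
have : c + t0 = t0 + k%:~R.
  by apply: Ainj; rewrite ck (translate_int AD) At0 mulr1.
lra.
Qed.

(** Change of variable s = amp (k t + c): ds = k I_0 dn dt and rho dn = 1, while s advances by k as
    t runs over [0, 1]. The integral of the angular density over k turns is k I_j, and k cancels. *)
Lemma sn_moment h j k c : 0 <= h < 1 -> (0 < k)%N ->
  integral01 (fun t => (sn h (k%:R * t + c) ^+ 2) ^+ j) = ellint j h / ellint 0 h.
Proof.
move=> h01 k0; have I0 := ellint0_gt0 h01; have [AD _ _ _] := ampP h01.
have kp : 0 < k%:R :> R by rewrite ltr0n.
have ci := @cont_ellint_integrand R j h h01.
have [F [_ dF]] := continuous_primitive ci.
have FD s : F (s + 1) = F s + ellint j h.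
  by rewrite (primitive_addn1 ci _ dF)// => u; rewrite sin2D1.
have dG t : is_derive t 1 (fun t => F (amp h (k%:R * t + c)))
    (k%:R * ellint 0 h * ((sn h (k%:R * t + c) ^+ 2) ^+ j)).
  have d1 := @is_derive_chain R (amp h) (fun t => k%:R * t + c) t _ _ (is_derive_amp _ h01) (is_derive_affine _ _ _).
  apply: (is_derive_eq (@is_derive_chain R F _ t _ _ (dF _) d1)).
  rewrite sin2_amp /rho -/(dn h _); set u := k%:R * t + c.
  by have := dn_gt0 u h01 => d0; field; rewrite gt_eqF.
have cs : continuous (fun t => (sn h (k%:R * t + c) ^+ 2) ^+ j).
  apply: cont_exp; apply: cont_exp; apply: (@cont_comp R (sn h)); first exact: cont_sn.
  by apply: is_derive_continuous => t; exact: is_derive_affine.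
have := integral01_derive (cont_scale _ cs) dG.
rewrite integral01Z; last exact: continuous_integ.
rewrite mulr1 mulr0 add0r [k%:R + c]addrC (translate_nat AD) mulr1 (translate_nat FD) [F _ + _]addrC addrK.
set X := integral01 _ => e.
have nz : k%:R * ellint 0 h != 0 by rewrite gt_eqF// mulr_gt0.
apply: (mulfI nz); rewrite e; field; by rewrite gt_eqF.
Qed.

End jacobi.



(** * The Duffing equation *)

Section duffing.
Context {R : realType}.
Implicit Types (z p w E : R -> R) (a b c h t M : R).

(** E exp(-C t) is nonincreasing and E exp(C t) nondecreasing, which gives E <= 0 after and before
    t0 respectively. *)
Lemma gronwall_eq0 E (E' : R -> R) C t0 : (forall t, is_derive t 1 E (E' t)) ->
  (forall t, 0 <= E t) -> (forall t, `|E' t| <= C * E t) -> E t0 = 0 ->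
  forall t, E t = 0.
Proof.
move=> dE E0 EC Et0 t; apply/eqP; rewrite eq_le E0 andbT.
have dexp (r s : R) : is_derive s 1 (fun u => expR (r * u)) (expR (r * s) * r).
  apply: (@is_derive_chain R expR (fun u => r * u)).
  by apply: (is_derive_eq (is_derive_scale r (is_derive_id s _))); rewrite mulr1.
have ep (r s : R) : 0 < expR (r * s) by exact: expR_gt0.
have [tt0|/ltW tt0] := leP t0 t.
  have := @derive_ge0_le R (fun s => (- 1) * (E s * expR (- C * s)))
    (fun s => (- 1) * (E' s * expR (- C * s) + E s * (expR (- C * s) * - C))) t0 t.
  move=> /(_ _ _ tt0); rewrite Et0 mul0r mulr0.
  have -> : -1 * (E t * expR (- C * t)) = - E t * expR (- C * t) by ring.
  rewrite pmulr_lge0// oppr_ge0; apply.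
    by move=> s; apply: is_derive_scale; exact: is_derive_mul.
  move=> s; have := EC s; rewrite ler_norml => /andP[_ h].
  by have := ep (- C) s; nra.
have := @derive_ge0_le R (fun s => E s * expR (C * s))
  (fun s => E' s * expR (C * s) + E s * (expR (C * s) * C)) t t0.
move=> /(_ _ _ tt0); rewrite Et0 mul0r pmulr_lle0//; apply.
  by move=> s; exact: is_derive_mul.
move=> s; have := EC s; rewrite ler_norml => /andP[h _].
by have := ep C s; nra.
Qed.

Definition duffing_solution a b z p : Prop :=
  (forall t, is_derive t 1 z (p t)) /\
  (forall t, is_derive t 1 p (a * z t + b * z t ^+ 3)).

(** Gronwall's inequality for the squared distance in the phase plane. The cubic is only locally
    Lipschitz, and the bound B on both solutions provides the constant, through |z^2 + z w + w^2| <=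
    3 B^2. *)
Lemma duffing_unique a b B z p w q t0 : duffing_solution a b z p ->
  duffing_solution a b w q -> (forall t, `|z t| <= B) -> (forall t, `|w t| <= B) ->
  z t0 = w t0 -> p t0 = q t0 -> forall t, z t = w t.
Proof.
move=> [dz dp] [dw dq] zB wB zw pq t.
pose E s := (z s + -1 * w s) ^+ 2 + (p s + -1 * q s) ^+ 2.
have du s := is_derive_add (dz s) (is_derive_scale (-1) (dw s)).
have dv s := is_derive_add (dp s) (is_derive_scale (-1) (dq s)).
have dE s := is_derive_add (is_derive_exp 1 (du s)) (is_derive_exp 1 (dv s)).
have E0 s : 0 <= E s by rewrite addr_ge0// sqr_ge0.
suff : E t = 0.
  move=> /eqP; rewrite paddr_eq0 ?sqr_ge0// => /andP[/eqP + _].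
  by move=> /eqP; rewrite sqrf_eq0 => /eqP; lra.
apply: (@gronwall_eq0 E _ (1 + `|a| + 3 * `|b| * B ^+ 2) t0 dE E0); last first.
  by rewrite /E zw pq !mulN1r !subrr expr0n/= addr0.
move=> s; rewrite /E !expr1.
set u := z s + -1 * w s; set v := p s + -1 * q s.
have -> : 2 * u * (p s + -1 * q s) + 2 * v * (a * z s + b * z s ^+ 3 + -1 * (a * w s + b * w s ^+ 3))
  = 2 * (u * v) * (1 + a + b * (z s ^+ 2 + z s * w s + w s ^+ 2)) by rewrite /u /v; ring.
have B0 : 0 <= B by apply: le_trans (zB s).
have uv : `|2 * (u * v)| <= u ^+ 2 + v ^+ 2.
  by rewrite ler_norml; apply/andP; split; have := sqr_ge0 (u + v); have := sqr_ge0 (u - v); nra.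
rewrite normrM mulrC; apply: ler_pM => //.
apply: (le_trans (ler_normD _ _)); apply: lerD.
  by apply: (le_trans (ler_normD _ _)); rewrite normr1.
rewrite normrM [3 * _]mulrC -mulrA; apply: ler_wpM2l => //.
have zz (x y : R) : `|x| <= B -> `|y| <= B -> `|x * y| <= B ^+ 2.
  by move=> xB yB; rewrite normrM expr2; apply: ler_pM.
have -> : 3 * B ^+ 2 = B ^+ 2 + B ^+ 2 + B ^+ 2 by ring.
rewrite !expr2 -!expr2 in zz *; rewrite ![_ s ^+ 2]expr2.
apply: (le_trans (ler_normD _ _)); apply: lerD; last exact: zz.
by apply: (le_trans (ler_normD _ _)); apply: lerD; exact: zz.
Qed.

Lemma periodic_EVT_max (f : R -> R) : continuous f -> periodic f 1 ->
  exists t0, forall t, f t <= f t0.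
Proof.
move=> cf pf; have [||t0 _ ft0] := @EVT_max R f 0 1.
- exact: ler01.
- exact: continuous_subspaceT.
exists t0 => t; have fl := floor_itv t.
rewrite -(periodic_int pf (- Num.floor t)); apply: ft0.
rewrite in_itv/= mulrNz; move: fl; rewrite intrD; lra.
Qed.

Lemma derive_max_eq0 (f : R -> R) l t0 : (forall t, derivable f t 1) -> is_derive t0 1 f l ->
  (forall t, f t <= f t0) -> l = 0.
Proof.
move=> df dl fm; apply: (derive_unique dl).
have ab : t0 - 1 <= t0 + 1 by lra.
by apply: (derive1_at_max ab) => //; rewrite in_itv/=; apply/andP; split; lra.
Qed.

Lemma derive0_constant z : (forall t, is_derive t 1 z (0 : R)) -> forall s t, z s = z t.
Proof. by move=> dz s t; exact: is_derive_0_is_cst s t dz. Qed.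

Lemma duffing_energy a b z p : duffing_solution a b z p -> forall s t,
  p s ^+ 2 + (- a * z s ^+ 2 + - (b / 2) * z s ^+ 4) =
  p t ^+ 2 + (- a * z t ^+ 2 + - (b / 2) * z t ^+ 4).
Proof.
move=> [dz dp]; apply: derive0_constant => t.
apply: (is_derive_eq (is_derive_add (is_derive_exp 1 (dp t)) (is_derive_add
  (is_derive_scale (- a) (is_derive_exp 1 (dz t))) (is_derive_scale (- (b / 2)) (is_derive_exp 3 (dz t)))))).
by field.
Qed.

Lemma sn_duffing h M lam c : 0 <= h < 1 ->
  duffing_solution (- (1 + h) * (lam * jfreq h) ^+ 2) (2 * h * (lam * jfreq h) ^+ 2 / M ^+ 2)
    (fun t => M * sn h (lam * t + c)) (fun t => M * (dsn h (lam * t + c) * lam)).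
Proof.
move=> h01; split=> t.
  apply: is_derive_scale.
  exact: (@is_derive_chain R (sn h) (fun t => lam * t + c) t _ _ (is_derive_sn _ h01) (is_derive_affine _ _ _)).
have d2 := @is_derive_chain R (dsn h) (fun t => lam * t + c) t _ _ (is_derive_dsn _ h01) (is_derive_affine _ _ _).
apply: (is_derive_eq (is_derive_scale M (is_derive_mul d2 (is_derive_const lam t)))).
(* For M = 0 the cubic coefficient is 0 by the convention on division, and both sides vanish. *)
have [->|M0] := eqVneq M 0; first by rewrite !mul0r expr0n/=; ring.
by field.
Qed.

(** Take t0 where z^2 is maximal, with M = z t0, so that p t0 = 0. Conservation of energy shows that
    a nonconstant solution has a + b M^2 < 0, exactly what is needed for a Jacobi sine of amplitude
    M with maximal phase at t0 to solve the equation. It has the same Cauchy data, hence equals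
    z. *)
Theorem duffing_classification a b z p : 0 < b -> periodic z 1 ->
  duffing_solution a b z p ->
  (exists c, forall t, z t = c) \/
  exists h M (k : nat) c, [/\ 0 < h < 1, M != 0, (0 < k)%N,
    forall t, z t = M * sn h (k%:R * t + c) &
    a = - (1 + h) * (k%:R * jfreq h) ^+ 2 /\ b * M ^+ 2 = 2 * h * (k%:R * jfreq h) ^+ 2].
Proof.
move=> b0 pz zp; have [dz dp] := zp.
have cz := is_derive_continuous dz.
have dz2 t := is_derive_exp 1 (dz t).
have [|t0 zt0] := periodic_EVT_max (cont_exp 2 cz); first by move=> t; rewrite pz.
set M := z t0 in zt0.
have zM t : `|z t| <= `|M|.
  by rewrite -(@ler_pXn2r _ 2) ?nnegrE// !real_normK ?num_real.
have [M0|M0] := eqVneq M 0.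
  by left; exists 0 => t; apply/eqP; rewrite -normr_le0; have := zM t; rewrite M0 normr0.
have zpt0 : p t0 = 0.
  have := @derive_max_eq0 (fun t => z t ^+ 2) _ t0 _ (dz2 t0) zt0.
  move=> /(_ (fun t => let: DeriveDef d _ := dz2 t in d)) /eqP.
  by rewrite expr1 !mulf_eq0 pnatr_eq0 (negbTE M0)/= => /eqP.
have M2 : 0 < M ^+ 2 by rewrite exprn_even_gt0.
have energy t : p t ^+ 2 = (z t ^+ 2 - M ^+ 2) * (a + b * (z t ^+ 2 + M ^+ 2) / 2).
  have := duffing_energy zp t t0; rewrite zpt0 -/M => e.
  by rewrite (_ : p t ^+ 2 = - (- a * z t ^+ 2 + - (b / 2) * z t ^+ 4) + (0 ^+ 2 + (- a * M ^+ 2 + - (b / 2) * M ^+ 4))); [field|rewrite -e; ring].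
have [zc|zc] := pselect (forall t, z t ^+ 2 = M ^+ 2).
  left; exists M => t; apply: (@derive0_constant z) => s.
  apply: (is_derive_eq (dz s)).
  have := dz2 s; have -> : (fun t => z t ^+ 2) = (fun=> M ^+ 2) by apply/funext.
  move=> /(derive_unique (is_derive_const (M ^+ 2) s)) /esym/eqP.
  rewrite expr1 !mulf_eq0 pnatr_eq0/= => /orP[|/eqP//].
  by rewrite -sqrf_eq0 zc sqrf_eq0 (negbTE M0).
have [t1 zt1] : exists t1, z t1 ^+ 2 < M ^+ 2.
  apply: contrapT => H; apply: zc => t; apply/eqP; rewrite eq_le zt0/= leNgt.
  by apply/negP => ?; apply: H; exists t.
(* Otherwise the second factor of [energy] would be positive while z^2 is slightly below M^2, making
   p^2 negative there. *)
have aM : a + b * M ^+ 2 <= 0.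
  rewrite leNgt; apply/negP => d0.
  set d := a + b * M ^+ 2 in d0.
  have db : 0 < d / b by rewrite divr_gt0.
  (* The margin d / b is chosen so that a + b (u + M^2) / 2 >= d / 2 > 0; by the intermediate value
     theorem z^2 takes the value u. *)
  have [u [zu Mdu uM]] : exists u, [/\ z t1 ^+ 2 <= u, M ^+ 2 - d / b <= u & u < M ^+ 2].
    exists (Num.max (z t1 ^+ 2) (M ^+ 2 - d / b)).
    by rewrite !le_max !lexx orbT gt_max zt1 ltrBlDr ltrDl.
  have [t zt] : exists t, z t ^+ 2 = u.
    have cz2 : continuous (fun t => z t ^+ 2) by exact: cont_exp.
    have uu : z t1 ^+ 2 <= u <= M ^+ 2 by rewrite zu ltW.
    have [t01|/ltW t01] := leP t0 t1.
      have [||t _ zt] := @IVT R (fun t => z t ^+ 2) t0 t1 u t01.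
      - exact: continuous_subspaceT.
      - case/andP: uu => u1 u2; rewrite ge_min le_max.
        by apply/andP; split; apply/orP; [right; exact: u1|left; exact: u2].
      by exists t.
    have [||t _ zt] := @IVT R (fun t => z t ^+ 2) t1 t0 u t01.
    - exact: continuous_subspaceT.
    - case/andP: uu => u1 u2; rewrite ge_min le_max.
        by apply/andP; split; apply/orP; [left; exact: u1|right; exact: u2].
    by exists t.
  have := sqr_ge0 (p t); rewrite energy zt nmulr_rge0 ?subr_lt0//.
  move: Mdu; have : d / b * b = d by rewrite divfK// gt_eqF.
  move: db; set e := d / b => e0 eb ue.
  have : b * (M ^+ 2 - e) <= b * u by rewrite ler_pM2l.
  rewrite /d in eb d0 *; nra.
(* In case of equality the constant M is a solution with the same Cauchy data at t0, so z would be
   constant. *)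
have aM' : a + b * M ^+ 2 < 0.
  rewrite lt_neqAle aM andbT; apply/eqP => aM0.
  have cs : duffing_solution a b (fun=> M) (fun=> 0).
    split=> t; first exact: is_derive_const.
    apply: (is_derive_eq (is_derive_const 0 t)).
    by rewrite (_ : _ + _ = M * (a + b * M ^+ 2)); [rewrite aM0 mulr0|ring].
  have := duffing_unique zp cs zM (fun=> lexx _) (erefl : z t0 = M) zpt0 t1.
  by move=> e; move: zt1; rewrite e ltxx.
right.
(* Solving a = -(1 + h) om2 and b M^2 = 2 h om2 for om2 and h, as [sn_duffing] requires; the
   condition h < 1 is a + b M^2 < 0. *)
pose om2 := - a - b * M ^+ 2 / 2.
have bM : 0 < b * M ^+ 2 by rewrite mulr_gt0.
have om0 : 0 < om2 by rewrite /om2; lra.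
pose h := b * M ^+ 2 / (2 * om2).
have h01' : 0 < h < 1.
  have om20 : 0 < 2 * om2 by rewrite mulr_gt0.
  apply/andP; split; first exact: divr_gt0.
  by rewrite /h ltr_pdivrMr// mul1r /om2; lra.
have h01 : 0 <= h < 1 by case/andP: h01' => /ltW -> ->.
have J0 := jfreq_gt0 h01.
pose lam := Num.sqrt om2 / jfreq h.
have lam0 : 0 < lam by rewrite divr_gt0// sqrtr_gt0.
have lJ : (lam * jfreq h) ^+ 2 = om2 by rewrite divfK ?gt_eqF// sqr_sqrtr// ltW.
have hE : 2 * h * om2 = b * M ^+ 2 by rewrite /h; field; rewrite gt_eqF.
have aE : a = - (1 + h) * om2.
  by rewrite mulNr mulrDl mul1r (_ : h * om2 = b * M ^+ 2 / 2); [rewrite /om2; ring|rewrite -hE; field].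
have bE : b = 2 * h * om2 / M ^+ 2 by rewrite hE mulfK// gt_eqF.
have [s0 [s1 s2 s3]] := sn_max h01.
have zE : forall t, z t = M * sn h (lam * t + (s0 - lam * t0)).
  have := @sn_duffing h M lam (s0 - lam * t0) h01.
  have e0 : lam * t0 + (s0 - lam * t0) = s0 by ring.
  rewrite lJ -aE -bE => ss; apply: (duffing_unique (t0 := t0) zp ss zM) => [t||].
  - by rewrite normrM ler_piMr// sn_norm_le1.
  - by rewrite e0 s1 mulr1.
  - by rewrite e0 s2 mul0r mulr0.
(* Since z (t0 + 1) = z t0 = M, the Jacobi sine is again maximal after an advance of lam. *)
have [k lk] : exists k : int, lam = k%:~R.
  apply: s3; apply: (mulfI M0); rewrite mulr1.
  have := zE (t0 + 1); rewrite pz -/M => {2}->; congr (_ * sn _ _); ring.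
have k0 : 0 < k by move: lam0; rewrite lk ltr0z.
case: k k0 lk => // k k0 lk.
exists h, M, k, (s0 - lam * t0); split => //.
- by move=> t; rewrite zE lk.
- by move: lJ; rewrite lk => lJ; split; rewrite [(_ * jfreq h) ^+ 2]lJ.
Qed.

End duffing.



(** * The differential of the averaged functional *)

Section differentials.
Context {R : realType} {V : normedModType R}.
Implicit Types (f g df dg L : V -> R) (z v : V).

(** In infinite dimension the differential must be shown continuous as well as linear; one constant
    C bounds both L and the quadratic remainder. The restriction to |v| <= 1 allows higher powers of
    |v| to be absorbed into the square. *)
Lemma is_diff_remainder f L z (C : R) :
  (forall a u v, L (a *: u + v) = a * L u + L v) ->
  (forall v, `|L v| <= C * `|v|) ->
  (forall v, `|v| <= 1 -> `|f (v + z) - f z - L v| <= C * `|v| ^+ 2) ->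
  is_diff z f L.
Proof.
move=> Llin LC fC.
pose L' : {linear V -> R} := HB.pack L (@GRing.isLinear.Build R V R _ L Llin).
have cL : continuous (L' : V -> R).
  apply/linear_bounded_continuous/linear_boundedP.
  apply: filterS (nbhs_pinfty_ge (num_real C)) => r Cr x.
  by apply: (le_trans (LC x)); apply: ler_wpM2r.
have fo : f \o shift z = cst (f z) + (L' : V -> R) +o_ 0 id.
  apply/eqaddoP => e e0.
  have C1 : 0 < `|C| + 1 by rewrite ltr_wpDl.
  have d0 : 0 < e / (`|C| + 1) by rewrite divr_gt0.
  near=> v.
  rewrite [X in `|X|](_ : _ = f (v + z) - f z - L v); last first.
    by rewrite /= opprD addrA.
  have v1 : `|v| <= 1 by near: v; apply: nbhs0_le.
  have vd : `|v| <= e / (`|C| + 1) by near: v; apply: nbhs0_le.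
  apply: (le_trans (fC v v1)); rewrite expr2 mulrA; apply: ler_wpM2r => //.
  move: vd; rewrite ler_pdivlMr// mulrC; apply: le_trans; apply: ler_wpM2r => //.
  by rewrite (le_trans (ler_norm C))// lerDl.
have dL := diff_unique cL fo.
split; last by [].
by apply/diff_locallyP; rewrite dL; split.
Unshelve. all: by end_near. Qed.

Lemma is_diff_ext f g df dg z : (forall v, f v = g v) -> (forall v, df v = dg v) ->
  is_diff z f df -> is_diff z g dg.
Proof. by move=> /funext -> /funext ->. Qed.

Lemma is_diff_add f g df dg z : is_diff z f df -> is_diff z g dg ->
  is_diff z (fun v => f v + g v) (fun v => df v + dg v).
Proof. by move=> hf hg; have := is_diffD hf hg. Qed.

Lemma is_diff_mul f g df dg z : is_diff z f df -> is_diff z g dg ->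
  is_diff z (fun v => f v * g v) (fun v => f z * dg v + g z * df v).
Proof. by move=> hf hg; have := is_diffM hf hg. Qed.

Lemma is_diff_scale (k : R) f df z : is_diff z f df ->
  is_diff z (fun v => k * f v) (fun v => k * df v).
Proof. by move=> hf; have := is_diffZ k hf. Qed.

Lemma is_diff_inv f df z : is_diff z f df -> f z != 0 ->
  is_diff z (fun v => (f v)^-1) (fun v => - (f z ^- 2) * df v).
Proof.
move=> [hf <-] fz; split; first exact: differentiableV.
by rewrite diffV.
Qed.

End differentials.



(** * Mass, energy and quartic integral on the loop space, and their differentials *)

Section loops.
Context {R : realType}.
Implicit Types (z v u : loop_H1 R) (a C : R).

Definition mass z : R := integral01 (fun t => z t ^+ 2).
Definition energy z : R := integral01 (fun t => weak_derivative z t ^+ 2).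
Definition quartic z : R := integral01 (fun t => z t ^+ 4).

Lemma loop_linE a u v t : (a *: u + v) t = a * u t + v t.
Proof. by []. Qed.

Lemma loop_addE u v t : (u + v) t = u t + v t.
Proof. by []. Qed.

Lemma loopP z : [/\ periodic z 1, continuous z & is_weak_derivative z (weak_derivative z)].
Proof. exact: sobolev_H1P (loop_funP z). Qed.

Lemma loop_cont z : continuous z. Proof. by case: (loopP z). Qed.

Arguments loop_cont : clear implicits.

Lemma loop_sqint z : square_integrable z.
Proof. exact: square_integrable_continuous (loop_cont z). Qed.

Lemma loop_dsqint z : square_integrable (weak_derivative z).
Proof. by have [_ _ []] := loopP z. Qed.

Lemma loop_norm_sqr z : `|z| ^+ 2 = mass z + energy z.
Proof.
rewrite -[`|z|]/(H1norm z) H1normE sqr_sqrtr//.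
by apply: addr_ge0; exact: integral01_sqr_ge0.
Qed.

Lemma mass_ge0 z : 0 <= mass z. Proof. exact: integral01_sqr_ge0. Qed.
Lemma energy_ge0 z : 0 <= energy z. Proof. exact: integral01_sqr_ge0. Qed.
Lemma mass_le z : mass z <= `|z| ^+ 2.
Proof. by rewrite loop_norm_sqr lerDl energy_ge0. Qed.
Lemma energy_le z : energy z <= `|z| ^+ 2.
Proof. by rewrite loop_norm_sqr lerDr mass_ge0. Qed.
Lemma quartic_le z : quartic z <= 8 * `|z| ^+ 4.
Proof.
have [pz cz dz] := loopP z; have := integral01_exp4_le cz pz dz.
by rewrite -/(mass z) -/(energy z) -loop_norm_sqr -exprM.
Qed.

Lemma mass_sqr_le z : mass z ^+ 2 <= quartic z.
Proof.
have c2 := cont_exp 2 (loop_cont z).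
have := cauchy_schwarz01 (square_integrable_continuous c2) (square_integrable_continuous (@cont_const R 1)).
under eq_fun do rewrite mulr1.
under [X in _ <= integral01 X * _]eq_fun do rewrite -exprM.
by under [X in _ <= _ * integral01 X]eq_fun do rewrite expr1n; rewrite integral01_cst mulr1.
Qed.

Lemma ler_norm_sqrt (x y m : R) : 0 <= m -> 0 <= y -> x ^+ 2 <= m * y ^+ 2 -> `|x| <= Num.sqrt m * y.
Proof.
move=> m0 y0 xy; rewrite -(@ler_pXn2r _ 2) ?nnegrE ?mulr_ge0 ?sqrtr_ge0//.
by rewrite real_normK ?num_real// exprMn sqr_sqrtr.
Qed.

Lemma pairing_le f v : square_integrable f ->
  `|integral01 (fun t => f t * v t)| <= Num.sqrt (integral01 (fun t => f t ^+ 2)) * `|v|.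
Proof.
move=> sf; apply: ler_norm_sqrt => //; first exact: integral01_sqr_ge0.
apply: (le_trans (cauchy_schwarz01 sf (loop_sqint v))).
by apply: ler_wpM2l (mass_le v); exact: integral01_sqr_ge0.
Qed.

Lemma dpairing_le f v : square_integrable f ->
  `|integral01 (fun t => f t * weak_derivative v t)| <=
  Num.sqrt (integral01 (fun t => f t ^+ 2)) * `|v|.
Proof.
move=> sf; apply: ler_norm_sqrt => //; first exact: integral01_sqr_ge0.
apply: (le_trans (cauchy_schwarz01 sf (loop_dsqint v))).
by apply: ler_wpM2l (energy_le v); exact: integral01_sqr_ge0.
Qed.

Lemma pairing_lin f a u v : square_integrable f ->
  integral01 (fun t => f t * (a *: u + v) t) =
  a * integral01 (fun t => f t * u t) + integral01 (fun t => f t * v t).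
Proof.
move=> sf; rewrite -integral01_lin; [|exact: integ_mul sf (loop_sqint _)..].
by congr integral01; apply/funext => t; rewrite loop_linE; ring.
Qed.

(** [weak_derivative] picks one representative in each class, so linearity holds almost everywhere
    only, which is enough under an integral. *)
Lemma weak_derivative_lin_ae a u v :
  ae_eq (@lebesgue_measure R) `[0%R, 1%R]%classic (weak_derivative (a *: u + v))
    (fun t => a * weak_derivative u t + weak_derivative v t).
Proof.
have [_ _ d] := loopP (a *: u + v); apply: (weak_derivative_unique d).
have [_ cu du] := loopP u; have [_ cv dv] := loopP v.
exact: (is_weak_derivative_lin a cu cv du dv).
Qed.

Lemma dpairing_lin f a u v : square_integrable f ->
  integral01 (fun t => f t * weak_derivative (a *: u + v) t) =
  a * integral01 (fun t => f t * weak_derivative u t) +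
  integral01 (fun t => f t * weak_derivative v t).
Proof.
move=> sf; rewrite -integral01_lin; [|exact: integ_mul sf (loop_dsqint _)..].
under eq_fun do rewrite mulrC.
rewrite (integral01_mul_ae (loop_dsqint _) _ sf (weak_derivative_lin_ae a u v)); last first.
  by apply: square_integrable_linE; exact: loop_dsqint.
by congr integral01; apply/funext => t; ring.
Qed.

Lemma mass_add v z :
  mass (v + z) = mass v + 2 * integral01 (fun t => z t * v t) + mass z.
Proof.
have := integral01_sqr_lin 1 (loop_sqint v) (loop_sqint z).
rewrite /mass (_ : (fun t => (1 * v t + z t) ^+ 2) = (fun t => (v + z) t ^+ 2)); last first.
  by apply/funext => t; rewrite mul1r.
move=> ->; rewrite expr1n !(mul1r, mulr1) addrA; congr (_ + 2 * _ + _).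
by congr integral01; apply/funext => t; rewrite mulrC.
Qed.

Lemma energy_add v z : energy (v + z) =
  energy v + 2 * integral01 (fun t => weak_derivative z t * weak_derivative v t) + energy z.
Proof.
have e := integral01_sqr_lin 1 (loop_dsqint v) (loop_dsqint z).
have ae := weak_derivative_lin_ae 1 v z; rewrite scale1r in ae.
have sl := square_integrable_linE 1 (loop_dsqint v) (loop_dsqint z).
have c : integral01 (fun t => weak_derivative z t * weak_derivative v t) =
    integral01 (fun t => weak_derivative v t * weak_derivative z t).
  by congr integral01; apply/funext => t; rewrite mulrC.
rewrite {1}/energy (integral01_sqr_ae (loop_dsqint _) sl ae) e c.
rewrite -/(energy v) -/(energy z).
by move: (energy v) (energy z) (integral01 _) => x y w; ring.
Qed.

Lemma loop_bounded z : exists2 B, 0 <= B & forall t, 0 <= t <= 1 -> `|z t| <= B.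
Proof.
have cn : continuous (fun t => `|z t|).
  by move=> x; apply: cvg_comp (loop_cont z x) _; exact: norm_continuous.
have [||c _ cM] := @EVT_max R (fun t => `|z t|) 0 1.
- exact: ler01.
- exact: continuous_subspaceT.
by exists `|z c| => // t t01; apply: cM; rewrite in_itv.
Qed.

(** In the expansion of (v + z)^4 the remainder is 6 z^2 v^2 + 4 z v^3 + v^4. Bounding |z| by B and
    |v|^3 by v^2 + v^4 leaves only the integrals of v^2 and v^4, at most |v|^2 and 8 |v|^4 <= 8
    |v|^2, whence the constant 6 B^2 + 4 B + 8 (4 B + 1). *)
Lemma quartic_remainder z : exists2 C, 0 <= C & forall v, `|v| <= 1 ->
  `|quartic (v + z) - quartic z - 4 * integral01 (fun t => z t ^+ 3 * v t)| <= C * `|v| ^+ 2.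
Proof.
have [B B0 zB] := loop_bounded z.
exists (6 * B ^+ 2 + 4 * B * 1 + 4 * B * 8 + 8).
  by rewrite !addr_ge0// ?mulr_ge0// ?exprn_ge0.
move=> v v1; have cz := loop_cont z; have cv := loop_cont v.
have i j k : lebesgue_measure.-integrable `[0%R, 1%R]%classic (EFin \o (fun t => z t ^+ j * v t ^+ k)).
  by apply: continuous_integ; apply: cont_mul; exact: cont_exp.
pose r t := 6 * (z t ^+ 2 * v t ^+ 2) + (4 * (z t * v t ^+ 3) + v t ^+ 4).
have cr : continuous r.
  apply: cont_add; first by apply: cont_scale; apply: cont_mul; exact: cont_exp.
  apply: cont_add; last exact: cont_exp.
  by apply: cont_scale; apply: cont_mul => //; exact: cont_exp.
have -> : quartic (v + z) - quartic z - 4 * integral01 (fun t => z t ^+ 3 * v t) = integral01 r.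
  rewrite /quartic (_ : (fun t => (v + z) t ^+ 4) =
     (fun t => 4 * (z t ^+ 3 * v t) + (r t + z t ^+ 4))); last first.
    by apply/funext => t; rewrite loop_addE /r; ring.
  have c4 : continuous (fun t => z t ^+ 4) by exact: cont_exp.
  rewrite integral01_lin; last 2 first.
  - by apply: continuous_integ; apply: cont_mul => //; exact: cont_exp.
  - by apply: continuous_integ; exact: cont_add.
  by rewrite integral01D; [ring|exact: continuous_integ..].
pose s t := (6 * B ^+ 2 + 4 * B * 1) * v t ^+ 2 + (4 * B + 1) * v t ^+ 4.
have cs : continuous s by apply: cont_add; apply: cont_scale; exact: cont_exp.
have rs t : 0 <= t <= 1 -> `|r t| <= s t.
  move=> /zB; set x := z t; set y := v t => xB.
  have x2 : x ^+ 2 <= B ^+ 2 by rewrite -[leLHS](real_normK (num_real x)) lerXn2r ?nnegrE.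
  have y2 := sqr_ge0 y; have y4 : 0 <= y ^+ 4 by rewrite -[4%N]/(2 * 2)%N exprM sqr_ge0.
  have xy : `|x * y ^+ 3| <= B * (y ^+ 2 + y ^+ 4).
    rewrite normrM; apply: ler_pM => //; rewrite ler_norml.
    have := sqr_ge0 (1 + y); have := sqr_ge0 (1 - y) => s1 s2.
    have y3 : y ^+ 3 = y * y ^+ 2 by ring.
    have y4' : y ^+ 4 = y ^+ 2 * y ^+ 2 by ring.
    by rewrite y3 y4'; apply/andP; split; nra.
  move: xy; rewrite ler_norml => /andP[xy1 xy2].
  have h : x ^+ 2 * y ^+ 2 <= B ^+ 2 * y ^+ 2 by apply: ler_wpM2r.
  have h0 : 0 <= x ^+ 2 * y ^+ 2 by apply: mulr_ge0 => //; exact: sqr_ge0.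
  by rewrite /r /s -/x -/y ler_norml; apply/andP; split; nra.
have r0 : `|integral01 r| <= integral01 (fun t => `|r t|).
  by apply: le_normr_Rintegral => //; exact: continuous_integ.
apply: (le_trans r0).
have rs' : integral01 (fun t => `|r t|) <= integral01 s.
  have cn : continuous (fun t => `|r t|).
    by move=> x; apply: cvg_comp (cr x) _; exact: norm_continuous.
  have ir := continuous_integ cn; have iS := continuous_integ cs.
  by apply: (le_Rintegral _ ir iS) => // t; rewrite /= in_itv/=; exact: rs.
apply: (le_trans rs').
have c2 := cont_exp 2 cv; have c4 := cont_exp 4 cv.
rewrite integral01D; [|by apply: continuous_integ; exact: cont_scale..].
rewrite !integral01Z; [|exact: continuous_integ..].
rewrite -/(mass v) -/(quartic v).
have m := mass_le v; have q := quartic_le v.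
have {}q : quartic v <= 8 * `|v| ^+ 2.
  apply: (le_trans q); rewrite ler_wpM2l// -[4%N]/(2 + 2)%N exprD.
  by rewrite ler_piMl ?sqr_ge0// exprn_ile1.
have vv := sqr_ge0 `|v|.
have h1 : (6 * B ^+ 2 + 4 * B * 1) * mass v <= (6 * B ^+ 2 + 4 * B * 1) * `|v| ^+ 2.
  by apply: ler_wpM2l m; rewrite !addr_ge0// ?mulr_ge0// ?exprn_ge0.
have h2 : (4 * B + 1) * quartic v <= (4 * B + 1) * (8 * `|v| ^+ 2).
  by apply: ler_wpM2l q; rewrite !addr_ge0// ?mulr_ge0.
lra.
Qed.

Local Opaque weak_derivative.

Section projection.
(** An abstract projection treats both components at once; it is instantiated with [fst] and
    [snd]. *)
Variable pr : pair_H1 R -> loop_H1 R.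
Hypothesis pr_lin : forall (a : R) (u v : pair_H1 R), pr (a *: u + v) = a *: pr u + pr v.
Hypothesis pr_le : forall v : pair_H1 R, `|pr v| <= `|v|.

Let prD (u v : pair_H1 R) : pr (u + v) = pr u + pr v.
Proof. by rewrite -[u in LHS]scale1r pr_lin scale1r. Qed.

Let le_pr_sqr (C : R) (v : pair_H1 R) : 0 <= C -> C * `|pr v| ^+ 2 <= C * `|v| ^+ 2.
Proof. by move=> C0; rewrite ler_wpM2l// lerXn2r ?nnegrE. Qed.

Lemma is_diff_mass (z : pair_H1 R) :
  is_diff z (mass \o pr) (fun v : pair_H1 R => 2 * integral01 (fun t => pr z t * pr v t)).
Proof.
have sz := loop_sqint (pr z).
set C := 1 + 2 * Num.sqrt (mass (pr z)).
have C1 : 1 <= C by rewrite lerDl mulr_ge0 ?sqrtr_ge0.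
apply: (@is_diff_remainder _ _ _ _ _ C) => [a u v|v|v v1].
- by rewrite pr_lin pairing_lin//; ring.
- rewrite normrM ger0_norm//; have := pairing_le (pr v) sz => h.
  apply: (@le_trans _ _ (2 * Num.sqrt (mass (pr z)) * `|v|)); last first.
    by rewrite ler_wpM2r// /C lerDr.
  rewrite -mulrA ler_wpM2l//; apply: (le_trans h).
  by rewrite ler_wpM2l ?sqrtr_ge0.
- rewrite /= prD mass_add (_ : _ - _ = mass (pr v)); last by ring.
  rewrite ger0_norm ?mass_ge0//; apply: (le_trans (mass_le _)).
  rewrite -[leLHS]mul1r; apply: (le_trans (le_pr_sqr _ _)) => //.
  by rewrite ler_wpM2r// sqr_ge0.
Qed.

Lemma is_diff_energy (z : pair_H1 R) :
  is_diff z (energy \o pr)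
    (fun v : pair_H1 R => 2 * integral01 (fun t => weak_derivative (pr z) t * weak_derivative (pr v) t)).
Proof.
have sz := loop_dsqint (pr z).
set C := 1 + 2 * Num.sqrt (energy (pr z)).
have C1 : 1 <= C by rewrite lerDl mulr_ge0 ?sqrtr_ge0.
apply: (@is_diff_remainder _ _ _ _ _ C) => [a u v|v|v v1].
- rewrite pr_lin (dpairing_lin a (pr u) (pr v) sz).
  by move: (integral01 _) (integral01 _) => x y; ring.
- rewrite normrM ger0_norm//; have := dpairing_le (pr v) sz => h.
  apply: (@le_trans _ _ (2 * Num.sqrt (energy (pr z)) * `|v|)); last first.
    by rewrite ler_wpM2r// /C lerDr.
  rewrite -mulrA ler_wpM2l//; apply: (le_trans h).
  by rewrite ler_wpM2l ?sqrtr_ge0.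
- rewrite /= prD (energy_add (pr v) (pr z)) (_ : _ - _ = energy (pr v)); last first.
    by move: (energy _) (energy _) (integral01 _) => x y w; ring.
  rewrite ger0_norm ?energy_ge0//; apply: (le_trans (energy_le _)).
  rewrite -[leLHS]mul1r; apply: (le_trans (le_pr_sqr _ _)) => //.
  by rewrite ler_wpM2r// sqr_ge0.
Qed.

Lemma is_diff_quartic (z : pair_H1 R) :
  is_diff z (quartic \o pr) (fun v : pair_H1 R => 4 * integral01 (fun t => pr z t ^+ 3 * pr v t)).
Proof.
have s3 : square_integrable (fun t => pr z t ^+ 3).
  by apply: square_integrable_continuous; apply: cont_exp; exact: loop_cont.
have [C0 C00 zC] := quartic_remainder (pr z).
pose X := integral01 (fun t => (pr z t ^+ 3) ^+ 2).
set C := C0 + 4 * Num.sqrt X.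
have C1 : C0 <= C by rewrite lerDl mulr_ge0 ?sqrtr_ge0.
apply: (@is_diff_remainder _ _ _ _ _ C) => [a u v|v|v v1].
- by rewrite pr_lin pairing_lin//; ring.
- rewrite normrM ger0_norm//; have := pairing_le (pr v) s3 => h.
  apply: (@le_trans _ _ (4 * Num.sqrt X * `|v|)); last first.
    by rewrite ler_wpM2r// /C lerDr.
  rewrite -mulrA ler_wpM2l//; apply: (le_trans h).
  by rewrite ler_wpM2l ?sqrtr_ge0.
- rewrite /= prD; apply: (le_trans (zC _ _)); first exact: le_trans (pr_le _) v1.
  by apply: (le_trans (le_pr_sqr _ _)) => //; rewrite ler_wpM2r// sqr_ge0.
Qed.

End projection.

Lemma pair_norm_fst (v : pair_H1 R) : `|v.1| <= `|v|.
Proof.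
have H (x y : R) : x <= Num.max x y by rewrite le_max lexx.
exact: (H `|v.1| `|v.2|).
Qed.

Lemma pair_norm_snd (v : pair_H1 R) : `|v.2| <= `|v|.
Proof.
have H (x y : R) : y <= Num.max x y by rewrite le_max lexx orbT.
exact: (H `|v.1| `|v.2|).
Qed.

End loops.



(** * Critical points as solutions of Duffing equations *)

Section critical.
Context {R : realType}.
Implicit Types (v u : loop_H1 R) (z w : pair_H1 R) (a b C t : R) (p q : R -> R).

Lemma H1_avP z : H1_av z <-> 0 < mass z.1 /\ 0 < mass z.2.
Proof. by rewrite /H1_av /= /L2norm !sqrtr_gt0. Qed.

Lemma mass_mul u : mass u = integral01 (fun t => u t * u t).
Proof. by congr integral01; apply/funext => t; rewrite expr2. Qed.

Lemma energy_mul u :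
  energy u = integral01 (fun t => weak_derivative u t * weak_derivative u t).
Proof. by congr integral01; apply/funext => t; rewrite expr2. Qed.

Lemma quartic_mul u : quartic u = integral01 (fun t => u t ^+ 3 * u t).
Proof. by congr integral01; apply/funext => t; rewrite -exprSr. Qed.

Local Opaque L2norm weak_derivative.

Lemma B_avE z : B_av z =
  (2 * (mass z.1 * energy z.1) + 2 * (mass z.1)^-1)
  + (2 * (mass z.2 * energy z.2) + 2 * (mass z.2)^-1)
  + -1 * (mass z.1 * mass z.2 * (quartic z.1 * mass z.2 + quartic z.2 * mass z.1)^-1).
Proof.
have q (u : loop_H1 R) : L2norm (fun t => u t ^+ 2) ^+ 2 = quartic u.
  by rewrite L2norm_sqr; congr integral01; apply/funext => t; rewrite -exprM.
have m (u : loop_H1 R) : L2norm u ^+ 2 = mass u by exact: L2norm_sqr.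
have e (u : loop_H1 R) : L2norm (weak_derivative u) ^+ 2 = energy u by exact: L2norm_sqr.
pose F (n1 n2 e1 e2 q1 q2 : R) :=
  (2 * n1 * e1 + 2 / n1) + (2 * n2 * e2 + 2 / n2) - n1 * n2 / (q1 * n2 + q2 * n1).
have FE (n1 n2 e1 e2 q1 q2 : R) : F n1 n2 e1 e2 q1 q2 = (2 * (n1 * e1) + 2 * n1^-1)
  + (2 * (n2 * e2) + 2 * n2^-1) + -1 * (n1 * n2 * (q1 * n2 + q2 * n1)^-1).
  by rewrite /F; ring.
rewrite -FE; apply: (etrans (_ : _ = F _ _ _ _ _ _) _); first by [].
by congr F; [exact: m|exact: m|exact: e|exact: e|exact: q|exact: q].
Qed.

(* At z the differential of B_av is the sum over i of grad kap z_i, with the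
   common value kap = coupling z: the components interact only through kap. *)
Definition grad (kap : R) (u v : loop_H1 R) : R :=
  4 * energy u * integral01 (fun t => u t * v t)
  + 4 * mass u * integral01 (fun t => weak_derivative u t * weak_derivative v t)
  - 4 * integral01 (fun t => u t * v t) / mass u ^+ 2
  + kap * (4 * integral01 (fun t => u t ^+ 3 * v t) / mass u
           - 2 * quartic u * integral01 (fun t => u t * v t) / mass u ^+ 2).

Local Opaque weak_derivative mass energy quartic.

(** The last term of [B_av] is -1 / (q_1 + q_2) with q_i = quartic / mass, and this is its
    derivative with respect to either q_i. *)
Definition coupling z : R :=
  (mass z.1 * mass z.2 / (quartic z.1 * mass z.2 + quartic z.2 * mass z.1)) ^+ 2.

Lemma quartic_gt0 u : 0 < mass u -> 0 < quartic u.
Proof. by move=> m0; apply: lt_le_trans (mass_sqr_le u); rewrite exprn_gt0. Qed.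

Lemma is_diff_B_av z : H1_av z ->
  is_diff z B_av (fun v : pair_H1 R => grad (coupling z) z.1 v.1 + grad (coupling z) z.2 v.2).
Proof.
move=> /H1_avP[m1 m2].
have q1 := quartic_gt0 m1; have q2 := quartic_gt0 m2.
have dm1 := @is_diff_mass R fst (fun _ _ _ => erefl) pair_norm_fst z.
have dm2 := @is_diff_mass R snd (fun _ _ _ => erefl) pair_norm_snd z.
have de1 := @is_diff_energy R fst (fun _ _ _ => erefl) pair_norm_fst z.
have de2 := @is_diff_energy R snd (fun _ _ _ => erefl) pair_norm_snd z.
have dq1 := @is_diff_quartic R fst (fun _ _ _ => erefl) pair_norm_fst z.
have dq2 := @is_diff_quartic R snd (fun _ _ _ => erefl) pair_norm_snd z.
have n1 : (mass \o fst) z != 0 by rewrite gt_eqF.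
have n2 : (mass \o snd) z != 0 by rewrite gt_eqF.
have dX := is_diff_add (is_diff_mul dq1 dm2) (is_diff_mul dq2 dm1).
have nX : (quartic \o fst) z * (mass \o snd) z + (quartic \o snd) z * (mass \o fst) z != 0.
  by rewrite gt_eqF//= addr_gt0// mulr_gt0.
have dB := is_diff_add (is_diff_add
  (is_diff_add (is_diff_scale 2 (is_diff_mul dm1 de1)) (is_diff_scale 2 (is_diff_inv dm1 n1)))
  (is_diff_add (is_diff_scale 2 (is_diff_mul dm2 de2)) (is_diff_scale 2 (is_diff_inv dm2 n2))))
  (is_diff_scale (-1) (is_diff_mul (is_diff_mul dm1 dm2) (is_diff_inv dX nX))).
apply: is_diff_ext dB => v; first by rewrite B_avE.
move: n1 n2 nX; rewrite /= /grad /coupling => n1 n2 nX.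
move: (integral01 (fun t => z.1 t * v.1 t)) (integral01 (fun t => z.2 t * v.2 t))
  (integral01 (fun t => z.1 t ^+ 3 * v.1 t)) (integral01 (fun t => z.2 t ^+ 3 * v.2 t))
  (integral01 (fun t => weak_derivative z.1 t * weak_derivative v.1 t))
  (integral01 (fun t => weak_derivative z.2 t * weak_derivative v.2 t)).
move: (mass z.1) (mass z.2) (energy z.1) (energy z.2) (quartic z.1) (quartic z.2) n1 n2 nX.
by move=> N1 N2 D1 D2 Q1 Q2 n1 n2 nX *; field; rewrite n1 n2 nX.
Qed.

(** Increments (v, 0) and (0, v) separate the two components, since [grad] vanishes on the zero
    increment. *)
Lemma critical_loop_pairP z : critical_loop_pair z <->
  [/\ H1_av z, forall v, grad (coupling z) z.1 v = 0 & forall v, grad (coupling z) z.2 v = 0].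
Proof.
have g0 kap u : grad kap u 0 = 0.
  have z0 f : square_integrable f -> integral01 (fun t => f t * (0 : loop_H1 R) t) = 0.
    by move=> sf; have := pairing_lin 1 0 0 sf; rewrite scaler0 addr0; lra.
  have d0 f : square_integrable f -> integral01 (fun t => f t * weak_derivative (0 : loop_H1 R) t) = 0.
    by move=> sf; have := dpairing_lin 1 0 0 sf; rewrite scaler0 addr0; lra.
  rewrite /grad z0 ?d0 ?z0; [ring| |exact: loop_dsqint|exact: loop_sqint].
  by apply: square_integrable_continuous; apply: cont_exp; exact: loop_cont.
split=> [[Hz dz d0]|[Hz h1 h2]].
  have [_ dE] := is_diff_B_av Hz.
  split => // v.
    by have := d0 (v, 0); rewrite dE /= g0 addr0.
  by have := d0 (0, v); rewrite dE /= g0 add0r.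
have [dz dE] := is_diff_B_av Hz.
by split => // v; rewrite dE h1 h2 addr0.
Qed.

(** The coefficients of u'' = a u + b u^3, obtained from [grad] on division by 4 mass. They depend
    on u itself through three integrals, which is the source of the algebraic conditions on the
    parameters. *)
Definition lin_coef (kap : R) u : R :=
  energy u / mass u - (mass u ^+ 3)^-1 - kap * quartic u / (2 * mass u ^+ 3).
Definition cub_coef (kap : R) u : R := kap / mass u ^+ 2.

Lemma gradE kap u v : 0 < mass u -> grad kap u v = 4 * mass u *
  (lin_coef kap u * integral01 (fun t => u t * v t)
   + cub_coef kap u * integral01 (fun t => u t ^+ 3 * v t)
   + integral01 (fun t => weak_derivative u t * weak_derivative v t)).
Proof.
by move=> m0; rewrite /grad /lin_coef /cub_coef; field; rewrite gt_eqF.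
Qed.

Lemma cubic_pairing a b u (v : R -> R) : square_integrable v ->
  integral01 (fun t => (a * u t + b * u t ^+ 3) * v t) =
  a * integral01 (fun t => u t * v t) + b * integral01 (fun t => u t ^+ 3 * v t).
Proof.
move=> sv.
have s3 : square_integrable (fun t => u t ^+ 3).
  by apply: square_integrable_continuous; apply: cont_exp; exact: loop_cont.
have i1 := integ_mul (loop_sqint u) sv; have i3 := integ_mul s3 sv.
rewrite -[X in _ + X]integral01Z// -integral01_lin//; last exact: integ_scale.
by congr integral01; apply/funext => t; ring.
Qed.

Lemma cont_cubic a b u : continuous (fun t => a * u t + b * u t ^+ 3).
Proof.
by apply: cont_add; apply: cont_scale; first exact: loop_cont; apply: cont_exp; exact: loop_cont.
Qed.

Arguments cont_cubic : clear implicits.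

(** Every test function is itself a loop, so the vanishing of [grad] contains the weak form of the
    equation and regularity applies. *)
Lemma grad0_duffing kap u : 0 < mass u -> (forall v, grad kap u v = 0) ->
  exists2 p, periodic p 1 & duffing_solution (lin_coef kap u) (cub_coef kap u) u p.
Proof.
move=> m0 g0; have [pu cu du] := loopP u.
have pf : periodic (fun t => lin_coef kap u * u t + cub_coef kap u * u t ^+ 3) 1.
  by move=> t; rewrite pu.
have cf := cont_cubic (lin_coef kap u) (cub_coef kap u) u.
have [|p [pp dup dpp]] := weak_solution_regular cf pf cu pu du; last by exists p.
move=> phi tphi; have [pphi dphi cphi] := test_functionP tphi.
have hphi := sobolev_H1_derive pphi cphi dphi.
have := g0 (LoopH1 hphi); rewrite gradE//= => /eqP.
rewrite mulf_eq0 (gt_eqF (mulr_gt0 _ m0))//= => /eqP.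
have sphi := square_integrable_continuous (test_function_cont tphi).
rewrite cubic_pairing//.
have wphi := is_weak_derivative_derive pphi cphi dphi.
have wphi' := weak_derivativeP wphi.
rewrite (_ : integral01 (fun t => weak_derivative u t * weak_derivative phi t) =
  integral01 (fun t => weak_derivative u t * derive1 phi t)); last first.
  have C (f g : R -> R) : integral01 (fun t => f t * g t) = integral01 (fun t => g t * f t).
    by congr integral01; apply/funext => t; rewrite mulrC.
  rewrite (C _ (weak_derivative phi)) (C _ (derive1 phi)).
  apply: integral01_mul_ae => //; [exact: wphi'.1|exact: wphi.1|exact: du.1|].
  exact: weak_derivative_unique wphi' wphi.
lra.
Qed.

(** The derivative p of u is periodic and continuously differentiable, hence an admissible test
    function for the weak derivative of v: the derivative is moved from v to p. *)
Lemma dpairing_classical u v p q : (forall t, is_derive t 1 u (p t)) -> periodic p 1 ->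
  continuous q -> (forall t, is_derive t 1 p (q t)) ->
  integral01 (fun t => weak_derivative u t * weak_derivative v t) =
  - integral01 (fun t => q t * v t).
Proof.
move=> dup pp cq dp; have [pu cu du] := loopP u; have [pv cv dv] := loopP v.
have cp := is_derive_continuous dp.
have wu := is_weak_derivative_derive pu cp dup.
rewrite (integral01_mul_ae du.1 wu.1 dv.1 (weak_derivative_unique du wu)).
have tp := test_function_derive pp dp cq.
have := dv.2 _ tp; rewrite (derive1_fun dp) => e.
rewrite [in RHS](_ : (fun t => q t * v t) = (fun t => v t * q t)) ?e ?opprK.
  by congr integral01; apply/funext => t; rewrite mulrC.
by apply/funext => t; rewrite mulrC.
Qed.

Lemma duffing_grad0 kap u p : 0 < mass u -> periodic p 1 ->
  duffing_solution (lin_coef kap u) (cub_coef kap u) u p -> forall v, grad kap u v = 0.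
Proof.
move=> m0 pp [dup dp] v; rewrite gradE// (dpairing_classical _ dup pp (cont_cubic _ _ u) dp).
by rewrite cubic_pairing; [ring|exact: loop_sqint].
Qed.

(** The equation paired with u itself. *)
Lemma duffing_energy_mass a b u p : periodic p 1 -> duffing_solution a b u p ->
  energy u = - (a * mass u + b * quartic u).
Proof.
move=> pp [dup dp].
rewrite energy_mul mass_mul quartic_mul.
rewrite (dpairing_classical _ dup pp (cont_cubic _ _ u) dp); congr (- _).
by rewrite cubic_pairing//; exact: loop_sqint.
Qed.

End critical.



(** * Classification of the critical points *)

Section torus_and_signs.
Context {R : realType}.
Implicit Types (z w x : pair_H1 R) (u v : loop_H1 R) (e : bool * bool).

Definition critical_class z : set (set (pair_H1 R)) := sign_orbit (torus_orbit z).

Definition shift_sign z w : Prop := exists e (th1 th2 : R),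
  (forall t, z.1 t = (-1) ^+ e.1 * w.1 (t + th1)) /\
  (forall t, z.2 t = (-1) ^+ e.2 * w.2 (t + th2)).

Lemma loop_scaleE (a : R) u t : (a *: u) t = a * u t.
Proof. by []. Qed.

Lemma sign_changeK e : cancel (@sign_change R e) (sign_change e).
Proof.
by move=> [u v]; rewrite /sign_change /= !scalerA -!expr2 !sqrr_sign !scale1r.
Qed.

Lemma sign_changeD e e' z :
  sign_change e (sign_change e' z) = sign_change (e.1 (+) e'.1, e.2 (+) e'.2) z.
Proof. by rewrite /sign_change /= !scalerA !signr_addb. Qed.

Lemma torus_orbit_shift_sign z w : shift_sign z w -> exists e,
  torus_orbit z = sign_change e @` torus_orbit w.
Proof.
move=> [e [th1 [th2 [h1 h2]]]]; exists e; apply/seteqP; split=> x.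
  move=> [s1 [s2 [x1 x2]]]; exists (sign_change e x); last exact: sign_changeK.
  exists (s1 + th1), (s2 + th2); split=> t.
    by rewrite loop_scaleE x1 h1 mulrA -expr2 sqrr_sign mul1r addrA.
  by rewrite loop_scaleE x2 h2 mulrA -expr2 sqrr_sign mul1r addrA.
move=> [y [s1 [s2 [y1 y2]]] <-]; exists (s1 - th1), (s2 - th2); split=> t.
  by rewrite loop_scaleE y1 h1 -!addrA [- th1 + th1]addNr addr0.
by rewrite loop_scaleE y2 h2 -!addrA [- th2 + th2]addNr addr0.
Qed.

Lemma critical_class_eq z w : shift_sign z w -> critical_class z = critical_class w.
Proof.
move=> /torus_orbit_shift_sign[e zw]; rewrite /critical_class zw.
apply/seteqP; split=> O [e' _ <-].
  exists (e'.1 (+) e.1, e'.2 (+) e.2) => //.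
  by rewrite image_comp; congr image; apply/funext => x; rewrite /= sign_changeD.
exists (e'.1 (+) e.1, e'.2 (+) e.2) => //.
rewrite image_comp; congr image; apply/funext => x; rewrite /= sign_changeD/=.
by rewrite -!addbA !addbb !addbF -surjective_pairing.
Qed.

(** The torus orbit of z belongs to its own class, by the trivial sign change, and contains z, by
    the zero shift; membership in the class of w then unfolds to the claim. *)
Lemma critical_class_inj z w : critical_class z = critical_class w -> shift_sign z w.
Proof.
move=> zw; have : critical_class z (torus_orbit z).
  exists (false, false) => //; rewrite -[RHS]image_id; congr image.
  by apply/funext => -[u v]; rewrite /sign_change/= !expr0 !scale1r.
rewrite zw => -[e _ ezw].
have : torus_orbit z z by exists 0, 0; split=> t; rewrite addr0.
rewrite -ezw => -[y [th1 [th2 [y1 y2]]] <-]; exists e, th1, th2.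
by split=> t; rewrite loop_scaleE ?y1 ?y2.
Qed.

End torus_and_signs.

(** * Algebraic equations for modulus, amplitude and frequency *)

Section parameters.
Context {R : realType}.
Implicit Types (u v : loop_H1 R) (z w : pair_H1 R) (h M c kap : R) (k : nat).

Local Opaque weak_derivative L2norm.

Definition moment_ratio h : R := ellint 2 h / ellint 1 h.

Lemma moment_ratio_gt0 h : 0 <= h < 1 -> 0 < moment_ratio h.
Proof. by move=> h01; rewrite divr_gt0 ?ellint1_gt0 ?ellint2_gt0. Qed.

Lemma moment_ratio_le h h' : 0 <= h -> h <= h' -> h' < 1 -> moment_ratio h <= moment_ratio h'.
Proof.
move=> h0 hh h1.
have h01 : 0 <= h < 1 by rewrite h0 (le_lt_trans hh).
have h01' : 0 <= h' < 1 by rewrite h1 (le_trans h0).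
rewrite /moment_ratio ler_pdivrMr ?ellint1_gt0// mulrAC ler_pdivlMr ?ellint1_gt0//.
exact: ellint_ratio_le.
Qed.

Lemma sn_loop_mass u h M k c : 0 <= h < 1 -> (0 < k)%N ->
  (forall t, u t = M * sn h (k%:R * t + c)) ->
  mass u = M ^+ 2 * (ellint 1 h / ellint 0 h).
Proof.
move=> h01 k0 uE; rewrite -(sn_moment 1 c h01 k0) -integral01Z.
  by congr integral01; apply/funext => t; rewrite uE expr1 exprMn.
apply: continuous_integ; apply: cont_exp; apply: cont_exp.
apply: (@cont_comp R (sn h)); first exact: cont_sn.
by apply: is_derive_continuous => t; exact: is_derive_affine.
Qed.

Lemma sn_loop_quartic u h M k c : 0 <= h < 1 -> (0 < k)%N ->
  (forall t, u t = M * sn h (k%:R * t + c)) ->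
  quartic u = M ^+ 4 * (ellint 2 h / ellint 0 h).
Proof.
move=> h01 k0 uE; rewrite -(sn_moment 2 c h01 k0) -integral01Z.
  by congr integral01; apply/funext => t; rewrite uE exprMn -exprM.
apply: continuous_integ; apply: cont_exp; apply: cont_exp.
apply: (@cont_comp R (sn h)); first exact: cont_sn.
by apply: is_derive_continuous => t; exact: is_derive_affine.
Qed.

Definition sn_critical kap h M k : Prop :=
  [/\ 0 < h < 1, M != 0, (0 < k)%N, kap * M ^+ 4 = 2 * h &
      M ^+ 6 * (2 * pi * k%:R * ellint 1 h) ^+ 2 = 1].

(** Here i0, i1, i2 stand for I_0, I_1, I_2 and N, Q, D for mass, quartic integral and energy.
    Eliminating D and kap from the formula for a gives 1 = -2 a N^3 - (3/2) b N^2 Q. After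
    multiplication by M^2 and substitution of a, b, Q and one factor N, the moment identity
    collapses the right side to om^2 N^2 M^4. *)
Lemma critical_frequency kap h M om i0 i1 i2 N Q D a b :
  M != 0 -> 0 < N -> 0 < i0 ->
  N = M ^+ 2 * (i1 / i0) -> Q = M ^+ 4 * (i2 / i0) ->
  a = D / N - (N ^+ 3)^-1 - kap * Q / (2 * N ^+ 3) -> b = kap / N ^+ 2 ->
  D = - (a * N + b * Q) -> a = - (1 + h) * om ^+ 2 -> b * M ^+ 2 = 2 * h * om ^+ 2 ->
  i0 - 2 * (1 + h) * i1 + 3 * h * i2 = 0 ->
  om ^+ 2 * N ^+ 2 * M ^+ 2 = 1.
Proof.
move=> M0 N0 i00 NE QE aE bE DE aE' bE' id.
have Nn : N != 0 by rewrite gt_eqF.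
have in0 : i0 != 0 by rewrite gt_eqF.
have aN : a * N ^+ 3 = D * N ^+ 2 - 1 - kap * Q / 2 by rewrite aE; field.
have kE : kap = b * N ^+ 2 by rewrite bE; field.
have M2 : M ^+ 2 = 2 * (1 + h) * om ^+ 2 * N ^+ 3 * M ^+ 2 - 3 * h * om ^+ 2 * N ^+ 2 * Q.
  have h1 : 1 = - 2 * a * N ^+ 3 - 3 / 2 * (b * N ^+ 2) * Q.
    transitivity (D * N ^+ 2 - kap * Q / 2 - a * N ^+ 3); first by rewrite aN; ring.
    by rewrite DE kE; field.
  transitivity ((- 2 * a * N ^+ 3 - 3 / 2 * (b * N ^+ 2) * Q) * M ^+ 2).
    by rewrite -h1 mul1r.
  rewrite mulrBl aE' (_ : 3 / 2 * (b * N ^+ 2) * Q * M ^+ 2 = 3 / 2 * N ^+ 2 * Q * (b * M ^+ 2)); last by ring.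
  by rewrite bE'; field.
apply: (mulIf (expf_neq0 2 M0)); rewrite mul1r [RHS]M2.
have iE : 2 * (1 + h) * i1 - 3 * h * i2 = i0 by lra.
transitivity (om ^+ 2 * N ^+ 2 * M ^+ 4 * ((2 * (1 + h) * i1 - 3 * h * i2) / i0)).
  by rewrite iE divff// mulr1; ring.
rewrite (_ : N ^+ 3 = N ^+ 2 * (M ^+ 2 * (i1 / i0))); last by rewrite -NE; ring.
by rewrite QE; field.
Qed.

(* The first alternative is that of a constant loop; it is incompatible with
   kap * (q1 + q2)^2 = 1. *)
Lemma critical_component kap u : 0 < kap -> 0 < mass u ->
  (forall v, grad kap u v = 0) ->
  kap * (quartic u / mass u) ^+ 2 = 2 \/
  exists h M k c, [/\ sn_critical kap h M k,
    forall t, u t = M * sn h (k%:R * t + c) & quartic u / mass u = M ^+ 2 * moment_ratio h].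
Proof.
move=> kap0 m0 g0; have [p pp up] := grad0_duffing m0 g0.
have [pu cu du] := loopP u.
have b0 : 0 < cub_coef kap u by rewrite divr_gt0// exprn_gt0.
have e := duffing_energy_mass pp up.
have [[c uc]|[h [M [k [c [h01' M0 k0 uE [aE bE]]]]]]] := duffing_classification b0 pu up.
  left.
  have mc : mass u = c ^+ 2.
    by rewrite -[RHS]integral01_cst; congr integral01; apply/funext => t; rewrite uc.
  have qc : quartic u = c ^+ 4.
    by rewrite -[RHS]integral01_cst; congr integral01; apply/funext => t; rewrite uc.
  have c0 : c != 0 by move: m0; rewrite mc exprn_even_gt0.
  have [du1 dp] := up.
  have u1 : loop_fun u = fun=> c by apply/funext.
  have p0 t : p t = 0.
    by apply: (derive_unique (du1 t)); rewrite u1; exact: is_derive_const.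
  have f0 : lin_coef kap u * c + cub_coef kap u * c ^+ 3 = 0.
    have := dp 0; rewrite uc (_ : p = fun=> 0); last by apply/funext.
    by move=> h; apply: (derive_unique h); exact: is_derive_const.
  have e0 : energy u = 0.
    rewrite e mc qc (_ : _ + _ = c * (lin_coef kap u * c + cub_coef kap u * c ^+ 3)); last by ring.
    by rewrite f0 mulr0 oppr0.
  (* With zero energy the equation for the constant c reduces to kap c^4 = 2, and here q = c^2. *)
  move: f0; rewrite /lin_coef /cub_coef e0 mc qc.
  rewrite (_ : _ + _ = (kap * c ^+ 4 - 2) / (2 * c ^+ 5)); last by field.
  move=> /eqP; rewrite mulf_eq0 invr_eq0 (negbTE (mulf_neq0 _ _)) ?expf_neq0 ?pnatr_eq0//.
  rewrite orbF subr_eq0 => /eqP <-; rewrite (_ : c ^+ 4 / c ^+ 2 = c ^+ 2); last by field.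
  by rewrite -exprM.
right; exists h, M, k, c.
have h01 : 0 <= h < 1 by case/andP: h01' => /ltW -> ->.
have mE := sn_loop_mass h01 k0 uE.
have qE := sn_loop_quartic h01 k0 uE.
have I0 := ellint0_gt0 h01; have I1 := ellint1_gt0 h01.
have id := ellint_moment_identity h01.
have om1 := @critical_frequency kap h M (k%:R * jfreq h) (ellint 0 h) (ellint 1 h) (ellint 2 h)
  (mass u) (quartic u) (energy u) _ _ M0 m0 I0 mE qE erefl erefl e aE bE id.
split => //.
- split => //.
  + transitivity (cub_coef kap u * M ^+ 2 * mass u ^+ 2 * M ^+ 2).
      by rewrite /cub_coef; field; rewrite gt_eqF.
    transitivity (2 * h * ((k%:R * jfreq h) ^+ 2 * mass u ^+ 2 * M ^+ 2)).
      by rewrite bE; ring.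
    by rewrite om1 mulr1.
  + rewrite -[RHS]om1 mE /jfreq; field; by rewrite gt_eqF.
- by rewrite mE qE /moment_ratio; field; rewrite M0 !gt_eqF.
Qed.

End parameters.



(** * At most one critical class for each pair of winding numbers *)

Section uniqueness.
Context {R : realType}.
Implicit Types (z w : pair_H1 R) (h M c kap : R) (k : nat).

Local Opaque weak_derivative L2norm mass energy quartic.

Lemma sn_critical01 kap h M k : sn_critical kap h M k -> 0 <= h < 1.
Proof. by case=> /andP[/ltW -> ->]. Qed.

(** If h < h', then kap M^4 = 2 h and kap' <= kap give M^4 < M'^4, and I_1 does not decrease. So M^6
    (2 pi k I_1)^2 would strictly increase, although it equals 1 in both cases. *)
Lemma sn_critical_le kap kap' h h' M M' k : 0 < kap' -> kap' <= kap ->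
  sn_critical kap h M k -> sn_critical kap' h' M' k -> h' <= h.
Proof.
move=> kap0 kk cr cr'; rewrite leNgt; apply/negP => hh.
have h01 := sn_critical01 cr; have h01' := sn_critical01 cr'.
case: cr cr' => [/andP[h0 h1] M0 k0 kM e] [/andP[h0' h1'] M0' _ kM' e'].
have II : ellint 1 h <= ellint 1 h' by apply: ellint_le => //; exact: ltW.
have I1 := ellint1_gt0 h01; have p0 := pi_gt0 R.
have kp : 0 < k%:R :> R by rewrite ltr0n.
have M2 : 0 < M ^+ 2 by rewrite exprn_even_gt0.
have M2' : 0 < M' ^+ 2 by rewrite exprn_even_gt0.
have M4 : M ^+ 4 < M' ^+ 4.
  have kp0 : 0 < kap by apply: lt_le_trans kk.
  rewrite -(ltr_pM2l kp0) kM; apply: (@lt_le_trans _ _ (kap' * M' ^+ 4)).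
    by rewrite kM' ltr_pM2l.
  by apply: ler_wpM2r kk; rewrite -[4%N]/(2 * 2)%N exprM sqr_ge0.
have MM : M ^+ 2 < M' ^+ 2.
  by rewrite -(@ltr_pXn2r _ 2) ?nnegrE ?(ltW M2) ?(ltW M2')// -!exprM.
have M6 : M ^+ 6 < M' ^+ 6.
  by rewrite -[6%N]/(2 * 3)%N !exprM ltr_pXn2r ?nnegrE ?(ltW M2) ?(ltW M2').
have X0 : 0 < 2 * pi * k%:R * ellint 1 h by rewrite !mulr_gt0.
have XX : 2 * pi * k%:R * ellint 1 h <= 2 * pi * k%:R * ellint 1 h'.
  by apply: ler_wpM2l II; rewrite !mulr_ge0// ltW.
have M60 : 0 < M' ^+ 6 by rewrite -[6%N]/(2 * 3)%N exprM exprn_gt0.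
have : M ^+ 6 * (2 * pi * k%:R * ellint 1 h) ^+ 2 < M' ^+ 6 * (2 * pi * k%:R * ellint 1 h') ^+ 2.
  apply: (@lt_le_trans _ _ (M' ^+ 6 * (2 * pi * k%:R * ellint 1 h) ^+ 2)).
    by rewrite ltr_pM2r// exprn_gt0.
  by rewrite ler_pM2l// lerXn2r ?nnegrE// ?(ltW X0)// (le_trans (ltW X0)).
by rewrite e e' ltxx.
Qed.

Lemma sn_critical_amplitude kap kap' h M M' k :
  sn_critical kap h M k -> sn_critical kap' h M' k -> M' = M \/ M' = - M.
Proof.
move=> cr cr'; have h01 := sn_critical01 cr.
case: cr cr' => [_ M0 k0 _ e] [_ M0' _ _ e'].
have I1 := ellint1_gt0 h01; have p0 := pi_gt0 R.
have kp : 0 < k%:R :> R by rewrite ltr0n.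
have X0 : 0 < 2 * pi * k%:R * ellint 1 h by rewrite !mulr_gt0.
have M6 : (M ^+ 2) ^+ 3 = (M' ^+ 2) ^+ 3.
  rewrite -!exprM; apply: (mulIf (lt0r_neq0 (exprn_gt0 2 X0))).
  by rewrite -[(2 * 3)%N]/6%N e e'.
have /eqP : M' ^+ 2 = M ^+ 2.
  by apply/eqP; rewrite -(@eqrXn2 _ 3) ?sqr_ge0 ?M6.
by rewrite eqf_sqr => /orP[] /eqP ->; [left|right].
Qed.

Lemma sum_le_eq (a b c d : R) : a <= c -> b <= d -> c + d = a + b -> a = c /\ b = d.
Proof. by move=> *; split; lra. Qed.

(** By symmetry kap' <= kap, so both moduli h_i' are at most h_i. The normalisation then equates two
    sums whose terms compare in the same direction, which forces equality term by term. *)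
Lemma pair_params_unique kap kap' h1 h2 h1' h2' M1 M2 M1' M2' k1 k2 : 0 < kap -> 0 < kap' ->
  sn_critical kap h1 M1 k1 -> sn_critical kap h2 M2 k2 ->
  kap * (M1 ^+ 2 * moment_ratio h1 + M2 ^+ 2 * moment_ratio h2) ^+ 2 = 1 ->
  sn_critical kap' h1' M1' k1 -> sn_critical kap' h2' M2' k2 ->
  kap' * (M1' ^+ 2 * moment_ratio h1' + M2' ^+ 2 * moment_ratio h2') ^+ 2 = 1 ->
  h1' = h1 /\ h2' = h2.
Proof.
wlog kk : kap kap' h1 h2 h1' h2' M1 M2 M1' M2' / kap' <= kap.
  move=> W kap0 kap0' c1 c2 e c1' c2' e'.
  have [kk|/ltW kk] := leP kap' kap; first exact: W kk kap0 kap0' c1 c2 e c1' c2' e'.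
  by have [-> ->] := W _ _ _ _ _ _ _ _ _ _ kk kap0' kap0 c1' c2' e' c1 c2 e.
move=> kap0 kap0' c1 c2 e c1' c2' e'.
have hh1 := sn_critical_le kap0' kk c1 c1'; have hh2 := sn_critical_le kap0' kk c2 c2'.
have [h11 h21] := (sn_critical01 c1, sn_critical01 c2).
have [h11' h21'] := (sn_critical01 c1', sn_critical01 c2').
have r1 := moment_ratio_gt0 h11; have r2 := moment_ratio_gt0 h21.
have r1' := moment_ratio_gt0 h11'; have r2' := moment_ratio_gt0 h21'.
have rr1 : moment_ratio h1' <= moment_ratio h1.
  by case/andP: h11' => ? _; case/andP: h11 => _ ?; exact: moment_ratio_le.
have rr2 : moment_ratio h2' <= moment_ratio h2.
  by case/andP: h21' => ? _; case/andP: h21 => _ ?; exact: moment_ratio_le.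
(* This rescaled squared amplitude satisfies x^2 = 2 h, so it depends on h alone and is increasing
   in it; the coupling disappears from the normalisation, which becomes x_1 r_1 + x_2 r_2 = 1. *)
pose x (k M : R) : R := Num.sqrt k * M ^+ 2.
have x0 (k M : R) : 0 <= x k M by rewrite mulr_ge0 ?sqrtr_ge0 ?sqr_ge0.
have xsq (k h M : R) n : 0 < k -> sn_critical k h M n -> x k M ^+ 2 = 2 * h.
  by move=> k0 [_ _ _ <- _]; rewrite exprMn sqr_sqrtr ?ltW// -exprM.
have xle (k k' h h' M M' : R) n n' : 0 < k -> 0 < k' -> sn_critical k h M n ->
    sn_critical k' h' M' n' -> h' <= h -> x k' M' <= x k M.
  move=> k0 k0' c c' hh; rewrite -(@ler_pXn2r _ 2) ?nnegrE ?x0//.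
  by rewrite (xsq _ _ _ _ k0 c) (xsq _ _ _ _ k0' c') ler_pM2l.
have sum1 (k A B a b : R) : 0 < k -> 0 <= a -> 0 <= b ->
    k * (A ^+ 2 * a + B ^+ 2 * b) ^+ 2 = 1 -> x k A * a + x k B * b = 1.
  move=> k0 a0 b0 E.
  have -> : x k A * a + x k B * b = Num.sqrt k * (A ^+ 2 * a + B ^+ 2 * b) by rewrite /x; ring.
  have S0 : 0 <= A ^+ 2 * a + B ^+ 2 * b.
    by apply: addr_ge0; apply: mulr_ge0 => //; exact: sqr_ge0.
  apply/eqP; rewrite -(@eqrXn2 _ 2 _ _ isT (mulr_ge0 (sqrtr_ge0 k) S0) ler01).
  by rewrite exprMn sqr_sqrtr ?(ltW k0)// E expr1n.
have s := sum1 _ _ _ _ _ kap0 (ltW r1) (ltW r2) e.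
have s' := sum1 _ _ _ _ _ kap0' (ltW r1') (ltW r2') e'.
have l1 := xle _ _ _ _ _ _ _ _ kap0 kap0' c1 c1' hh1.
have l2 := xle _ _ _ _ _ _ _ _ kap0 kap0' c2 c2' hh2.
have p1 : x kap' M1' * moment_ratio h1' <= x kap' M1' * moment_ratio h1 by rewrite ler_wpM2l.
have p2 : x kap' M2' * moment_ratio h2' <= x kap' M2' * moment_ratio h2 by rewrite ler_wpM2l.
have p3 : x kap' M1' * moment_ratio h1 <= x kap M1 * moment_ratio h1 by rewrite ler_pM2r.
have p4 : x kap' M2' * moment_ratio h2 <= x kap M2 * moment_ratio h2 by rewrite ler_pM2r.
have [E1 E2] := sum_le_eq (le_trans p1 p3) (le_trans p2 p4) (etrans s (esym s')).
have e1 : x kap' M1' = x kap M1.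
  by apply: (mulIf (lt0r_neq0 r1)); apply/eqP; rewrite eq_le p3/= -E1.
have e2 : x kap' M2' = x kap M2.
  by apply: (mulIf (lt0r_neq0 r2)); apply/eqP; rewrite eq_le p4/= -E2.
have := xsq _ _ _ _ kap0 c1; rewrite -e1 (xsq _ _ _ _ kap0' c1') => q1.
have := xsq _ _ _ _ kap0 c2; rewrite -e2 (xsq _ _ _ _ kap0' c2') => q2.
have two0 : 2 != 0 :> R by rewrite pnatr_eq0.
by split; exact: (mulfI two0).
Qed.

Lemma coupling_sqr z : H1_av z ->
  coupling z * (quartic z.1 / mass z.1 + quartic z.2 / mass z.2) ^+ 2 = 1.
Proof.
move=> /H1_avP[m1 m2]; have q1 := quartic_gt0 m1; have q2 := quartic_gt0 m2.
rewrite /coupling -exprMn; set X := (X in X ^+ 2).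
suff -> : X = 1 by rewrite expr1n.
have X0 : quartic z.1 * mass z.2 + quartic z.2 * mass z.1 != 0.
  by rewrite gt_eqF// addr_gt0// mulr_gt0.
move: X0 (lt0r_neq0 m1) (lt0r_neq0 m2) @X.
move: (mass z.1) (mass z.2) (quartic z.1) (quartic z.2) => N1 N2 Q1 Q2 X0 n1 n2 /=.
by field; rewrite X0 n1 n2.
Qed.

Lemma coupling_gt0 z : H1_av z -> 0 < coupling z.
Proof.
move=> Hz; have := coupling_sqr Hz; rewrite lt_neqAle sqr_ge0 andbT => e.
by apply/eqP => c0; move: e; rewrite -c0 mul0r => /eqP; rewrite eq_sym oner_eq0.
Qed.

(** k1 and k2 count the full oscillations of the components during one period. The phases c1 and c2
    stay free, being absorbed by the torus. *)
Definition has_windings k1 k2 z : Prop := exists h1 M1 c1 h2 M2 c2,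
  [/\ 0 < coupling z,
      sn_critical (coupling z) h1 M1 k1 /\ (forall t, z.1 t = M1 * sn h1 (k1%:R * t + c1)),
      sn_critical (coupling z) h2 M2 k2 /\ (forall t, z.2 t = M2 * sn h2 (k2%:R * t + c2)) &
      coupling z * (M1 ^+ 2 * moment_ratio h1 + M2 ^+ 2 * moment_ratio h2) ^+ 2 = 1].

Lemma critical_has_windings z : critical_loop_pair z -> exists k1 k2, has_windings k1 k2 z.
Proof.
move=> /critical_loop_pairP[Hz g1 g2]; have /H1_avP[m1 m2] := Hz.
have kap0 := coupling_gt0 Hz; have kapE := coupling_sqr Hz.
have qm (u : loop_H1 R) : 0 < mass u -> 0 < quartic u / mass u.
  by move=> m0; rewrite divr_gt0// quartic_gt0.
(* Constant loops are excluded here: kap a^2 = 2 exceeds kap (a + b)^2 = 1 although a and b are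
   positive. *)
have nc (a b : R) : 0 < a -> 0 < b -> coupling z * (a + b) ^+ 2 = 1 ->
    coupling z * a ^+ 2 <> 2.
  move=> a0 b0 ab a2; have p : 0 < coupling z * (b * (2 * a + b)).
    by rewrite mulr_gt0// mulr_gt0// addr_gt0// mulr_gt0.
  have : coupling z * (a + b) ^+ 2 = coupling z * a ^+ 2 + coupling z * (b * (2 * a + b)) by ring.
  rewrite ab a2; move: p; move: (_ * (_ * _)) => *; lra.
have [/(nc _ _ (qm _ m1) (qm _ m2) kapE)//|[h1 [M1 [k1 [c1 [cr1 z1 r1]]]]]] :=
  critical_component kap0 m1 g1.
have kapE' := kapE; rewrite addrC in kapE'.
have [/(nc _ _ (qm _ m2) (qm _ m1) kapE')//|[h2 [M2 [k2 [c2 [cr2 z2 r2]]]]]] :=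
  critical_component kap0 m2 g2.
exists k1, k2, h1, M1, c1, h2, M2, c2; split => //.
by rewrite -r1 -r2.
Qed.

Lemma sn_shift h M M' c c' k (f g : R -> R) : (0 < k)%N -> M' = M \/ M' = - M ->
  (forall t, f t = M * sn h (k%:R * t + c)) -> (forall t, g t = M' * sn h (k%:R * t + c')) ->
  exists (b : bool) th, forall t, g t = (-1) ^+ b * f (t + th).
Proof.
move=> k0 MM fE gE; have kp : k%:R != 0 :> R by rewrite pnatr_eq0 -lt0n.
have sh t : k%:R * (t + (c' - c) / k%:R) + c = k%:R * t + c' by field.
case: MM => MM; [exists false|exists true]; exists ((c' - c) / k%:R) => t;
  by rewrite fE gE sh MM ?expr0 ?expr1; ring.
Qed.

Lemma has_windings_unique k1 k2 z w : has_windings k1 k2 z -> has_windings k1 k2 w ->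
  critical_class w = critical_class z.
Proof.
move=> [h1 [M1 [c1 [h2 [M2 [c2 [kap0 [cr1 z1] [cr2 z2] e]]]]]]].
move=> [h1' [M1' [c1' [h2' [M2' [c2' [kap0' [cr1' w1] [cr2' w2] e']]]]]]].
have [hE1 hE2] := pair_params_unique kap0 kap0' cr1 cr2 e cr1' cr2' e'.
rewrite hE1 hE2 in cr1' cr2' w1 w2.
have k10 : (0 < k1)%N by case: cr1.
have k20 : (0 < k2)%N by case: cr2.
have [b1 [th1 s1]] := sn_shift k10 (sn_critical_amplitude cr1 cr1') z1 w1.
have [b2 [th2 s2]] := sn_shift k20 (sn_critical_amplitude cr2 cr2') z2 w2.
by apply: critical_class_eq; exists (b1, b2), th1, th2.
Qed.

(** Each pair of winding numbers is sent to its only possible class. Pairs for which none exists go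
    to the default [set0], so the critical set is merely included in the image. *)
Lemma countable_critical_points : countable (critical_points_mod_signs R).
Proof.
pose P (k : nat * nat) (O : set (set (pair_H1 R))) :=
  exists2 z, has_windings k.1 k.2 z & O = critical_class z.
have PE (k : nat * nat) O O' : P k O -> P k O' -> O = O'.
  by move=> [z zk ->] [w wk ->]; exact: has_windings_unique wk zk.
have sub : critical_points_mod_signs R `<=` (fun k : nat * nat => xget set0 [set O | P k O]) @` setT.
  move=> _ [_ [z zc <-] <-]; have [k1 [k2 zk]] := critical_has_windings zc.
  exists (k1, k2) => //; have Pz : P (k1, k2) (critical_class z) by exists z.
  by case: xgetP => [B _ PB| /(_ _ Pz)]//; exact: PE PB Pz.
apply: sub_countable (subset_card_le sub) _.
exact: sub_countable (card_image_le _ _) (countableP _).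
Qed.

End uniqueness.

(** * Infinitely many critical classes on the diagonal *)

Section existence.
Context {R : realType}.
Implicit Types (z w : pair_H1 R) (h M c kap : R) (k : nat).

Local Opaque weak_derivative L2norm mass energy quartic.

Lemma sn_loop h M k : 0 <= h < 1 ->
  exists u : loop_H1 R, forall t, u t = M * sn h (k%:R * t).
Proof.
move=> h01; have [ds dd] := @sn_duffing R h M k%:R 0 h01.
have E t : M * sn h (k%:R * t + 0) = M * sn h (k%:R * t) by rewrite addr0.
have cd := is_derive_continuous dd.
have H : (fun t => M * sn h (k%:R * t + 0)) \in @sobolev_H1 R.
  apply: sobolev_H1_derive cd ds => t.
  by rewrite !addr0 mulrDr mulr1 (periodic_nat (sn_periodic h01)).
by exists (LoopH1 H) => t; rewrite -E.
Qed.

(** The classification read backwards: u solves a Duffing equation by construction, and it remains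
    to check that its coefficients are those prescribed by its own mass, energy, quartic integral
    and coupling. *)
Lemma diagonal_critical h M k (u : loop_H1 R) : 0 < h < 1 ->
  8 * h * ellint 2 h ^+ 2 = ellint 1 h ^+ 2 -> (0 < k)%N ->
  M ^+ 6 * (2 * pi * k%:R * ellint 1 h) ^+ 2 = 1 ->
  (forall t, u t = M * sn h (k%:R * t)) -> critical_loop_pair (u, u).
Proof.
move=> h01' hE k0 ME uE.
have h01 : 0 <= h < 1 by case/andP: h01' => /ltW -> ->.
have h0 : h != 0 by case/andP: h01' => /gt_eqF ->.
have uE0 t : u t = M * sn h (k%:R * t + 0) by rewrite addr0.
have mE := sn_loop_mass h01 k0 uE0; have qE := sn_loop_quartic h01 k0 uE0.
have I0 := ellint0_gt0 h01; have I1 := ellint1_gt0 h01; have I2 := ellint2_gt0 h01.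
have M0 : M != 0.
  by apply/eqP => Z; move: ME; rewrite Z expr0n mul0r => /eqP; rewrite eq_sym oner_eq0.
have i0 := lt0r_neq0 I0; have i1 := lt0r_neq0 I1; have i2 := lt0r_neq0 I2.
have m0 : 0 < mass u by rewrite mE mulr_gt0 ?divr_gt0// exprn_even_gt0.
have Hz : H1_av (u, u) by apply/H1_avP.
pose om := k%:R * jfreq h.
have omE : om ^+ 2 * mass u ^+ 2 * M ^+ 2 = 1.
  by rewrite -[RHS]ME mE /om /jfreq; field.
(* On the diagonal the coupling is (mass / (2 quartic))^2 = I_1^2 / (4 I_2^2 M^4), and the root
   condition 8 h I_2^2 = I_1^2 turns it into the required value. *)
have kapE : coupling (u, u) = 2 * h / M ^+ 4.
  rewrite /coupling /=; have -> : mass u * mass u / (quartic u * mass u + quartic u * mass u) =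
      mass u / (2 * quartic u).
    have q0 := lt0r_neq0 (quartic_gt0 m0).
    by move: (lt0r_neq0 m0) q0; move: (mass u) (quartic u) => N Q n q; rewrite (_ : Q * N + Q * N = 2 * Q * N); [field; rewrite ?n ?q|ring].
  rewrite mE qE.
  transitivity (ellint 1 h ^+ 2 / (4 * ellint 2 h ^+ 2 * M ^+ 4)).
    by field; rewrite M0 i0 i2.
  by rewrite -hE; field; rewrite M0 i2.
have id := ellint_moment_identity h01.
have [ds dd] := @sn_duffing R h M k%:R 0 h01.
rewrite -/om in dd.
have uf : loop_fun u = fun t => M * sn h (k%:R * t + 0) by apply/funext.
set p := fun t => M * (dsn h (k%:R * t + 0) * k%:R) in ds dd.
have pp : periodic p 1.
  by move=> t; rewrite /p !addr0 mulrDr mulr1 (periodic_nat (dsn_periodic h01)).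
have up : duffing_solution (- (1 + h) * om ^+ 2) (2 * h * om ^+ 2 / M ^+ 2) u p.
  by split; rewrite uf.
have eE := duffing_energy_mass pp up.
have n0 := lt0r_neq0 m0.
have aE : lin_coef (coupling (u, u)) u = - (1 + h) * om ^+ 2.
  rewrite /lin_coef eE kapE.
  (* The normalisation [omE] gives every term the common factor om^2; then the moment identity
     removes I_0. *)
  have N3 : (mass u ^+ 3)^-1 = om ^+ 2 * M ^+ 2 / mass u.
    by apply: (mulIf (expf_neq0 3 n0)); rewrite mulVf ?expf_neq0// -[LHS]omE; field.
  have -> : 2 * h / M ^+ 4 * quartic u / (2 * mass u ^+ 3) =
      h / M ^+ 4 * quartic u * (mass u ^+ 3)^-1 by field; rewrite n0 M0.
  rewrite N3 mE qE.
  have i0E : ellint 0 h = 2 * (1 + h) * ellint 1 h - 3 * h * ellint 2 h by lra.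
  transitivity ((1 + h) * om ^+ 2 - 2 * h * om ^+ 2 * (ellint 2 h / ellint 1 h)
    - om ^+ 2 * ((ellint 0 h + h * ellint 2 h) / ellint 1 h)).
    by field; rewrite M0 i0 i1.
  by rewrite i0E; field.
have bE : cub_coef (coupling (u, u)) u = 2 * h * om ^+ 2 / M ^+ 2.
  rewrite /cub_coef kapE.
  rewrite -[LHS]mulr1 -[X in _ * X]omE; field; by rewrite n0 M0.
have g v : grad (coupling (u, u)) u v = 0.
  by apply: (duffing_grad0 m0 pp); rewrite aE bE.
by apply/critical_loop_pairP.
Qed.

Lemma infinite_critical_points : infinite_set (critical_points_mod_signs R).
Proof.
have [h h01' hE] := @ellint_symmetric_root R.
have h01 : 0 <= h < 1 by case/andP: h01' => /ltW -> ->.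
have I1 := ellint1_gt0 h01.
pose X k : R := 2 * pi * k.+1%:R * ellint 1 h.
have X0 k : 0 < X k by rewrite !mulr_gt0 ?pi_gt0 ?ltr0n.
(* The positive cube root of 1 / X k, so that M^6 X^2 = 1. *)
pose M k : R := expR (- ln (X k) / 3).
have M0 k : 0 < M k by exact: expR_gt0.
have M3 k : M k ^+ 3 = (X k)^-1.
  rewrite -expRM_natl (_ : 3%:R * _ = - ln (X k)); last by field.
  by rewrite expRN lnK// posrE.
have /choice[u uE] k : exists u : loop_H1 R, forall t, u t = M k * sn h (k.+1%:R * t).
  exact: sn_loop.
have crit k : critical_loop_pair (u k, u k).
  apply: (diagonal_critical h01' hE (ltn0Sn k) _ (uE k)).
  by rewrite -/(X k) -[6%N]/(3 * 2)%N exprM M3 exprVn mulVf// expf_neq0// gt_eqF.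
have [t0 [st0 _ _]] := sn_max h01.
(* The amplitude M k is the maximum of |u k|, unchanged by shifts and signs. Evaluation at t0 / (k +
   1), where u k equals M k, gives one inequality and symmetry the other; X, hence M, separates the
   indices. *)
have le k l : critical_class (u k, u k) = critical_class (u l, u l) -> M k <= M l.
  move=> /critical_class_inj[[b1 b2] [th1 [th2 [/= e _]]]].
  have k1 : k.+1%:R != 0 :> R by rewrite pnatr_eq0.
  have := e (t0 / k.+1%:R); rewrite !uE [_ * (t0 / _)]mulrC divfK// st0 mulr1 => ->.
  apply: (le_trans (ler_norm _)); rewrite normrM normr_sign mul1r normrM.
  by rewrite (gtr0_norm (M0 l)) ler_piMr ?sn_norm_le1// ltW.
have inj : injective (fun k => critical_class (u k, u k)).
  move=> k l kl; have MM : M k = M l.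
    by apply/eqP; rewrite eq_le; apply/andP; split; apply: le.
  have := M3 k; rewrite MM M3 => /invr_inj.
  have p2 : 2 * pi != 0 :> R by rewrite gt_eqF// mulr_gt0// pi_gt0.
  rewrite /X => /(mulIf (lt0r_neq0 I1)) /(mulfI p2) /eqP.
  by rewrite eqr_nat eqSS => /eqP.
apply/infiniteP; have := @inj_card_eq _ _ setT (fun k => critical_class (u k, u k)) (in2W inj).
rewrite card_eq_sym card_eq_le => /andP[le1 _].
apply: card_le_trans le1 _; apply: subset_card_le => _ [k _ <-].
by exists (torus_orbit (u k, u k)) => //; exists (u k, u k).
Qed.

End existence.

Lemma infinite_positive_rat : infinite_set [set q : rat | 0 < q].
Proof.
have inj : injective (fun n : nat => n.+1%:R : rat).
  by move=> m n /eqP; rewrite eqr_nat => /eqP[].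
apply/infiniteP; have := @inj_card_eq _ _ setT (fun n : nat => n.+1%:R : rat) (in2W inj).
rewrite card_eq_sym card_eq_le => /andP[le1 _].
apply: card_le_trans le1 _; apply: subset_card_le => _ [k _ <-].
by rewrite /= ltr0n.
Qed.

Theorem theorem2 (R : realType) :
  exists f : rat -> set (set (pair_H1 R)),
    set_bij [set q : rat | 0 < q] (critical_points_mod_signs R) f.
Proof.
(* Cantor-Bernstein, each of the two comparisons passing through the natural numbers. *)
apply/card_set_bijP; rewrite card_eq_le; apply/andP; split.
  apply: (@card_le_trans _ _ _ [set: nat]); first exact: countableP.
  by apply/infiniteP; exact: infinite_critical_points.
apply: (@card_le_trans _ _ _ [set: nat]); first exact: countable_critical_points.
by apply/infiniteP; exact: infinite_positive_rat.
Qed.
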